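(* Let $j:(U_{\mathrm{ad}},\|\cdot\|_{L^q(\Omega)})\to\mathbb{R}$ be differentiable on $U_{\mathrm{ad}}$ with respect to feasible variations, with derivative Lipschitz continuous as a mapping $\nabla_R j:(U_{\mathrm{ad}},\|\cdot\|_{L^q(\Omega)})\to L^{q'}(\Omega)$. Let $\bar u$ be a local minimizer of $$\min_u\ j(u)+\mathrm{TV}(u)\quad\text{s.t.}\quad u\in U_{\mathrm{ad}}$$ with respect to $BV(\Omega)\cap L^q(\Omega)$. Then there exist $\bar\sigma\in L^\infty(\Omega;\mathbb{R}^d)$ with $\mathrm{div}\,\bar\sigma\in L^{q'}(\Omega)$, $\bar\lambda^\ell\in L^{q'}(\Omega)$ and $\bar\lambda^u\in L^{q'}(\Omega)$ such that $$\begin{aligned} -\mathrm{div}\,\bar\sigma-\bar\lambda^\ell+\bar\lambda^u&=-\nabla_R j(\bar u),\\ \bar\lambda^\ell&\ge0,\qquad \bar\lambda^u\ge0 \quad\text{a.e.},\\ \int_\Omega\bar\lambda^\ell(u_\ell-\bar u)\,dx&=0,\qquad \int_\Omega\bar\lambda^u(\bar u-u_u)\,dx=0,\\ \|\bar\sigma\|_{L^\infty(\Omega)}&=1,\\ \mathrm{TV}(\bar u)&=-\int_\Omega\bar u\,\mathrm{div}\,\bar\sigma\,dx,\\ \mathrm{TV}(u)-\mathrm{TV}(\bar u)&\ge-\int_\Omega\mathrm{div}\,\bar\sigma\,(u-\bar u)\,dx\quad\text{for all }u\in U_{\mathrm{ad}}. \end{aligned}$$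
   Context: $\Omega\subset\mathbb{R}^d$, $d\ge2$, is a bounded domain with Lipschitz boundary (of class $C^{1,\alpha}$). $0<u_\ell\le u_u$ are fixed scalars, $U_{\mathrm{ad}}=\{u\in BV(\Omega):u_\ell\le u(x)\le u_u\text{ for a.e. }x\in\Omega\}$, and $\mathrm{TV}:L^1(\Omega)\to[0,\infty]$ is the total variation seminorm. Fix $s>2$ and $q>\frac{2s}{s-2}$ (so $2<q<\infty$); $q'=q/(q-1)$. $j$ is differentiable at $u\in U_{\mathrm{ad}}$ with respect to feasible variations (and $\|\cdot\|_{L^q}$) if there is $j'(u)\in(L^q(\Omega))^*$ with $|j(u+\phi)-j(u)-\langle j'(u),\phi\rangle|/\|\phi\|_{L^q}\to0$ as $\phi\to0$ in $L^q$ with $u+\phi\in U_{\mathrm{ad}}$; $\nabla_R j(u)\in L^{q'}(\Omega)$ denotes the representative of $j'(u)$. $\bar u\in U_{\mathrm{ad}}$ is a local minimizer with respect to $BV(\Omega)\cap L^q(\Omega)$ if there is $\rho>0$ such that $j(\bar u)+\mathrm{TV}(\bar u)\le j(u)+\mathrm{TV}(u)$ for all $u\in U_{\mathrm{ad}}$ with $\max\{\mathrm{TV}(u-\bar u),\|u-\bar u\|_{L^q}\}\le\rho$. *)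

(* Defs.v *)
From HB Require Import structures.
From mathcomp Require Import all_boot all_order all_algebra.
From mathcomp Require Import all_classical all_reals all_analysis.
Set Implicit Arguments.
Unset Strict Implicit.
Unset Printing Implicit Defensive.
Import Order.TTheory GRing.Theory Num.Theory.
Import numFieldNormedType.Exports.
Local Open Scope classical_set_scope.
Local Open Scope ring_scope.

(* 'rV[R]_n carries the sigma-algebra generated by the coordinates, as the
   library does for n.-tuple; over R it is the Borel sigma-algebra. *)
Definition rV_display : measure_display -> measure_display.
Proof. exact. Qed.

Section measurable_rV.
Context {R : realType} (n : nat).

Let coors : 'I_n -> 'rV[R]_n -> measurableTypeR R := fun i x => x 0 i.

Let rV_set0 : g_sigma_preimage coors set0.
Proof. exact: sigma_algebra0. Qed.

Let rV_setC A : g_sigma_preimage coors A -> g_sigma_preimage coors (~` A).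
Proof. exact: sigma_algebraC. Qed.

Let rV_bigcup (F : _^nat) : (forall i, g_sigma_preimage coors (F i)) ->
  g_sigma_preimage coors (\bigcup_i (F i)).
Proof. exact: sigma_algebra_bigcup. Qed.

HB.instance Definition _ := @isMeasurable.Build (rV_display default_measure_display)
  'rV[R]_n (g_sigma_preimage coors) rV_set0 rV_setC rV_bigcup.

End measurable_rV.

Lemma measurable_coord (R : realType) n (i : 'I_n) :
  measurable_fun [set: 'rV[R]_n] (fun x : 'rV[R]_n => x 0 i : measurableTypeR R).
Proof.
move=> _ Y mY; rewrite setTI; apply: sub_sigma_algebra => /=.
rewrite -bigcup_seq/=; exists i => /=; first by rewrite mem_index_enum.
by exists Y => //; rewrite setTI.
Qed.

Lemma measurable_fun_rV d (T : measurableType d) (R : realType) n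
    (f : T -> 'rV[R]_n) :
  (forall i, measurable_fun [set: T] (fun x => f x 0 i : measurableTypeR R)) ->
  measurable_fun [set: T] f.
Proof.
move=> mf _ A; rewrite setTI; rewrite /measurable/= => mA.
pose G : set (set 'rV[R]_n) := [set B | measurable (f @^-1` B)].
apply: (mA G); split; first split.
- by rewrite /G/= preimage_set0.
- by move=> B GB; rewrite /G/= setTD -preimage_setC; exact: measurableC.
- by move=> F GF; rewrite /G/= preimage_bigcup; exact: bigcupT_measurable.
- case: n => [|n] in f mf A mA G *; first by rewrite big_ord0.
  rewrite -bigcup_mkord_ord; apply: bigcup_sub => i Ii.
  by move=> _ [B mB <-]; rewrite /G/= setTI; have := mf (inord i) measurableT B mB;
    rewrite setTI.
Qed.

Definition rV_cons (R : realType) n (x : measurableTypeR R * 'rV[R]_n) : 'rV[R]_n.+1 :=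
  row_mx (const_mx x.1 : 'rV[R]_1) x.2.

Lemma rV_cons0 (R : realType) n (x : measurableTypeR R * 'rV[R]_n) :
  rV_cons x 0 ord0 = x.1.
Proof.
rewrite /rV_cons (_ : ord0 = @lshift 1 n ord0); last exact: val_inj.
by rewrite (@row_mxEl _ 1 1 n) mxE.
Qed.

Lemma rV_consS (R : realType) n (x : measurableTypeR R * 'rV[R]_n) (i : 'I_n) :
  rV_cons x 0 (lift ord0 i) = x.2 0 i.
Proof.
rewrite /rV_cons (_ : lift ord0 i = @rshift 1 n i); last exact: val_inj.
by rewrite (@row_mxEr _ 1 1 n).
Qed.

Lemma measurable_rV_cons (R : realType) n : measurable_fun [set: _] (@rV_cons R n).
Proof.
apply: measurable_fun_rV => i; case: (unliftP ord0 i) => [j|] ->.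
  under eq_fun do rewrite rV_consS.
  exact: (measurableT_comp (measurable_coord j) measurable_snd).
by under eq_fun do rewrite rV_cons0; exact: measurable_fst.
Qed.

Section lebesgue_rV_step.
Context {R : realType} (n : nat) (m : {sigma_finite_measure set 'rV[R]_n -> \bar R}).
Local Open Scope ereal_scope.

Definition lebesgue_rV_step : set 'rV[R]_n.+1 -> \bar R :=
  pushforward (@lebesgue_measure R \x m) (@rV_cons R n).

Let step0 : lebesgue_rV_step set0 = 0.
Proof. by rewrite /lebesgue_rV_step /pushforward preimage_set0 measure0. Qed.

Let step_ge0 A : 0 <= lebesgue_rV_step A.
Proof. exact: (measure_ge0 (@lebesgue_measure R \x m)%E). Qed.

Let step_sigma_additive : semi_sigma_additive lebesgue_rV_step.
Proof.
move=> F mF tF mUF; rewrite /lebesgue_rV_step /pushforward preimage_bigcup.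
have mpre A : measurable A -> measurable (@rV_cons R n @^-1` A).
  by move=> mA; rewrite -[X in measurable X]setTI; exact: measurable_rV_cons.
apply: measure_semi_sigma_additive.
- by move=> k; exact: mpre.
- apply/trivIsetP => /= i j _ _ ij; rewrite -preimage_setI.
  by move/trivIsetP : tF => /(_ _ _ _ _ ij) ->//; rewrite preimage_set0.
- by rewrite -preimage_bigcup; exact: mpre.
Qed.

HB.instance Definition _ := isMeasure.Build _ _ _ lebesgue_rV_step
  step0 step_ge0 step_sigma_additive.

Let step_sigma_finite : sigma_finite setT lebesgue_rV_step.
Proof.
have /sigma_finiteP[F [TF ndF Foo]] := sigma_finiteT (@lebesgue_measure R).
have /sigma_finiteP[G [TG ndG Goo]] := sigma_finiteT m.
pose g (v : 'rV[R]_n.+1) : measurableTypeR R * 'rV[R]_n :=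
  (v 0%R ord0, \row_i v 0%R (lift ord0 i)).
have gK : cancel (@rV_cons R n) g.
  move=> [x v]; rewrite /g rV_cons0; congr pair.
  by apply/rowP => i; rewrite mxE rV_consS.
have mg : measurable_fun setT g.
  apply/measurable_fun_pairP; split; first exact: measurable_coord.
  apply: measurable_fun_rV => i; under eq_fun do rewrite mxE.
  exact: measurable_coord.
exists (fun k => g @^-1` (F k `*` G k)).
  rewrite -preimage_bigcup (_ : \bigcup_k _ = setT) ?preimage_setT//.
  rewrite -setXTT TF TG predeqE => -[x y]; split.
    by move=> [k _ []/= ? ?]; split; exists k.
  move=> [/= [k _ Fkx] [l _ Gly]]; exists (maxn k l) => //; split.
  - by move: x Fkx; exact/subsetPset/ndF/leq_maxl.
  - by move: y Gly; exact/subsetPset/ndG/leq_maxr.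
move=> k; have [mF Fk] := Foo k; have [mG Gk] := Goo k.
have mFG : measurable (F k `*` G k) by exact: measurableX.
split; first by rewrite -[X in measurable X]setTI; exact: mg.
rewrite /lebesgue_rV_step /pushforward -comp_preimage.
rewrite (_ : g \o _ = id); last by apply/funext => x /=; rewrite gK.
by rewrite preimage_id product_measure1E// lte_mul_pinfty// ge0_fin_numE.
Qed.

HB.instance Definition _ := Measure_isSigmaFinite.Build _ _ _ lebesgue_rV_step
  step_sigma_finite.

End lebesgue_rV_step.

Fixpoint lebesgue_rV (R : realType) (n : nat) :
    {sigma_finite_measure set 'rV[R]_n -> \bar R} :=
  if n is n'.+1 then lebesgue_rV_step (lebesgue_rV R n') else \d_(0 : 'rV[R]_0).

Lemma lebesgue_rVS (R : realType) (n : nat) (A : set 'rV[R]_n.+1) :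
  lebesgue_rV R n.+1 A =
  (@lebesgue_measure R \x lebesgue_rV R n)%E (@rV_cons R n @^-1` A).
Proof. by []. Qed.

Lemma lebesgue_rV_box (R : realType) (n : nat) (a b : 'I_n -> R) :
  (forall i, a i <= b i) ->
  lebesgue_rV R n [set x | forall i, x 0 i \in `[a i, b i]] =
    (\prod_(i < n) (b i - a i))%:E.
Proof.
elim: n => [|n IH] in a b *; move=> ab.
  rewrite big_ord0 /= diracE mem_set//= => -[]//.
rewrite big_ord_recl EFinM.
rewrite -(IH (a \o lift ord0) (b \o lift ord0)) => [|i]; last exact: ab.
pose I_ i := `[a (lift ord0 i), b (lift ord0 i)].
pose S := [set x : 'rV[R]_n | forall i, x 0 i \in I_ i].
rewrite -/S lebesgue_rVS.
set A : set (measurableTypeR R) := [set` `[a ord0, b ord0]].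
have mS : measurable S.
  rewrite (_ : S = \bigcap_(i : 'I_n) ((fun x => x 0 i) @^-1` [set` I_ i]));
    last first.
    by apply/seteqP; split => x Sx i; [move=> _; exact: Sx|exact: (Sx i I)].
  apply: fin_bigcap_measurable => // i _.
  by rewrite -[X in measurable X]setTI; apply: measurable_coord.
rewrite (_ : _ @^-1` _ = A `*` S); last first.
  apply/seteqP; split => -[x v] /=.
    move=> h; split; first by have := h ord0; rewrite rV_cons0.
    by move=> i; have := h (lift ord0 i); rewrite rV_consS.
  move=> [h1 h2] i; case: (unliftP ord0 i) => [j ->|->]; last by rewrite rV_cons0.
  by rewrite rV_consS; have := h2 j.
have mA : measurable A by exact: measurable_itv.
rewrite (product_measure1E _ _ mA mS); congr (_ * _)%E.
apply: etrans (lebesgue_measure_itv `[a ord0, b ord0]) _ => /=.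
rewrite lte_fin; case: ltP => //.
move=> ba; have := ab ord0; rewrite le_eqVlt ltNge ba orbF => /eqP ->.
by rewrite subrr.
Qed.

Section euclidean.
Context {R : realType}.

(* The library's norm on 'rV[R]_n is the maximum norm. *)
Definition enorm n (x : 'rV[R]_n) : R := Num.sqrt (\sum_(i < n) x 0 i ^+ 2).

Definition partial n (i : 'I_n) (f : 'rV[R]_n -> R) (x : 'rV[R]_n) : R :=
  'D_(delta_mx 0 i) f x.

Fixpoint Ck n (k : nat) (f : 'rV[R]_n -> R) : Prop :=
  if k is k'.+1 then
    (forall x, differentiable f x) /\ (forall i, Ck k' (partial i f))
  else continuous f.

Definition smooth n (f : 'rV[R]_n -> R) := forall k, Ck k f.

Definition compactly_supported n (V : zmodType) (Omega : set 'rV[R]_n)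
    (f : 'rV[R]_n -> V) :=
  compact (closure [set x | f x != 0]) /\ closure [set x | f x != 0] `<=` Omega.

Definition divergence n (phi : 'rV[R]_n -> 'rV[R]_n) (x : 'rV[R]_n) : R :=
  \sum_(i < n) partial i (fun y => phi y 0 i) x.

(* The boundary of Omega is locally, in some rotated coordinates y = x *m Q, the
   graph { y_k = gamma (y without y_k) } of a function gamma of class K, with
   Omega lying above it. *)
Definition graph_boundary n (K : ('rV[R]_n.-1 -> R) -> Prop)
    (Omega : set 'rV[R]_n) :=
  forall x0, (closure Omega `\` interior Omega) x0 ->
  exists (Q : 'M[R]_n) (k : 'I_n) (gamma : 'rV[R]_n.-1 -> R) (r : R),
    [/\ Q *m Q^T = 1%:M, K gamma, 0 < r &
        forall x, enorm (x - x0) < r ->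
          (Omega x <-> gamma (col' k (x *m Q)) < (x *m Q) 0 k)].

Definition lipschitz_function n (f : 'rV[R]_n -> R) :=
  exists L : R, forall x y, `|f x - f y| <= L * enorm (x - y).

Definition C1alpha_function (alpha : R) n (f : 'rV[R]_n -> R) :=
  (forall x, differentiable f x) /\
  exists L : R, forall i x y,
    `|partial i f x - partial i f y| <= L * enorm (x - y) `^ alpha.

(* Bounded domain with Lipschitz boundary, of class C^{1,alpha}; C^{1,alpha}
   implies Lipschitz, both being kept as separate conditions. *)
Definition bounded_domain n (alpha : R) (Omega : set 'rV[R]_n) :=
  [/\ open Omega, connected Omega, Omega !=set0 & bounded_set Omega] /\
  graph_boundary (@lipschitz_function _) Omega /\
  graph_boundary (C1alpha_function alpha (n := _)) Omega.

End euclidean.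

Section function_spaces.
Context {R : realType} {n : nat}.
Variable Omega : set 'rV[R]_n.
Local Notation mu := (lebesgue_rV R n).

(* Elements of L^p(Omega) are represented by functions on 'rV[R]_n, of which only
   the values on Omega matter, up to null sets. *)
Definition LpNorm (p : \bar R) (f : 'rV[R]_n -> R) : \bar R :=
  ('N[mu]_p[(EFin \o f) \_ Omega])%E.

Definition in_Lp (p : \bar R) (f : 'rV[R]_n -> R) : Prop :=
  measurable_fun Omega f /\ (LpNorm p f < +oo)%E.

Definition in_Linfty_vec (sigma : 'rV[R]_n -> 'rV[R]_n) : Prop :=
  (forall i, measurable_fun Omega (fun x => sigma x 0 i)) /\
  (LpNorm +oo (fun x => enorm (sigma x)) < +oo)%E.

Definition ae_on (P : 'rV[R]_n -> Prop) : Prop :=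
  {ae mu, forall x, Omega x -> P x}.

Definition integral_on (f : 'rV[R]_n -> R) : R := (\int[mu]_(x in Omega) f x)%R.

Definition weak_divergence (sigma : 'rV[R]_n -> 'rV[R]_n) (g : 'rV[R]_n -> R) :=
  forall psi, smooth psi -> compactly_supported Omega psi ->
    integral_on (fun x => \sum_(i < n) sigma x 0 i * partial i psi x) =
    - integral_on (fun x => g x * psi x).

Definition TV_test (phi : 'rV[R]_n -> 'rV[R]_n) : Prop :=
  [/\ forall i, Ck 1 (fun x => phi x 0 i),
      compactly_supported Omega phi & forall x, enorm (phi x) <= 1].

Definition TV (u : 'rV[R]_n -> R) : \bar R :=
  ereal_sup [set (integral_on (fun x => u x * divergence phi x))%:E
            | phi in TV_test].

Definition BV (u : 'rV[R]_n -> R) : Prop := in_Lp 1%E u /\ (TV u < +oo)%E.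

Definition Uad (ul uu : R) (u : 'rV[R]_n -> R) : Prop :=
  BV u /\ ae_on (fun x => ul <= u x <= uu).

(* D is (a lift to representatives of) an element of the dual of L^q(Omega). *)
Definition Lq_dual (q : R) (D : ('rV[R]_n -> R) -> R) : Prop :=
  (forall (a : R) f g, in_Lp q%:E f -> in_Lp q%:E g ->
     D (fun x => a * f x + g x) = a * D f + D g) /\
  exists C : R, forall f, in_Lp q%:E f -> (`|D f|%:E <= C%:E * LpNorm q%:E f)%E.

Definition represents (q : R) (g : 'rV[R]_n -> R) (D : ('rV[R]_n -> R) -> R) :=
  in_Lp (q / (q - 1))%:E g /\
  forall f, in_Lp q%:E f -> D f = integral_on (fun x => g x * f x).

Definition feasible_derivative (q : R) (U : ('rV[R]_n -> R) -> Prop)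
    (j : ('rV[R]_n -> R) -> R) (u : 'rV[R]_n -> R) (D : ('rV[R]_n -> R) -> R) :=
  Lq_dual q D /\
  forall eps : R, 0 < eps -> exists2 delta : R, 0 < delta &
    forall phi, in_Lp q%:E phi -> U (fun x => u x + phi x) ->
      (0 < LpNorm q%:E phi < delta%:E)%E ->
      `|j (fun x => u x + phi x) - j u - D phi| / fine (LpNorm q%:E phi) < eps.

Definition local_minimizer (q : R) (U : ('rV[R]_n -> R) -> Prop)
    (j : ('rV[R]_n -> R) -> R) (ubar : 'rV[R]_n -> R) : Prop :=
  U ubar /\
  exists2 rho : R, 0 < rho &
    forall u, U u ->
      (maxe (TV (fun x => u x - ubar x)%R)
            (LpNorm q%:E (fun x => u x - ubar x)%R) <= rho%:E)%E ->
      ((j ubar)%:E + TV ubar <= (j u)%:E + TV u)%E.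

End function_spaces.

(* Main.v *)
(* Differentiating along segments in [Uad] shows that [ubar] minimizes the convex functional
   [u |-> TV u + int g0 u] over [Uad], where [g0] is the gradient at [ubar]. Since truncation
   to [[ul, uu]] does not increase [TV], the box constraint may be relaxed, and one seeks the
   multipliers in the form [th g0^+] and [th g0^-] with [0 <= th <= 1]; then [- div sigma] has
   to be [- (1 - th) g0]. On pairs of a test field [phi] and a weight [th], consider the residual
   [div phi + (1 - th) g0], weighted in L^2 by [1 / (1 + |g0|)], together with the defect of the
   dual value [int th (g0^+ ul - g0^- uu)] from [TV ubar + int g0 ubar]. If both could not be made
   small simultaneously, the projection of the target onto the closure of this convex set would
   produce a feasible function better than [ubar]. Among approximate solutions those of
   nearly least L^2 norm are Cauchy, and their strong limit is [(- sigma, th)]; comparing primal and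
   dual values yields the complementarity relations. This sigma satisfies [|sigma| <= 1] only;
   adding a suitable multiple of a compactly supported divergence-free field makes its norm
   exactly 1, which is where [d >= 2] enters. *)
Require Import Defs.
From HB Require Import structures.
From mathcomp Require Import all_boot all_order all_algebra.
From mathcomp Require Import all_classical all_reals all_analysis.
From mathcomp Require Import measurable_realfun ess_sup_inf ring lra.
Import Order.TTheory GRing.Theory Num.Theory.
Import numFieldNormedType.Exports.
Local Open Scope classical_set_scope.
Local Open Scope ring_scope.
Set Implicit Arguments.
Unset Strict Implicit.
Unset Printing Implicit Defensive.

(** * Integrals of real functions *)

(** The gradient [g0] lies only in L^q', so the residual need not be square integrable. Dividing its
    square by [1 + |g0|] repairs this, because [|resid| <= C (1 + |g0|)]; nothing is lost, because
    the square root of [1 + |g0|] is itself in L^2 and Cauchy-Schwarz turns a small weighted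
    residual into a small one in L^1. Hilbert space geometry then replaces weak compactness: the
    parallelogram law makes nearly minimal points Cauchy, and fast subsequences converge almost
    everywhere. Multipliers of the form [th g0^+], [th g0^-] are dominated by [|g0|], as is the
    divergence, so all three are in L^q' at once. Truncation must be handled for functions whose
    variation is known only by duality. The factor relating the difference quotients of [T o v] to
    those of [v] is merely measurable, and its C^1 approximations have uncontrolled gradients.
    Averaging each component of the test field over a segment of length [h] in its own direction
    turns the divergence into a sum of difference quotients, after which only the size of the field
    matters, not its derivatives. *)

Lemma ler_norm_between (R : realDomainType) (a b x : R) : a <= x <= b -> `|x| <= `|a| + `|b|.
Proof.
move=> /andP[ax xb]; have := ler_norm b; have := ler_norm (- a); rewrite normrN => h1 h2.
have := normr_ge0 a; have := normr_ge0 b => h3 h4.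
by rewrite ler_norml; apply/andP; split; lra.
Qed.

Section real_integrals.
Context d (T : measurableType d) (R : realType).
Variable mu : {measure set T -> \bar R}.
Variables (D : set T) (mD : measurable D).
Implicit Types f g : T -> R.
Local Notation L1 f := (mu.-integrable D (EFin \o f)).
Local Notation I f := (\int[mu]_(x in D) f x).

Lemma L1_measurable f : L1 f -> measurable_fun D f.
Proof. by move=> /integrableP[/measurable_EFinP]. Qed.

Lemma L1_dom f g : measurable_fun D f -> (forall x, D x -> `|f x| <= g x) ->
  L1 g -> L1 f.
Proof.
move=> mf fg; apply: le_integrable => //; first exact/measurable_EFinP.
by move=> x Dx /=; rewrite lee_fin (le_trans (fg _ Dx))// ler_norm.
Qed.

Lemma L1D f g : L1 f -> L1 g -> L1 (fun x => f x + g x).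
Proof. by move=> lf lg; exact: (integrableD mD lf lg). Qed.

Lemma L1Z (k : R) f : L1 f -> L1 (fun x => k * f x).
Proof. by move=> lf; exact: (integrableZl mD k lf). Qed.

Lemma L1N f : L1 f -> L1 (fun x => - f x).
Proof. by move=> lf; exact: (integrableN lf). Qed.

Lemma L1B f g : L1 f -> L1 g -> L1 (fun x => f x - g x).
Proof. by move=> lf lg; apply: L1D => //; exact: L1N. Qed.

Lemma L1_abs f : L1 f -> L1 (fun x => `|f x|).
Proof. exact: integrable_norm. Qed.

Lemma L1_sum n (f : 'I_n -> T -> R) : (forall i, L1 (f i)) ->
  L1 (fun x => \sum_(i < n) f i x).
Proof.
move=> lf; have := @integrable_sum _ _ _ mu D mD _ (index_enum 'I_n) xpredT
  (fun i => EFin \o f i) (fun i _ => lf i).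
by apply: eq_integrable => // x _; rewrite /= sumEFin.
Qed.

Lemma L1_bounded f (M : R) : (mu D < +oo)%E -> measurable_fun D f ->
  (forall x, D x -> `|f x| <= M) -> L1 f.
Proof.
move=> muD mf fM; apply: measurable_bounded_integrable => //.
exists M; split; first exact: num_real.
by move=> N MN x Dx; rewrite /= (le_trans (fM _ Dx))// ltW.
Qed.

Lemma L1Ml f g (M : R) : measurable_fun D f -> (forall x, D x -> `|f x| <= M) ->
  L1 g -> L1 (fun x => f x * g x).
Proof.
move=> mf fM lg; apply: (L1_dom _ _ (L1Z M (L1_abs lg))).
  by apply: measurable_funM => //; exact: L1_measurable.
by move=> x Dx; rewrite normrM ler_wpM2r// fM.
Qed.

Lemma Rint_sum n (f : 'I_n -> T -> R) : (forall i, L1 (f i)) ->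
  I (fun x => \sum_(i < n) f i x) = \sum_(i < n) I (f i).
Proof.
elim: n f => [|n IH] f lf.
  rewrite big_ord0; under eq_Rintegral do rewrite big_ord0.
  by rewrite Rintegral_cst// mul0r.
rewrite big_ord_recl -IH//; under eq_Rintegral do rewrite big_ord_recl.
by rewrite RintegralD//; exact: L1_sum.
Qed.

Lemma Rint_le f g : L1 f -> L1 g -> (forall x, D x -> f x <= g x) -> I f <= I g.
Proof. exact: le_Rintegral. Qed.

Lemma Rint_ae_eq f g : measurable_fun D f -> measurable_fun D g ->
  {ae mu, forall x, D x -> f x = g x} -> I f = I g.
Proof.
move=> mf mg fg; congr fine; apply: ae_eq_integral => //; try exact/measurable_EFinP.
by apply: filterS fg => x h Dx; rewrite h.
Qed.

Lemma L1_ae_eq f g : measurable_fun D g -> {ae mu, forall x, D x -> f x = g x} ->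
  L1 f -> L1 g.
Proof.
move=> mg fg lf; apply/integrableP; split; first exact/measurable_EFinP.
rewrite (@ae_eq_integral _ _ _ mu D (abse \o (EFin \o f)) (abse \o (EFin \o g)))//.
- by case/integrableP: lf.
- by apply: measurableT_comp => //; exact/measurable_EFinP.
- by apply: measurableT_comp => //; exact/measurable_EFinP/L1_measurable.
- by apply: filterS fg => x h Dx /=; rewrite h.
Qed.

Lemma Rint_dct (f_ : (T -> R)^nat) f g : (forall n, measurable_fun D (f_ n)) ->
  measurable_fun D f ->
  {ae mu, forall x, D x -> f_ n x @[n --> \oo] --> f x} ->
  L1 g -> (forall n x, D x -> `|f_ n x| <= g x) ->
  L1 f /\ I (f_ n) @[n --> \oo] --> I f.
Proof.
move=> mf_ mf ff lg fg.
have [|||||lf _ cv] := @dominated_convergence _ _ _ mu D mD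
  (fun n => EFin \o f_ n) (EFin \o f) (EFin \o g).
- by move=> n; exact/measurable_EFinP.
- exact/measurable_EFinP.
- by apply: filterS ff => x h Dx; apply: cvg_EFin; [exact: nearW|exact: h].
- exact: lg.
- by apply: aeW => x n Dx /=; rewrite lee_fin fg.
split => //; move: cv; rewrite -(fineK (integrable_fin_num mD lf)).
exact: fine_cvg.
Qed.

Lemma L1_prod f g : measurable_fun D f -> measurable_fun D g ->
  L1 (fun x => f x ^+ 2) -> L1 (fun x => g x ^+ 2) -> L1 (fun x => f x * g x).
Proof.
move=> mf mg lf lg; apply: (L1_dom _ _ (L1D lf lg)).
  exact: measurable_funM.
move=> x Dx; rewrite -(real_normK (num_real (f x))) -(real_normK (num_real (g x))) normrM.
by have := sqr_ge0 (`|f x| - `|g x|); have := sqr_ge0 (`|f x| + `|g x|); nra.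
Qed.

Lemma L1_sqrD f g : measurable_fun D f -> measurable_fun D g ->
  L1 (fun x => f x ^+ 2) -> L1 (fun x => g x ^+ 2) -> L1 (fun x => (f x + g x) ^+ 2).
Proof.
move=> mf mg lf lg.
have -> : (fun x => (f x + g x) ^+ 2) = (fun x => f x ^+ 2 + (2 * (f x * g x) + g x ^+ 2)).
  by apply/funext => x; ring.
by apply: L1D => //; apply: L1D => //; apply: L1Z; exact: L1_prod.
Qed.

Lemma L1_sqrZ f (k : R) : L1 (fun x => f x ^+ 2) -> L1 (fun x => (k * f x) ^+ 2).
Proof.
move=> lf; have -> : (fun x => (k * f x) ^+ 2) = (fun x => k ^+ 2 * f x ^+ 2).
  by apply/funext => x; rewrite exprMn.
exact: L1Z.
Qed.

Lemma L1_sqrB f g : measurable_fun D f -> measurable_fun D g ->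
  L1 (fun x => f x ^+ 2) -> L1 (fun x => g x ^+ 2) -> L1 (fun x => (f x - g x) ^+ 2).
Proof.
move=> mf mg lf lg; have -> : (fun x => (f x - g x) ^+ 2) = (fun x => (f x + (-1) * g x) ^+ 2).
  by apply/funext => x; rewrite mulN1r.
by apply: L1_sqrD => //; [exact: measurable_funM|exact: L1_sqrZ].
Qed.

Lemma Rint_sqrD f g (k : R) : measurable_fun D f -> measurable_fun D g ->
  L1 (fun x => f x ^+ 2) -> L1 (fun x => g x ^+ 2) ->
  I (fun x => (f x + k * g x) ^+ 2) =
  I (fun x => f x ^+ 2) + 2 * k * I (fun x => f x * g x) + k ^+ 2 * I (fun x => g x ^+ 2).
Proof.
move=> mf mg lf lg; have lfg := L1_prod mf mg lf lg.
transitivity (I (fun x => f x ^+ 2 + (2 * k * (f x * g x) + k ^+ 2 * (g x ^+ 2)))).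
  by apply: eq_Rintegral => x _; ring.
rewrite RintegralD//; last by apply: L1D; exact: L1Z.
by rewrite RintegralD ?RintegralZl ?addrA//; exact: L1Z.
Qed.

(* The Cauchy-Schwarz inequality in the additive form given by AM-GM. *)
Lemma Rint_prod_le f g (eta : R) : 0 < eta ->
  measurable_fun D f -> measurable_fun D g ->
  L1 (fun x => f x ^+ 2) -> L1 (fun x => g x ^+ 2) ->
  I (fun x => `|f x * g x|) <=
  eta^-1 * I (fun x => f x ^+ 2) + eta * I (fun x => g x ^+ 2).
Proof.
move=> e0 mf mg lf lg; rewrite -!RintegralZl// -RintegralD//; try exact: L1Z.
apply: Rint_le; first exact/L1_abs/L1_prod.
  by apply: L1D; exact: L1Z.
move=> x Dx; rewrite normrM -(real_normK (num_real (f x))) -(real_normK (num_real (g x))).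
have := normr_ge0 (f x); have := normr_ge0 (g x).
move: `|f x| `|g x| => a b b0' a0.
have -> : eta^-1 * a ^+ 2 + eta * b ^+ 2 = eta^-1 * (a ^+ 2 + (eta * b) ^+ 2).
  by field; rewrite gt_eqF.
rewrite -(@ler_pM2l _ eta)// mulrA mulVKf ?gt_eqF//.
have b0 : 0 <= eta * b by rewrite mulr_ge0// ltW.
have -> : eta * a * b = a * (eta * b) by ring.
have := sqr_ge0 (a - eta * b); have : 0 <= a * (eta * b) by rewrite mulr_ge0.
nra.
Qed.

End real_integrals.

(** * Nearly minimal points of nested sets closed under midpoints *)

Section nested_minimizers.
Context (R : realType) (X : Type).
Variables (C : nat -> set X) (mid : X -> X -> X) (Q : X -> R) (dist2 : X -> X -> R).

(* Parallelogram argument: the hypothesis on [dist2] makes nearly minimal points Cauchy,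
   without any completeness assumption on [X]. *)
Lemma nested_minimizers (M : R) :
  (forall n, C n.+1 `<=` C n) ->
  (forall n x y, C n x -> C n y -> C n (mid x y)) ->
  (forall x, C 0%N x -> 0 <= Q x) ->
  (forall n, exists2 x, C n x & Q x <= M) ->
  (forall x y, C 0%N x -> C 0%N y ->
     dist2 x y <= 2 * Q x + 2 * Q y - 4 * Q (mid x y)) ->
  exists x_ : nat -> X, [/\ forall n, C n (x_ n),
    (forall e : R, 0 < e -> exists N, forall m n, (N <= m)%N -> (N <= n)%N ->
       dist2 (x_ m) (x_ n) <= e) &
    forall n y, C n y -> Q (x_ n) <= Q y + n.+1%:R^-1].
Proof.
move=> nest Cmid Q0 QM par.
have sub m n : (m <= n)%N -> C n `<=` C m.
  elim: n => [|n IH]; first by rewrite leqn0 => /eqP ->.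
  by rewrite leq_eqVlt ltnS => /predU1P[->//|mn]; apply: subset_trans (IH mn).
have lbQ n : has_lbound [set Q x | x in C n].
  by exists 0 => _ [x Cx <-]; apply: Q0; exact: sub Cx.
have infQ n : has_inf [set Q x | x in C n].
  by split => //; have [x Cx _] := QM n; exists (Q x), x.
pose a n := inf [set Q x | x in C n].
have aQ n x : C n x -> a n <= Q x by move=> Cx; apply: ge_inf => //; exists x.
have aM n : a n <= M by have [x Cx xM] := QM n; exact: le_trans (aQ _ _ Cx) xM.
have nda m n : (m <= n)%N -> a m <= a n.
  move=> mn; apply: lb_le_inf => [|_ [x Cx <-]].
    by have [x Cx _] := QM n; exists (Q x), x.
  by apply: aQ; exact: sub Cx.
have /choice[x_ xP] : forall n, exists x, C n x /\ Q x < a n + n.+1%:R^-1.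
  move=> n; have n0 : 0 < n.+1%:R^-1 :> R by rewrite invr_gt0.
  have [_ [x Cx <-] xa] := inf_adherent n0 (infQ n).
  by exists x.
(* The infima [a n] increase and stay below [M], so they approach their supremum. *)
have supa : has_sup (range a).
  by split; [exists (a 0%N), 0%N|exists M => _ [n _ <-]].
exists x_; split => [n|e e0|n y Cy]; first exact: (xP n).1; last first.
  by have [_ /ltW /le_trans] := xP n; apply; rewrite lerD2r aQ.
(* For [m, n >= N1] the midpoint lies in [C N1], so the squared distance is at most
   [4 (sup a - a N1) + 2 / m.+1 + 2 / n.+1]. The first term and the sum of the other two are each at
   most [e / 2]. *)
have e8 : 0 < e / 8 by rewrite divr_gt0.
have [_ [N1 _ <-] aN1] := sup_adherent e8 supa.
have [N2 _ /(_ N2 (leqnn _)) N2P] : \forall n \near \oo, n.+1%:R^-1 < e / 8.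
  by have := @near_infty_natSinv_lt R (PosNum e8).
exists (maxn N1 N2) => m n; rewrite !geq_max => /andP[N1m N2m] /andP[N1n N2n].
have small k : (N2 <= k)%N -> k.+1%:R^-1 < e / 8.
  move=> N2k; apply: le_lt_trans N2P.
  by rewrite lef_pV2 ?posrE// ler_nat ltnS.
have CNm : C N1 (x_ m) by apply: sub (xP m).1.
have CNn : C N1 (x_ n) by apply: sub (xP n).1.
have C0 k x : C k x -> C 0%N x by exact: sub.
apply: le_trans (par _ _ (C0 _ _ CNm) (C0 _ _ CNn)) _.
have := aQ _ _ (Cmid _ _ _ CNm CNn).
have := (xP m).2; have := (xP n).2; have := small _ N2m; have := small _ N2n.
have : a m <= sup (range a) by apply: ub_le_sup; [case: supa|exists m].
have : a n <= sup (range a) by apply: ub_le_sup; [case: supa|exists n].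
move: (n.+1%:R^-1) (m.+1%:R^-1) => rn rm; move: (sup _) aN1 => L.
lra.
Qed.

End nested_minimizers.

(** * Almost everywhere convergence of fast Cauchy sequences in L^2 *)

Section L2.
Context d (T : measurableType d) (R : realType).
Variable mu : {measure set T -> \bar R}.
Variables (D : set T) (mD : measurable D).
Implicit Types f g : T -> R.
Local Notation L1 f := (mu.-integrable D (EFin \o f)).
Local Notation I f := (\int[mu]_(x in D) f x).

(** The increments are at most [sqrt s / 2 ^ n], hence summable; [s + 1] is a rougher bound that
    needs no square root. *)
Lemma fast_cauchy_cvg (u : R^nat) (s : R) :
  (forall n, 4 ^+ n * (u n.+1 - u n) ^+ 2 <= s) -> cvgn u.
Proof.
move=> us; have s0 : 0 <= s.
  by apply: le_trans (us 0%N); apply: mulr_ge0; rewrite ?sqr_ge0 ?exprn_ge0.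
have bnd n : `|u n.+1 - u n| <= geometric (s + 1) (2^-1) n.
  rewrite /geometric /= exprVn ler_pdivlMr ?exprn_gt0//.
  have := us n; set v := u n.+1 - u n.
  have -> : 4 ^+ n * v ^+ 2 = (`|v| * 2 ^+ n) ^+ 2.
    rewrite exprMn real_normK ?num_real// mulrC; congr (_ * _).
    by rewrite -exprM mulnC exprM; congr (_ ^+ _); rewrite -natrX.
  have : 0 <= `|v| * 2 ^+ n by rewrite mulr_ge0// exprn_ge0.
  by move: (_ * _ ^+ n) => w w0 ws; nra.
have : cvgn (series (telescope u)).
  apply: normed_cvg; apply: (series_le_cvg (v_ := geometric (s + 1) 2^-1)) => [n|n|n|].
  - exact: normr_ge0.
  - by apply: mulr_ge0; [exact: addr_ge0|apply: exprn_ge0; rewrite invr_ge0].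
  - exact: bnd.
  - by apply: is_cvg_geometric_series; rewrite ger0_norm ?invr_ge0// invf_lt1// ltr1n.
move=> cv; have -> : u = (fun n => u 0%N + series (telescope u) n).
  by apply/funext => n; rewrite {1}(@eq_sum_telescope R u n).
by apply: is_cvgD => //; exact: is_cvg_cst.
Qed.

(** The factor [4 ^ n] against [8 ^- n] leaves [2 ^- n]: the series [S] of weighted squared
    increments has a finite integral, hence a finite sum almost everywhere, and [fast_cauchy_cvg]
    applies wherever it is finite. *)
Lemma L2_fast_ae_cvg (F : (T -> R)^nat) :
  (forall n, measurable_fun D (F n)) -> (forall n, L1 (fun x => F n x ^+ 2)) ->
  (forall n, I (fun x => (F n.+1 x - F n x) ^+ 2) <= 8 ^- n) ->
  exists2 f : T -> R, measurable_fun D f & {ae mu, forall x, D x -> F n x @[n --> \oo] --> f x}.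
Proof.
move=> mF lF FF.
pose G n x := 4 ^+ n * (F n.+1 x - F n x) ^+ 2.
have mG n : measurable_fun D (G n).
  by apply: measurable_funM => //; apply: measurable_funX; exact: measurable_funB.
have G0 n x : 0 <= G n x by apply: mulr_ge0; rewrite ?sqr_ge0 ?exprn_ge0.
have lG n : L1 (G n) by apply: L1Z => //; apply: L1_sqrB.
pose S x := (\sum_(n <oo) (G n x)%:E)%E.
have mS : measurable_fun D S.
  apply: ge0_emeasurable_sum => [k x _ _|k _]; first by rewrite lee_fin.
  exact/measurable_EFinP.
have S0 x : (0 <= S x)%E by apply: nneseries_ge0 => n _ _; rewrite lee_fin.
have lS : mu.-integrable D S.
  apply/integrableP; split => //.
  under eq_integral do rewrite gee0_abs//.
  rewrite integral_nneseries//; last 2 first.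
  - by move=> n; exact/measurable_EFinP.
  - by move=> n x _; rewrite lee_fin.
  apply: (@le_lt_trans _ _ (\sum_(n <oo) (geometric 1 (2^-1) n : R)%:E)%E).
    apply: lee_nneseries => [n _ _|n _].
      by apply: integral_ge0 => x _; rewrite lee_fin.
    have -> : (\int[mu]_(x in D) (G n x)%:E)%E = (I (G n))%:E.
      by rewrite /Rintegral fineK// (integrable_fin_num mD (lG n)).
    rewrite lee_fin /G RintegralZl//; last exact: L1_sqrB.
    apply: (@le_trans _ _ (4 ^+ n * 8 ^- n)).
      by rewrite ler_wpM2l ?exprn_ge0.
    by rewrite /geometric/= mul1r (_ : 2^-1 = 4 / 8) ?expr_div_n//; lra.
  have cvg2 : cvgn (series (geometric 1 (2^-1 : R))).
    by apply: is_cvg_geometric_series; rewrite ger0_norm ?invr_ge0// invf_lt1// ltr1n.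
  rewrite (_ : (\sum_(n <oo) _)%E = (limn (series (geometric 1 (2^-1 : R))))%:E) ?ltry//.
  rewrite -EFin_lim//; congr (limn _); apply/funext => n /=.
  by rewrite /series/= -sumEFin.
pose E := D `&` [set x | S x \is a fin_num].
have mE : measurable E by exact: emeasurable_fin_num.
have cvE x : E x -> cvgn (F^~ x).
  move=> [_ Sx]; apply: (@fast_cauchy_cvg _ (fine (S x))) => n.
  rewrite -lee_fin fineK// /S (@nneseriesD1 _ (fun k => (G k x)%:E) n xpredT)//; last first.
    by move=> k _; rewrite lee_fin.
  by rewrite leeDl// nneseries_ge0// => k _ _; rewrite lee_fin.
(* The value 0 off [E] makes this the everywhere limit of the measurable functions [F n * 1_E]. *)
exists (fun x => if x \in E then limn (F^~ x) else 0).
  apply: (@measurable_fun_cvg _ _ _ D (fun n x => F n x * \1_E x)).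
    by move=> n; apply: measurable_funM => //; exact: measurable_indic.
  move=> x Dx; rewrite indicE; case: ifPn => [|_] /=.
    by rewrite inE => Ex; under eq_fun do rewrite mulr1; exact: cvE.
  by under eq_fun do rewrite mulr0; exact: cvg_cst.
apply: filterS (integrable_ae mD lS) => x /= Sx Dx.
have Ex : E x by split => //=; exact: Sx.
by rewrite mem_set//; exact: cvE.
Qed.

Lemma L2_limit (F : (T -> R)^nat) f (e : R) (N : nat) :
  (forall n, measurable_fun D (F n)) -> (forall n, L1 (fun x => F n x ^+ 2)) ->
  measurable_fun D f -> {ae mu, forall x, D x -> F n x @[n --> \oo] --> f x} ->
  (forall n, (N <= n)%N -> I (fun x => (F N x - F n x) ^+ 2) <= e) ->
  L1 (fun x => (F N x - f x) ^+ 2) /\ I (fun x => (F N x - f x) ^+ 2) <= e.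
Proof.
move=> mF lF mf Ff Fe.
pose h n x := ((F N x - F n x) ^+ 2)%:E.
have mh n : measurable_fun D (h n).
  by apply/measurable_EFinP; apply: measurable_funX; exact: measurable_funB.
have h0 n x : D x -> (0 <= h n x)%E by rewrite lee_fin sqr_ge0.
have mg : measurable_fun D (fun x => (F N x - f x) ^+ 2).
  by apply: measurable_funX; exact: measurable_funB.
have le_e : (\int[mu]_(x in D) ((F N x - f x) ^+ 2)%:E <= e%:E)%E.
  (* Fatou's lemma is applied off the null set [Z], where the limit inferior is the pointwise limit.
     Each tail infimum is estimated by its term of index [maxn n N], to which the hypothesis
     applies. *)
  have [Z [mZ Z0 FZ]] := Ff.
  rewrite (ge0_negligible_integral mZ mD _ _ Z0); last 2 first.
  - exact/measurable_EFinP.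
  - by move=> x _; rewrite lee_fin sqr_ge0.
  have mDZ : measurable (D `\` Z) by exact: measurableD.
  have -> : (\int[mu]_(x in D `\` Z) ((F N x - f x) ^+ 2)%:E =
             \int[mu]_(x in D `\` Z) (limn_einf (h^~ x)))%E.
    apply: eq_integral => x; rewrite inE => -[Dx Zx].
    have Fx : F n x @[n --> \oo] --> f x.
      by apply: contrapT => nc; apply/Zx/FZ => /= /(_ Dx).
    have cv : h n x @[n --> \oo] --> ((F N x - f x) ^+ 2)%:E.
      apply: cvg_EFin; first exact: nearW.
      by rewrite /h /=; under eq_fun do rewrite expr2; rewrite expr2; apply: cvgM; apply: cvgB => //; exact: cvg_cst.
    by rewrite is_cvg_limn_einfE; [apply/esym; exact: cvg_lim|apply/cvg_ex; eexists; exact: cv].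
  have mh' n : measurable_fun (D `\` Z) (h n).
    by apply: measurable_funS (mh n) => //; exact: subDsetl.
  have h0' n x : (D `\` Z) x -> (0 <= h n x)%E by move=> [Dx _]; exact: h0.
  apply: le_trans (fatou mu mDZ mh' h0') _.
  rewrite limn_einf_lim; apply: lime_le; first exact: is_cvg_einfs.
  apply: nearW => n.
  apply: (@le_trans _ _ (\int[mu]_(x in D `\` Z) h (maxn n N) x)%E).
    by apply: ereal_inf_lbound; exists (maxn n N) => //=; rewrite leq_maxl.
  apply: (@le_trans _ _ (\int[mu]_(x in D) h (maxn n N) x)%E).
    by apply: ge0_subset_integral => // x Dx; apply: h0.
  have -> : (\int[mu]_(x in D) h (maxn n N) x = (I (fun x => (F N x - F (maxn n N) x) ^+ 2))%:E)%E.
    have lsq : L1 (fun x => (F N x - F (maxn n N) x) ^+ 2) by exact: (L1_sqrB mD (mF N) (mF _) (lF N) (lF _)).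
    by rewrite /Rintegral fineK// (integrable_fin_num mD lsq).
  by rewrite lee_fin Fe// leq_maxr.
have lg : L1 (fun x => (F N x - f x) ^+ 2).
  apply/integrableP; split; first exact/measurable_EFinP.
  apply: le_lt_trans (ltry e); apply: le_trans le_e.
  by under eq_integral do rewrite /= ger0_norm ?sqr_ge0//.
by split=> //; rewrite -lee_fin /Rintegral fineK// (integrable_fin_num mD lg).
Qed.

End L2.

(** * Lebesgue measure on row vectors *)

Section lebesgue_rV_theory.
Context (R : realType) (n : nat).
Local Notation mu := (lebesgue_rV R n).
Implicit Types (x v : 'rV[R]_n) (A : set 'rV[R]_n).

Lemma measurable_rV_box (P : 'I_n -> set R) :
  (forall i, measurable (P i)) -> measurable [set x : 'rV[R]_n | forall i, P i (x 0 i)].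
Proof.
move=> mP; rewrite (_ : [set x | _] =
    \bigcap_(i : 'I_n) ((fun x : 'rV[R]_n => x 0 i) @^-1` P i)); last first.
  by apply/seteqP; split => x Sx i; [move=> _; exact: Sx|exact: (Sx i I)].
apply: fin_bigcap_measurable => // i _.
by rewrite -[X in measurable X]setTI; exact: (measurable_coord i measurableT (mP i)).
Qed.

(** The sigma-algebra is generated by the coordinates, so an open set has to be exhibited as a
    countable union of boxes: those cubes with rational centre and side [2 / k.+1] that it
    contains. *)
Lemma open_measurable_rV A : open A -> measurable A.
Proof.
move=> oA.
pose B (ck : 'rV[rat]_n * nat) := [set x : 'rV[R]_n |
  forall i, `]ratr (ck.1 0 i) - ck.2.+1%:R^-1, ratr (ck.1 0 i) + ck.2.+1%:R^-1[%classic (x 0 i)].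
have -> : A = \bigcup_(ck in [set ck | B ck `<=` A]) B ck.
  apply/seteqP; split => [x Ax|x [ck BA Bx]]; last exact: BA.
  have /nbhs_ballP[e /= e0 eA] : nbhs x A by exact: open_nbhs_nbhs.
  (* Both [x] and any other point of the cube are within [1 / k.+1] of its centre, hence the
     halving. *)
  have e2 : 0 < e / 2 by rewrite divr_gt0.
  have [k _ /(_ k (leqnn _)) ke] : \forall k \near \oo, k.+1%:R^-1 < e / 2.
    by have := @near_infty_natSinv_lt R (PosNum e2).
  have k0 : 0 < k.+1%:R^-1 :> R by rewrite invr_gt0.
  have /choice[c cP] i : exists c : rat, ratr c \in `]x 0 i - k.+1%:R^-1, x 0 i + k.+1%:R^-1[.
    by apply: rat_in_itvoo; rewrite ltrBlDr -addrA ltrDl addr_gt0.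
  exists (\row_i c i, k) => /=.
    move=> y By; apply: eA; split => // i j; rewrite (ord1 i).
    have := By j; have := cP j; rewrite /= !mxE !in_itv/= => /andP[c1 c2] /andP[y1 y2].
    move: ke y1 y2 c1 c2; move: (k.+1%:R^-1) => r ke y1 y2 c1 c2.
    by rewrite /ball/= ltr_norml; apply/andP; split; lra.
  move=> i /=; have := cP i; rewrite !mxE !in_itv/= => /andP[c1 c2].
  by move: c1 c2; move: (k.+1%:R^-1) => r c1 c2; apply/andP; split; lra.
rewrite bigcup_mkcond; apply: countable_bigcupT_measurable => [|ck]; first exact: countableP.
case: ifPn => // _.
by apply: (@measurable_rV_box (fun i => `]ratr (ck.1 0 i) - ck.2.+1%:R^-1, ratr (ck.1 0 i) + ck.2.+1%:R^-1[%classic)) => i.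
Qed.

Lemma continuous_measurable_rV (f : 'rV[R]_n -> R) : continuous f -> measurable_fun setT f.
Proof.
move=> cf; apply: (measurability _ (RGenOpens.measurableE R)).
move=> _ [_ [a [b ->] <-]]; rewrite setTI; apply: open_measurable_rV.
by apply: open_comp => [x _|]; [exact: cf|exact: interval_open].
Qed.

Lemma measurable_rV_shift v : measurable_fun setT (fun x => x + v).
Proof.
apply: measurable_fun_rV => i; under eq_fun do rewrite mxE.
by apply: measurable_funD => //; exact: measurable_coord.
Qed.

End lebesgue_rV_theory.

(** * Translation invariance; measure of bounded and of open sets *)

Section translation.
Context (R : realType).

Let lebesgue_measureD (r : R) (A : set R) : measurable A ->
  pushforward lebesgue_measure ((fun x => x + r) : _ -> measurableTypeR R) A = lebesgue_measure A.
Proof.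
move=> mA.
have mD : measurable_fun setT ((fun x => x + r) : measurableTypeR R -> measurableTypeR R).
  exact: measurable_funD.
apply/esym/lebesgue_measure_unique => //= _ [[a b]] _ <-.
rewrite /pushforward.
rewrite (_ : _ @^-1` _ = `](a - r), (b - r)]%classic); last first.
  by apply/seteqP; split => x /=; rewrite !in_itv/= ltrBlDr lerBrDr.
rewrite !lebesgue_measure_itv/= !lte_fin ltrD2r; case: ifPn => // _.
by rewrite -!EFinB; congr EFin; ring.
Qed.

(** Induction on the dimension: slice by slice, the induction hypothesis absorbs the shift [v'] of
    the remaining coordinates, and the outer integral is invariant because [lebesgue_measure] is
    determined by its values on half-open intervals. *)
Lemma lebesgue_rV_shift n (v : 'rV[R]_n) A : measurable A ->
  lebesgue_rV R n ((fun x => x + v) @^-1` A) = lebesgue_rV R n A.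
Proof.
elim: n v A => [|n IH] v A mA.
  congr (lebesgue_rV R 0 _); apply/seteqP; split => x /=;
  by rewrite (_ : x + v = x)//; apply/rowP => -[].
rewrite !lebesgue_rVS /product_measure1.
set B := @rV_cons R n @^-1` A.
have mB : measurable B by rewrite -[B]setTI; exact: measurable_rV_cons.
pose v' : 'rV[R]_n := \row_i v 0 (lift ord0 i).
pose g := lebesgue_rV R n \o xsection B.
have mg : measurable_fun setT g by exact: measurable_fun_xsection.
have mr : measurable_fun setT ((fun x => x + v 0 0) : measurableTypeR R -> measurableTypeR R).
  exact: measurable_funD.
transitivity (\int[@lebesgue_measure R]_x g ((x : R) + v 0 0)%R)%E.
  apply: eq_integral => x _; rewrite /g /= -[RHS](IH v'); last exact: measurable_xsection.
  have E w : rV_cons (x + v 0 0, w + v') = rV_cons (x, w) + v.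
    apply/rowP => i; rewrite [RHS]mxE; case: (unliftP ord0 i) => [j|] ->.
      by rewrite !rV_consS /= !mxE.
    by rewrite !rV_cons0.
  by congr (lebesgue_rV R n _); apply/seteqP; split => w /=;
    rewrite /xsection /= !inE /B /= E.
rewrite -[LHS](@ge0_integral_pushforward _ _ _ _ _ _ mr lebesgue_measure setT g)//.
by apply: eq_measure_integral => C mC _; exact: lebesgue_measureD.
Qed.

Context (n : nat).
Local Notation mu := (lebesgue_rV R n).

Lemma ge0_integral_rV_shift (v : 'rV[R]_n) (f : 'rV[R]_n -> \bar R) :
  measurable_fun setT f -> (forall x, 0 <= f x)%E ->
  (\int[mu]_x f (x + v)%R = \int[mu]_x f x)%E.
Proof.
move=> mf f0.
rewrite -[LHS](@ge0_integral_pushforward _ _ _ _ _ _ (measurable_rV_shift v) mu setT f)//.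
apply: eq_measure_integral => [|mv C mC _]; first exact: measurable_rV_shift.
  exact: lebesgue_rV_shift.
Qed.

Lemma L1_rV_shift (v : 'rV[R]_n) (f : 'rV[R]_n -> R) :
  mu.-integrable setT (EFin \o f) ->
  mu.-integrable setT (EFin \o (fun x => f (x + v))).
Proof.
move=> /integrableP[mf fi]; apply/integrableP; split.
  exact: (measurableT_comp mf (measurable_rV_shift v)).
rewrite (ge0_integral_rV_shift v (f := fun x => `|(f x)%:E|%E))//.
exact: measurableT_comp.
Qed.

Lemma Rint_rV_shift (v : 'rV[R]_n) (f : 'rV[R]_n -> R) :
  mu.-integrable setT (EFin \o f) ->
  \int[mu]_x f (x + v) = \int[mu]_x f x.
Proof.
move=> lf; congr fine.
have mf := measurable_int _ lf.
rewrite -[LHS](@integral_pushforward _ _ _ _ _ _ (measurable_rV_shift v) mu setT (EFin \o f))//.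
  apply: eq_measure_integral => [|mv C mC _]; first exact: measurable_rV_shift.
  exact: lebesgue_rV_shift.
exact: L1_rV_shift.
Qed.

Lemma coord_le_norm (x : 'rV[R]_n) i : `|x 0 i| <= `|x|.
Proof.
rewrite /Num.norm/= mx_normrE.
exact: (@le_bigmax _ _ _ 0 (fun ij : 'I_1 * 'I_n => `|x ij.1 ij.2|) (0, i)).
Qed.

Lemma bounded_finite_rV (A : set 'rV[R]_n) : measurable A -> bounded_set A -> (mu A < +oo)%E.
Proof.
move=> mA [M [_ MA]].
pose N := Num.max (M + 1) 0.
have N0 : 0 <= N by rewrite le_max lexx orbT.
apply: (@le_lt_trans _ _ (mu [set x | forall i, x 0 i \in `[- N, N]])).
  apply: le_measure; rewrite ?inE//.
    exact: (@measurable_rV_box R n (fun _ => `[- N, N]%classic)).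
  move=> x Ax i; rewrite in_itv/= -ler_norml (le_trans (coord_le_norm x i))//.
  by apply: MA => //; rewrite /N lt_max ltrDl ltr01.
by rewrite lebesgue_rV_box ?ltry// => _; rewrite ge0_cp.
Qed.

Lemma open_gt0_rV (A : set 'rV[R]_n) : open A -> A !=set0 -> (0 < mu A)%E.
Proof.
move=> oA [x Ax].
have /nbhs_ballP[e /= e0 eA] : nbhs x A by exact: open_nbhs_nbhs.
apply: (@lt_le_trans _ _ (mu [set y | forall i, y 0 i \in `[x 0 i - e / 2, x 0 i + e / 2]])).
  rewrite lebesgue_rV_box => [|i]; last by lra.
  by rewrite lte_fin; apply: prodr_gt0 => i _; lra.
apply: le_measure; rewrite ?inE.
- exact: (@measurable_rV_box R n (fun i => `[x 0 i - e / 2, x 0 i + e / 2]%classic)).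
- exact: open_measurable_rV.
- move=> y yx; apply: eA; split => // i j; rewrite (ord1 i).
  have := yx j; rewrite in_itv/= => /andP[y1 y2].
  by rewrite /ball/= ltr_norml; apply/andP; split; lra.
Qed.

End translation.

(** * Calculus of C^1 functions *)

Section C1_calculus.
Context (R : realType) (n : nat).
Implicit Types (f g : 'rV[R]_n -> R) (x v w : 'rV[R]_n) (i : 'I_n).
Local Notation e_ i := (delta_mx 0 i : 'rV[R]_n).

Lemma Ck0 f : continuous f -> Ck 0 f. Proof. by []. Qed.

Lemma partialE i f x : differentiable f x -> partial i f x = 'd f x (e_ i).
Proof. by move=> df; rewrite /partial deriveE. Qed.

Lemma C1_differentiable f x : Ck 1 f -> differentiable f x.
Proof. by case. Qed.

Lemma C1_derivable f x v : Ck 1 f -> derivable f x v.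
Proof. by move=> Cf; apply: diff_derivable; exact: C1_differentiable. Qed.

Lemma C1_continuous f : Ck 1 f -> continuous f.
Proof. by move=> Cf x; apply: differentiable_continuous; exact: C1_differentiable. Qed.

Lemma C1_partial_continuous i f : Ck 1 f -> continuous (partial i f).
Proof. by case. Qed.

Lemma partial_cst i (c : R) x : partial i (fun=> c) x = 0.
Proof. exact: derive_cst. Qed.

Lemma partialD i f g x : Ck 1 f -> Ck 1 g ->
  partial i (fun y => f y + g y) x = partial i f x + partial i g x.
Proof. by move=> Cf Cg; apply: deriveD; exact: C1_derivable. Qed.

Lemma partialM i f g x : Ck 1 f -> Ck 1 g ->
  partial i (fun y => f y * g y) x = f x * partial i g x + g x * partial i f x.
Proof. by move=> Cf Cg; apply: deriveM; exact: C1_derivable. Qed.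

Lemma C1_cst (c : R) : Ck 1 (fun _ : 'rV[R]_n => c).
Proof.
split=> [x|i]; first exact: differentiable_cst.
apply: Ck0; rewrite (_ : partial i _ = fun=> 0); first exact: cst_continuous.
by apply/funext => x; exact: partial_cst.
Qed.

Lemma C1D f g : Ck 1 f -> Ck 1 g -> Ck 1 (fun x => f x + g x).
Proof.
move=> Cf Cg; split=> [x|i]; first by apply: differentiableD; exact: C1_differentiable.
apply: Ck0; rewrite (_ : partial i _ = fun x => partial i f x + partial i g x).
  by move=> x; apply: continuousD; exact: C1_partial_continuous.
by apply/funext => x; exact: partialD.
Qed.

Lemma C1M f g : Ck 1 f -> Ck 1 g -> Ck 1 (fun x => f x * g x).
Proof.
move=> Cf Cg; split=> [x|i]; first by apply: differentiableM; exact: C1_differentiable.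
apply: Ck0; rewrite (_ : partial i _ = fun x => f x * partial i g x + g x * partial i f x).
  move=> x; apply: (@continuousD _ _ _ (fun x => f x * partial i g x) (fun x => g x * partial i f x)).
    by apply: continuousM; [exact: C1_continuous|exact: C1_partial_continuous].
  by apply: continuousM; [exact: C1_continuous|exact: C1_partial_continuous].
by apply/funext => x; exact: partialM.
Qed.

Lemma C1Z (c : R) f : Ck 1 f -> Ck 1 (fun x => c * f x).
Proof. by move=> Cf; apply: C1M => //; exact: C1_cst. Qed.

Lemma partialZ i (c : R) f x : Ck 1 f -> partial i (fun y => c * f y) x = c * partial i f x.
Proof.
by move=> Cf; rewrite partialM ?partial_cst ?mulr0 ?addr0//; exact: C1_cst.
Qed.

Lemma C1_sum m (f : 'I_m -> 'rV[R]_n -> R) : (forall k, Ck 1 (f k)) ->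
  Ck 1 (fun x => \sum_(k < m) f k x).
Proof.
elim: m f => [|m IH] f Cf.
  by under eq_fun do rewrite big_ord0; exact: C1_cst.
by under eq_fun do rewrite big_ord_recl; apply: C1D => //; exact: IH.
Qed.

Lemma partial_sum i m (f : 'I_m -> 'rV[R]_n -> R) x : (forall k, Ck 1 (f k)) ->
  partial i (fun y => \sum_(k < m) f k y) x = \sum_(k < m) partial i (f k) x.
Proof.
elim: m f => [|m IH] f Cf.
  by under eq_fun do rewrite big_ord0; rewrite big_ord0 partial_cst.
under eq_fun do rewrite big_ord_recl.
by rewrite big_ord_recl partialD ?IH//; exact: C1_sum.
Qed.

Lemma partial_shift i v f x : partial i (fun y => f (y + v)) x = partial i f (x + v).
Proof.
rewrite /partial /derive; set F := (fun h : R => _); set G := (fun h : R => _).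
suff -> : F = G by [].
by apply/funext => h; rewrite /F /G /shift /= addrA.
Qed.

Lemma C1_shift v f : Ck 1 f -> Ck 1 (fun x => f (x + v)).
Proof.
move=> Cf; have dv x : differentiable (fun x : 'rV[R]_n => x + v) x.
  by apply: differentiableD; [exact: ex_diff|exact: differentiable_cst].
split=> [x|i].
  by apply: (@differentiable_comp _ _ _ _ (fun x => x + v) f) => //; exact: C1_differentiable.
apply: Ck0; rewrite (_ : partial i _ = partial i f \o (fun x => x + v)); last first.
  by apply/funext => x; rewrite partial_shift.
move=> x; apply: continuous_comp; last exact: C1_partial_continuous.
exact: differentiable_continuous.
Qed.

Lemma partial_coord i j x : partial i (fun y : 'rV[R]_n => y 0 j) x = (i == j)%:R.
Proof.
rewrite /partial /derive; set F := (fun h : R => _).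
have FE : {near 0^', F =1 cst (i == j)%:R}.
  near=> h; rewrite /F /shift /= !mxE addrK eqxx /= /GRing.scale/= mulrA mulVf ?mul1r; first by rewrite eq_sym.
  by near: h; exact: nbhs_dnbhs_neq.
by apply: cvg_lim => //; exact: cvg_near_cst.
Unshelve. all: by end_near. Qed.

Lemma C1_coord j : Ck 1 (fun y : 'rV[R]_n => y 0 j).
Proof.
split=> [x|i]; first exact: differentiable_coord.
apply: Ck0; rewrite (_ : partial i _ = fun=> (i == j)%:R); first exact: cst_continuous.
by apply/funext => x; exact: partial_coord.
Qed.

Lemma partial_comp i (h dh : R -> R) f x : (forall t : R, is_derive t (1 : R) h (dh t)) -> Ck 1 f ->
  partial i (fun y => h (f y)) x = dh (f x) * partial i f x.
Proof.
move=> hh Cf; have dfx := C1_differentiable x Cf.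
have dh1 : differentiable h (f x) by apply/derivable1_diffP; case: (hh (f x)).
rewrite !partialE//; last exact: (@differentiable_comp _ _ _ _ f h).
rewrite (@diff_comp _ _ _ _ f h)//= diff1E//.
by rewrite /= derive1E (@derive_val _ _ _ _ _ _ _ (hh (f x))) /GRing.scale/= mulrC.
Qed.

Lemma C1_comp (h dh : R -> R) f : (forall t : R, is_derive t (1 : R) h (dh t)) -> continuous dh ->
  Ck 1 f -> Ck 1 (fun x => h (f x)).
Proof.
move=> hh cdh Cf; split=> [x|i].
  apply: (@differentiable_comp _ _ _ _ f h); first exact: C1_differentiable.
  by apply/derivable1_diffP; case: (hh (f x)).
apply: Ck0; rewrite (_ : partial i _ = fun x => dh (f x) * partial i f x).
  move=> x; apply: continuousM; last exact: C1_partial_continuous.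
  by apply: (@continuous_comp _ _ _ f dh); [exact: C1_continuous|exact: cdh].
by apply/funext => x; exact: partial_comp.
Qed.

Lemma is_derive_line f x w (r : R) : differentiable f (x + r *: w) ->
  is_derive r 1 (fun t => f (x + t *: w)) ('d f (x + r *: w) w).
Proof.
move=> df.
have E : (fun h : R => h^-1 *: (((fun t => f (x + t *: w)) \o shift r) (h *: 1) - f (x + r *: w)))
    = (fun h : R => h^-1 *: ((f \o shift (x + r *: w)) (h *: w) - f (x + r *: w))).
  apply/funext => h /=; congr (_ *: (f _ - _)).
  by rewrite /shift/= scalerDl addrCA; congr (_ *: w + _); rewrite /GRing.scale/= mulr1.
apply: DeriveDef.
  by rewrite /derivable E; exact: diff_derivable.
by rewrite /derive E -deriveE.
Qed.

Lemma C1_MVT f x w : Ck 1 f ->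
  exists2 c : R, 0 <= c <= 1 & f (x + w) - f x = 'd f (x + c *: w) w.
Proof.
move=> Cf.
have hd (r : R) : is_derive r (1 : R) (fun t : R => f (x + t *: w)) ('d f (x + r *: w) w).
  by apply: is_derive_line; exact: C1_differentiable.
have [|c] := @MVT_segment R _ _ 0 1 ler01 (fun r _ => hd r).
  apply: continuous_subspaceT => r; apply: differentiable_continuous.
  by apply/derivable1_diffP; case: (hd r).
rewrite in_itv/= scale1r scale0r addr0 subr0 mulr1 => c01 ->.
by exists c.
Qed.

Lemma C1_MVT_partial f x i (t : R) : Ck 1 f ->
  exists2 c : R, 0 <= c <= 1 & f (x + t *: e_ i) - f x = t * partial i f (x + (c * t) *: e_ i).
Proof.
move=> Cf; have [c c01 ->] := C1_MVT x (t *: e_ i) Cf.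
exists c => //; rewrite linearZ/= scalerA partialE//; exact: C1_differentiable.
Qed.

Lemma norm_delta_le i (t : R) : `|t *: e_ i| <= `|t|.
Proof.
rewrite normrZ ler_piMr// /Num.norm/= mx_normrE.
apply: bigmax_le => // -[a b] _ /=; rewrite mxE.
by case: (_ && _); rewrite ?normr1 ?normr0.
Qed.

(** By the mean value theorem each quotient is a value of the partial derivative on a shrinking
    segment. *)
Lemma C1_diff_quotient_cvg f x i : Ck 1 f ->
  k.+1%:R * (f (x + k.+1%:R^-1 *: e_ i) - f x) @[k --> \oo] --> partial i f x.
Proof.
move=> Cf.
pose c k := sval (cid2 (C1_MVT_partial x i k.+1%:R^-1 Cf)).
have cP k : 0 <= c k <= 1 by rewrite /c; case: cid2.
have cE k : f (x + k.+1%:R^-1 *: e_ i) - f x = k.+1%:R^-1 * partial i f (x + (c k * k.+1%:R^-1) *: e_ i).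
  by rewrite /c; case: cid2.
under eq_fun => k do rewrite cE mulrA mulfV ?pnatr_eq0// mul1r.
apply: (@cvg_comp _ _ _ (fun k => x + (c k * k.+1%:R^-1) *: e_ i) (partial i f) _ (nbhs x));
  last exact: C1_partial_continuous.
suff : x + (c k * k.+1%:R^-1) *: e_ i @[k --> \oo] --> x + 0 *: e_ i.
  by rewrite scale0r addr0.
apply: cvgD; first exact: cvg_cst.
apply: cvgZr_tmp.
apply: (@squeeze_cvgr _ _ _ _ (cst 0) (@harmonic R)); [|exact: cvg_cst|exact: cvg_harmonic].
apply: nearW => k; have /andP[c0 c1] := cP k.
by rewrite /cst /harmonic /= mulr_ge0 ?invr_ge0// ler_piMl ?invr_ge0.
Qed.

End C1_calculus.

(** * Functions that vanish off a compact set *)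

Section compact_support.
Context (R : realType) (n : nat).
Local Notation mu := (lebesgue_rV R n).
Implicit Types (f g : 'rV[R]_n -> R) (x v w : 'rV[R]_n) (i : 'I_n) (K : set 'rV[R]_n).
Local Notation e_ i := (delta_mx 0 i : 'rV[R]_n).

(** The set [K] is carried along explicitly: sums, products and derivatives can then share one
    compact set, whereas the closure of the nonzero set changes with the function. *)
Definition vanish_off K (V : zmodType) (f : 'rV[R]_n -> V) := forall x, ~ K x -> f x = 0.

Lemma compact_closed_rV K : compact K -> closed K.
Proof. by apply: compact_closed; exact: norm_hausdorff. Qed.

Lemma compact_measurable_rV K : compact K -> measurable K.
Proof.
move=> /compact_closed_rV cK; rewrite -[K]setCK; apply: measurableC.
by apply: open_measurable_rV; exact: closed_openC.
Qed.

Lemma vanish_off_compactly_supported K Omega (V : zmodType) (f : 'rV[R]_n -> V) :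
  compact K -> K `<=` Omega -> vanish_off K f -> compactly_supported Omega f.
Proof.
move=> cK KO fK; have sK : closure [set x | f x != 0] `<=` K.
  rewrite ((closure_id K).1 (compact_closed_rV cK)).
  apply: closure_subset => x /= fx; apply: contrapT => /fK fx0.
  by rewrite fx0 eqxx in fx.
split; last exact: subset_trans KO.
by apply: (subclosed_compact _ cK) => //; exact: closed_closure.
Qed.

Lemma compactly_supported_vanish_off Omega (V : zmodType) (f : 'rV[R]_n -> V) :
  compactly_supported Omega f ->
  exists K, [/\ compact K, K `<=` Omega & vanish_off K f].
Proof.
move=> [cK KO]; exists (closure [set x | f x != 0]); split => // x nx.
apply: contrapT => fx; apply: nx; apply: subset_closure => /=; exact/eqP.
Qed.

Lemma C1_vanish_partial i K f : compact K -> vanish_off K f -> vanish_off K (partial i f).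
Proof.
move=> /compact_closed_rV cK fK x nKx.
rewrite /partial (@near_eq_derive _ _ _ f (fun=> 0)) ?derive_cst//.
have : nbhs x (~` K) by apply: open_nbhs_nbhs; split => //; exact: closed_openC.
by apply: filterS => y; exact: fK.
Qed.

Lemma compact_continuous_bounded K f : compact K -> continuous f -> vanish_off K f ->
  exists2 M : R, 0 < M & forall x, `|f x| <= M.
Proof.
move=> cK cf fK.
have [M [_ MK]] : bounded_set (f @` K).
  by apply: compact_bounded; apply: continuous_compact => //; exact: continuous_subspaceT.
exists (`|M| + 1); first by rewrite ltr_wpDl.
move=> x; have [Kx|nKx] := pselect (K x).
  by apply: MK; [rewrite (le_lt_trans (ler_norm M))// ltrDl|exists x].
by rewrite fK// normr0 addr_ge0.
Qed.

Lemma L1_vanish K f (M : R) : measurable K -> bounded_set K -> measurable_fun setT f ->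
  (forall x, `|f x| <= M) -> vanish_off K f -> mu.-integrable setT (EFin \o f).
Proof.
move=> mK bK mf fM fK.
rewrite (_ : EFin \o f = (EFin \o f) \_ K); last first.
  apply/funext => x; rewrite /patch; case: ifPn => //= /negP nKx.
  by rewrite fK// => Kx; apply: nKx; rewrite inE.
apply/(integrable_mkcond _ mK); apply: (@L1_bounded _ _ _ _ _ mK _ M) => //.
  exact: bounded_finite_rV.
exact: measurable_funTS.
Qed.

Lemma L1_continuous_compact K f : compact K -> continuous f -> vanish_off K f ->
  mu.-integrable setT (EFin \o f).
Proof.
move=> cK cf fK; have [M _ fM] := compact_continuous_bounded cK cf fK.
apply: (L1_vanish (K := K) (M := M)) => //; first exact: compact_measurable_rV.
  exact: compact_bounded.
exact: continuous_measurable_rV.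
Qed.

Lemma Rint_vanish K Omega f : K `<=` Omega -> vanish_off K f ->
  \int[mu]_(x in Omega) f x = \int[mu]_x f x.
Proof.
move=> KO fK; rewrite Rintegral_mkcond; congr (Rintegral _ _ _).
apply/funext => x; rewrite /patch; case: ifPn => // /negP nO.
by rewrite fK// => /KO Ox; apply: nO; rewrite inE.
Qed.

(** A large closed ball will do. It confines the difference quotients of a function that vanishes
    off [K]. *)
Lemma compact_thickening K (r : R) : compact K -> 0 <= r ->
  exists2 K', compact K' & forall x y, K x -> `|y - x| <= r -> K' y.
Proof.
move=> cK r0; have [M [_ MK]] := compact_bounded cK.
exists [set y | `|y| <= `|M| + 1 + r].
  apply: bounded_closed_compact.
    exists (`|M| + 1 + r); split; first exact: num_real.
    by move=> N NM y /= yM; exact: le_trans yM (ltW NM).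
  rewrite (_ : [set y | _] = (fun y : 'rV[R]_n => `|y|) @^-1` [set t | t <= `|M| + 1 + r])//.
  by apply: closed_comp => [y _|]; [exact: norm_continuous|exact: closed_le].
move=> x y Kx yx /=; rewrite -(subrK x y) addrC.
apply: le_trans (ler_normD _ _) _; apply: lerD => //.
by apply: MK => //; rewrite (le_lt_trans (ler_norm M))// ltrDl.
Qed.

(* Translation invariance kills the integral of each difference quotient. *)
Lemma Rint_partial0 i K f : compact K -> Ck 1 f -> vanish_off K f ->
  \int[mu]_x partial i f x = 0.
Proof.
move=> cK Cf fK.
have cf := C1_continuous Cf; have cdf := C1_partial_continuous (i := i) Cf.
have [M M0 dfM] := compact_continuous_bounded cK cdf (C1_vanish_partial i cK fK).
have [K' cK' KK'] := compact_thickening cK ler01.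
have lf := L1_continuous_compact cK cf fK.
pose q (k : nat) x := k.+1%:R * (f (x + k.+1%:R^-1 *: e_ i) - f x).
have lq k : mu.-integrable setT (EFin \o q k).
  by apply: L1Z => //; apply: L1B => //; exact: (L1_rV_shift _ lf).
have q0 k : \int[mu]_x q k x = 0.
  rewrite RintegralZl//; last by apply: L1B => //; exact: (L1_rV_shift _ lf).
  by rewrite RintegralB ?Rint_rV_shift ?subrr ?mulr0//; exact: (L1_rV_shift _ lf).
(* The mean value theorem bounds the quotients by [M], and they vanish off the 1-thickening [K']
   because the steps have length at most 1. *)
have qM k x : `|q k x| <= M * \1_K' x.
  have [Kx|nKx] := pselect (K' x).
    rewrite indicE mem_set// mulr1 /q.
    have [c _ ->] := C1_MVT_partial x i k.+1%:R^-1 Cf.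
    by rewrite mulrA mulfV ?pnatr_eq0// mul1r.
  rewrite indicE memNset//= mulr0 /q !fK ?subrr ?mulr0 ?normr0//.
    by move=> Kx; apply: nKx; apply: KK' Kx _; rewrite subrr normr0.
  move=> Kx; apply: nKx; apply: KK' Kx _; rewrite opprD addrA subrr sub0r normrN.
  apply: le_trans (norm_delta_le _ _) _.
  by rewrite ger0_norm ?invr_ge0// invf_le1// ler1n.
have l1 : mu.-integrable setT (EFin \o (fun x => M * \1_K' x)).
  apply: L1Z => //; apply: (L1_vanish (K := K') (M := 1)).
  - exact: compact_measurable_rV.
  - exact: compact_bounded.
  - by apply: measurable_indic; exact: compact_measurable_rV.
  - by move=> x; rewrite indicE; case: (_ \in _); rewrite ?normr1 ?normr0.
  - by move=> x nK; rewrite indicE memNset.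
have [] := @Rint_dct _ _ _ mu setT measurableT q (partial i f) (fun x => M * \1_K' x).
- by move=> k; exact: (L1_measurable (lq k)).
- exact: continuous_measurable_rV.
- by apply: aeW => x _; exact: C1_diff_quotient_cvg.
- exact: l1.
- by move=> k x _; exact: qM.
move=> _; under eq_fun do rewrite q0.
by move=> /cvg_lim <-//; rewrite lim_cst.
Qed.

Lemma uniform_continuity_compact K f (e : R) : compact K -> continuous f -> vanish_off K f ->
  0 < e -> exists2 r : R, 0 < r & forall x y, `|y - x| < r -> `|f y - f x| < e.
Proof.
move=> cK cf fK e0.
have near_K : \forall r \near (0:R)^'+, forall x, K x -> forall y, `|y - x| < r -> `|f y - f x| < e.
  apply: (compact_near_coveringP K).1 => // x Kx.
  have e2 : 0 < e / 2 by rewrite divr_gt0.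
  have /nbhs_ballP[r /= r0 xr] : nbhs x [set y | `|f x - f y| < e / 2].
    by have /cvgrPdist_lt/(_ _ e2) := cf x.
  have r2 : 0 < r / 2 by rewrite divr_gt0.
  exists (ball x (r / 2), [set t | t < r / 2]); first split => /=.
  - exact: nbhsx_ballx.
  - exact: nbhs_right_lt.
  move=> [x' t] [/= xx' tr] y yx'.
  have x'r : ball x r x' by apply: le_ball xx'; lra.
  have yr : ball x r y.
    rewrite mx_norm_ball /ball_ /= in xx' *.
    rewrite -(subrK x' x) -addrA; apply: le_lt_trans (ler_normD _ _) _.
    by rewrite [ltRHS]splitr ltrD// distrC (lt_trans yx').
  have := xr _ x'r; have := xr _ yr => /= h1 h2.
  rewrite -(subrK (f x) (f y)) -addrA; apply: le_lt_trans (ler_normD _ _) _.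
  by rewrite [ltRHS]splitr ltrD// distrC.
have [r /= [r0 rP]] : exists r : R, 0 < r /\ forall x, K x -> forall y, `|y - x| < r -> `|f y - f x| < e.
  near (0 : R)^'+ => r; exists r; split; last exact: (near near_K r).
  by near: r; exact: nbhs_right_gt.
exists r => // x y xy; have [Kx|nKx] := pselect (K x); first exact: rP.
have [Ky|nKy] := pselect (K y); first by rewrite distrC; apply: rP => //; rewrite distrC.
by rewrite !fK// subrr normr0.
Unshelve. all: by end_near. Qed.

Lemma compact_open_margin K Omega : compact K -> open Omega -> K `<=` Omega ->
  exists2 r : R, 0 < r & forall x y, K x -> `|y - x| < r -> Omega y.
Proof.
move=> cK oO KO.
have near_K : \forall r \near (0:R)^'+, forall x, K x -> forall y, `|y - x| < r -> Omega y.
  apply: (compact_near_coveringP K).1 => // x Kx.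
  have /nbhs_ballP[r /= r0 xr] : nbhs x Omega by apply: open_nbhs_nbhs; split => //; exact: KO.
  have r2 : 0 < r / 2 by rewrite divr_gt0.
  exists (ball x (r / 2), [set t | t < r / 2]); first split => /=.
  - exact: nbhsx_ballx.
  - exact: nbhs_right_lt.
  move=> [x' t] [/= xx' tr] y yx'; apply: xr.
  rewrite mx_norm_ball /ball_ /= in xx' *.
  rewrite -(subrK x' x) -addrA; apply: le_lt_trans (ler_normD _ _) _.
  by rewrite [ltRHS]splitr ltrD// distrC (lt_trans yx').
near (0 : R)^'+ => r; exists r; last by move=> x y Kx; exact: (near near_K r).
by near: r; exact: nbhs_right_gt.
Unshelve. all: by end_near. Qed.

End compact_support.

(** * Density of C^1 functions *)

Section sequences_of_reals.
Context (R : realType).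
Implicit Types (u : R^nat) (l a X Y : R).

Lemma cvg_le_cst u l a : u n @[n --> \oo] --> l -> (forall k, u k <= a) -> l <= a.
Proof.
move=> ul ua; rewrite -(cvg_lim _ ul)//; apply: limr_le; last exact: nearW.
by apply/cvg_ex; exists l.
Qed.

Lemma cvg_ge_cst u l a : u n @[n --> \oo] --> l -> (forall k, a <= u k) -> a <= l.
Proof.
move=> ul ua; rewrite -(cvg_lim _ ul)//; apply: limr_ge; last exact: nearW.
by apply/cvg_ex; exists l.
Qed.

Lemma cvg0_small u (e : R) : u n @[n --> \oo] --> 0 -> 0 < e -> exists N, forall k, (N <= k)%N -> `|u k| < e.
Proof.
move=> /cvgrPdist_lt u0 e0; have [N _ NP] := u0 _ e0.
by exists N => k Nk; have := NP k Nk; rewrite /= sub0r normrN.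
Qed.

Lemma cvg_dist_le u l (b : R^nat) : (forall k, `|u k - l| <= b k) ->
  b n @[n --> \oo] --> 0 -> u n @[n --> \oo] --> l.
Proof.
move=> ub b0; apply/cvgrPdist_lt => e e0.
have [N NP] := cvg0_small b0 e0; exists N => // k /= Nk.
by rewrite distrC (le_lt_trans (ub k))// (le_lt_trans (ler_norm _))// NP.
Qed.

Lemma cvg_exprN (a : R) : 1 < a -> a ^- k @[k --> \oo] --> 0.
Proof.
move=> a1; under eq_fun do rewrite -exprVn.
by apply: cvg_expr; rewrite ger0_norm ?invr_ge0 ?invf_lt1// ?(lt_trans ltr01 a1)// ltW// (lt_trans ltr01 a1).
Qed.

(** This is the last step of a first variation: a quadratic inequality divided by its step [s] has
    this form, and [s] tends to 0. *)
Lemma le0_of_small_slope X Y : (forall s : R, 0 < s <= 1 -> s * Y <= X) -> 0 <= X.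
Proof.
move=> sYX; have cv : harmonic k * Y @[k --> \oo] --> (0 : R).
  by rewrite -(mul0r Y); apply: cvgMl; exact: cvg_harmonic.
apply: (cvg_le_cst cv) => k; apply: sYX.
by rewrite /harmonic /= invr_gt0 ltr0Sn/= invf_le1// ler1n.
Qed.

End sequences_of_reals.

Section smoothstep.
Context (R : realType).
Implicit Types t : R.

(** A C^1 function that vanishes exactly on a half-line; the cutoffs [smoothstep] and the later
    [bump] are built from it. *)
Definition pos2 t := Num.max t 0 ^+ 2.

Lemma is_derive_pos2 t : is_derive t (1 : R) pos2 (2 * Num.max t 0).
Proof.
have cv : h^-1 *: ((pos2 \o shift t) (h *: (1 : R)) - pos2 t) @[h --> 0^'] --> 2 * Num.max t 0.
  apply/cvgrPdist_lt => e e0; near=> h.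
  have h0 : h != 0 by near: h; exact: nbhs_dnbhs_neq.
  have he : `|h| < e.
    by near: h; apply: dnbhs0_lt.
  rewrite /= /shift /= /GRing.scale/= mulr1 -(ltr_pM2l (x := `|h|)) ?normr_gt0//.
  rewrite -normrM mulrBr [h * (h^-1 * _)]mulrA mulfV// mul1r.
  (* The linearization error of [pos2] is at most [h ^ 2], whichever side of 0 the two points are
     on. *)
  apply: (@le_lt_trans _ _ (`|h| ^+ 2)); last by rewrite expr2 ltr_pM2l ?normr_gt0.
  rewrite real_normK ?num_real// /pos2 ler_norml.
  by case: (leP t 0) => t0; case: (leP (h + t) 0) => ht0; apply/andP; split; nra.
apply: DeriveDef; first by apply/cvg_ex; eexists; exact: cv.
by apply: cvg_lim => //; exact: cv.
Unshelve. all: by end_near. Qed.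

Lemma continuous_pos2' : continuous (fun t => 2 * Num.max t 0).
Proof.
move=> t; apply: cvgMr; apply: (@continuous_max _ R (fun t => t) (fun=> 0)).
  exact: cvg_id.
exact: cvg_cst.
Qed.

(* The C^1 quadratic spline rising from 0 on ]-oo, 0] to 1 on [1, +oo[. *)
Definition smoothstep t := 2 * pos2 t + (- 4) * pos2 (t - 2^-1) + 2 * pos2 (t - 1).

Lemma smoothstep_ge0_le1 t : 0 <= smoothstep t <= 1.
Proof.
rewrite /smoothstep /pos2.
by case: (leP t 0) => t0; case: (leP (t - 2^-1) 0) => t1; case: (leP (t - 1) 0) => t2;
  apply/andP; split; nra.
Qed.

Lemma smoothstep0 t : t <= 0 -> smoothstep t = 0.
Proof.
move=> t0; rewrite /smoothstep /pos2.
by case: (leP t 0) => t0'; case: (leP (t - 2^-1) 0) => t1; case: (leP (t - 1) 0) => t2; nra.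
Qed.

Lemma smoothstep1 t : 1 <= t -> smoothstep t = 1.
Proof.
move=> t0; rewrite /smoothstep /pos2.
case: (leP t 0) => t0'; case: (leP (t - 2^-1) 0) => t1; case: (leP (t - 1) 0) => t2; try lra.
by rewrite (_ : t = 1); [field|lra].
Qed.

End smoothstep.

Section C1_density.
Context (R : realType) (n : nat).
Local Notation mu := (lebesgue_rV R n).
Implicit Types (f g th : 'rV[R]_n -> R) (x : 'rV[R]_n).

Lemma C1_smoothstep f : Ck 1 f -> Ck 1 (fun x => smoothstep (f x)).
Proof.
have Cp g : Ck 1 g -> Ck 1 (fun x => pos2 (g x)).
  by move=> Cg; exact: (C1_comp (@is_derive_pos2 R) (@continuous_pos2' R) Cg).
move=> Cf; apply: C1D; first apply: C1D.
- by apply: C1Z; exact: Cp.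
- by apply: C1Z; apply: Cp; apply: C1D => //; exact: C1_cst.
- by apply: C1Z; apply: Cp; apply: C1D => //; exact: C1_cst.
Qed.

Variable G : 'rV[R]_n -> R.
Hypotheses (lG : mu.-integrable setT (EFin \o G)) (G0 : forall x, 0 <= G x).

Let unit_valued th := forall x, 0 <= th x <= 1.
Let approx th (eta : R) := exists f,
  [/\ Ck 1 f, unit_valued f & \int[mu]_x (`|f x - th x| * G x) <= eta].
(** These functions are stable under pointwise limits, complements and products. Hence the sets with
    a good indicator form a sigma-algebra, and it is enough to approximate half-spaces. *)
Let good th := [/\ measurable_fun setT th, unit_valued th &
  forall eta : R, 0 < eta -> approx th eta].

Let mG : measurable_fun setT G. Proof. exact: L1_measurable lG. Qed.

Let L1_diff f g : measurable_fun setT f -> measurable_fun setT g ->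
  unit_valued f -> unit_valued g -> mu.-integrable setT (EFin \o (fun x => `|f x - g x| * G x)).
Proof.
move=> mf mg uf ug; apply: (@L1Ml _ _ _ _ _ measurableT _ _ 1) => //.
  by apply: measurableT_comp => //; exact: measurable_funB.
move=> x _; rewrite normr_id; have := uf x; have := ug x => /andP[? ?] /andP[? ?].
by rewrite ler_norml; apply/andP; split; lra.
Qed.

Let C1_measurable f : Ck 1 f -> measurable_fun setT f.
Proof. by move=> Cf; apply: continuous_measurable_rV; exact: C1_continuous. Qed.

Let good_limit (th_ : nat -> 'rV[R]_n -> R) th : (forall k, good (th_ k)) ->
  (forall x, th_ k x @[k --> \oo] --> th x) -> good th.
Proof.
move=> gth cvth.
have mth : measurable_fun setT th.
  apply: (@measurable_fun_cvg _ _ _ setT th_) => [k|x _]; last exact: cvth.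
  by case: (gth k).
have uth : unit_valued th.
  move=> x; apply/andP; split.
    by apply: cvg_ge_cst (cvth x) _ => k; case: (gth k) => _ /(_ x)/andP[].
  by apply: cvg_le_cst (cvth x) _ => k; case: (gth k) => _ /(_ x)/andP[].
split => // eta e0; have e2 : 0 < eta / 2 by rewrite divr_gt0.
have [] := @Rint_dct _ _ _ mu setT measurableT (fun k x => `|th_ k x - th x| * G x) (fun=> 0) G.
- move=> k; apply: measurable_funM => //; apply: measurableT_comp => //.
  by apply: measurable_funB => //; case: (gth k).
- exact: measurable_cst.
- apply: aeW => x _; rewrite -(mul0r (G x)); apply: cvgMl.
  rewrite -[X in _ --> X](@normr0 _ R); apply: cvg_norm.
  by rewrite -[X in _ --> X](subrr (th x)); apply: cvgB; [exact: cvth|exact: cvg_cst].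
- exact: lG.
- move=> k x _; rewrite normrM normr_id (ger0_norm (G0 x)) ler_piMl//.
  have [_ /(_ x) /andP[a b] _] := gth k; have /andP[c d] := uth x.
  by rewrite ler_norml; apply/andP; split; lra.
move=> _; rewrite Rintegral_cst// mul0r => cv0.
have [N /(_ N (leqnn _)) NP] := cvg0_small cv0 e2.
have [mN uN /(_ _ e2) [f [Cf uf fe]]] := gth N.
exists f; split => //.
have mf := C1_measurable Cf.
apply: (@le_trans _ _ (\int[mu]_x (`|f x - th_ N x| * G x + `|th_ N x - th x| * G x))).
  apply: Rint_le => //; first exact: L1_diff.
    by apply: L1D => //; exact: L1_diff.
  by move=> x _; rewrite -mulrDl ler_wpM2r// ler_distD.
rewrite RintegralD//; try exact: L1_diff.
by have := le_lt_trans (ler_norm _) NP; lra.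
Qed.

Let good1B th : good th -> good (fun x => 1 - th x).
Proof.
move=> [mth uth ath]; split=> [|x|eta /ath [f [Cf uf fe]]].
- exact: measurable_funB.
- by have := uth x => /andP[a b]; apply/andP; split; lra.
- exists (fun x => 1 + (-1) * f x); split.
  + by apply: C1D; [exact: C1_cst|exact: C1Z].
  + by move=> x; have := uf x => /andP[a b]; apply/andP; split; lra.
  + apply: le_trans fe; rewrite le_eqVlt; apply/orP; left; apply/eqP.
    by apply: eq_Rintegral => x _; rewrite -normrN; congr (`|_| * _); ring.
Qed.

Let goodM th th' : good th -> good th' -> good (fun x => th x * th' x).
Proof.
move=> [mth uth ath] [mth' uth' ath'].
have u2 f f' : unit_valued f -> unit_valued f' -> unit_valued (fun x => f x * f' x).
  by move=> uf uf' x; have := uf x; have := uf' x => /andP[? ?] /andP[? ?];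
    apply/andP; split; nra.
split=> [||eta e0]; [exact: measurable_funM|exact: u2|].
have e2 : 0 < eta / 2 by rewrite divr_gt0.
have [f [Cf uf fe]] := ath _ e2; have [f' [Cf' uf' fe']] := ath' _ e2.
exists (fun x => f x * f' x); split; [exact: C1M|exact: u2|].
have mf := C1_measurable Cf; have mf' := C1_measurable Cf'.
apply: (@le_trans _ _ (\int[mu]_x (`|f x - th x| * G x + `|f' x - th' x| * G x))).
  apply: Rint_le => //.
  - by apply: L1_diff => //; [exact: measurable_funM|exact: measurable_funM|exact: u2|exact: u2].
  - by apply: L1D => //; exact: L1_diff.
  move=> x _; rewrite -mulrDl ler_wpM2r//.
  have -> : f x * f' x - th x * th' x = (f x - th x) * f' x + th x * (f' x - th' x) by ring.
  apply: le_trans (ler_normD _ _) _; rewrite !normrM lerD//.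
    by rewrite ler_piMr// ger0_norm; have /andP[] := uf' x.
  by rewrite ler_piMl// ger0_norm; have /andP[] := uth x.
by rewrite RintegralD//; try exact: L1_diff; lra.
Qed.

Let good_C1 th : Ck 1 th -> unit_valued th -> good th.
Proof.
move=> Cth uth; split => // [|eta e0]; first exact: C1_measurable.
exists th; split => //; under eq_Rintegral do rewrite subrr normr0 mul0r.
by rewrite Rintegral_cst// mul0r ltW.
Qed.

Let good_cst (c : R) : 0 <= c <= 1 -> good (fun=> c).
Proof. by move=> c01; apply: good_C1 => //; exact: C1_cst. Qed.

Let good_indic (A : set 'rV[R]_n) := good (\1_A).

Let good_halfspace i (c : R) : good_indic ((fun x : 'rV[R]_n => x 0 i) @^-1` `]-oo, c[).
Proof.
(* Smoothsteps of growing slope tend to the indicator everywhere, also on the hyperplane, where all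
   of them are 0. *)
apply: (good_limit (th_ := fun k x => smoothstep (k%:R * (c + (-1) * x 0 i)))) => [k|x].
  apply: good_C1; last by move=> x; exact: smoothstep_ge0_le1.
  apply: C1_smoothstep; apply: C1Z; apply: C1D; first exact: C1_cst.
  by apply: C1Z; exact: C1_coord.
rewrite indicE; have [xc|cx] := ltP (x 0 i) c.
  rewrite mem_set/=; last by rewrite in_itv.
  apply: cvg_near_cst; have cx0 : 0 < c + -1 * x 0 i by lra.
  near=> k; apply: smoothstep1; rewrite -ler_pdivrMr// mul1r.
  by near: k; exact: nbhs_infty_ger.
rewrite memNset/=; last by rewrite in_itv/= => xc; move: cx; rewrite leNgt xc.
apply: cvg_near_cst; apply: nearW => k; apply: smoothstep0.
by rewrite mulr_ge0_le0//; lra.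
Unshelve. all: by end_near. Qed.

Let sigma_algebra_good : sigma_algebra setT good_indic.
Proof.
split.
- by rewrite /good_indic indic0; apply: good_cst; rewrite lexx ler01.
- move=> A gA; rewrite /good_indic (_ : \1_(setT `\` A) = fun x => 1 - \1_A x :> R).
    exact: good1B.
  by apply/funext => x; rewrite setTD !indicE in_setC; case: (x \in A) => /=; rewrite ?subrr ?subr0.
- move=> A gA.
  (* Stability under products and complements covers finite unions; the limit in [k] yields the
     countable one. *)
  pose th k x : R := \prod_(j < k) (1 - \1_(A j) x).
  have gth k : good (th k).
    elim: k => [|k IH].
      rewrite (_ : th 0%N = fun=> 1); last by apply/funext => x; rewrite /th big_ord0.
      by apply: good_cst; rewrite lexx ler01.
    rewrite (_ : th k.+1 = fun x => th k x * (1 - \1_(A k) x)); last first.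
      by apply/funext => x; rewrite /th big_ord_recr.
    by apply: goodM => //; apply: good1B; exact: gA.
  apply: (good_limit (th_ := fun k x => 1 - th k x)) => [k|x]; first exact: good1B.
  have [Ax|nAx] := pselect ((\bigcup_k A k) x).
    rewrite indicE mem_set//=; case: Ax => j _ Ajx.
    rewrite -[X in _ --> X]subr0; apply: cvgB; first exact: cvg_cst.
    apply: cvg_near_cst; exists j.+1 => // k /= jk.
    by rewrite /th (bigD1 (Ordinal jk))//= indicE mem_set// subrr mul0r.
  rewrite indicE memNset//=; rewrite -[X in _ --> X](subrr 1); apply: cvgB; first exact: cvg_cst.
  apply: cvg_near_cst; apply: nearW => k; rewrite /th big1// => j _.
  by rewrite indicE memNset ?subr0// => Ajx; apply: nAx; exists j.
Qed.

Let good_measurable A : measurable A -> good_indic A.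
Proof.
rewrite /measurable/= => mA; apply: (mA good_indic); split; first exact: sigma_algebra_good.
have [s0 sC sU] := sigma_algebra_good.
have step i (B : set (measurableTypeR R)) : measurable B -> good_indic ((fun x : 'rV[R]_n => x 0 i) @^-1` B).
  rewrite RGenInftyO.measurableE => mB.
  apply: (mB [set B | good_indic ((fun x : 'rV[R]_n => x 0 i) @^-1` B)]).
  split; last by move=> _ [c ->]; exact: good_halfspace.
  split => [|C /= gC|F /= gF]; first by rewrite /= preimage_set0.
  - by rewrite setTD preimage_setC -setTD; exact: sC.
  - by rewrite preimage_bigcup; exact: sU.
move=> C; rewrite -bigcup_seq/= => -[i _ [B mB <-]].
by rewrite setTI; exact: step.
Qed.

(** Binary expansion: splitting off the digit [1_A], where [A] is the set [th >= 1/2], leaves a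
    remainder [th1] with values in [0, 1] again, and each further digit halves the error. The digits
    themselves are approximated by [good_measurable]. *)
Lemma C1_dense th (eta : R) : measurable_fun setT th -> (forall x, 0 <= th x <= 1) ->
  0 < eta -> exists f,
  [/\ Ck 1 f, forall x, 0 <= f x <= 1 & \int[mu]_x (`|f x - th x| * G x) <= eta].
Proof.
pose M := \int[mu]_x G x.
have M0 : 0 <= M by apply: Rintegral_ge0 => x _.
suff P k : forall th eta, measurable_fun setT th -> unit_valued th -> 0 < eta ->
    approx th (2 ^- k * M + eta).
  move=> mth uth e0; have e2 : 0 < eta / 2 by rewrite divr_gt0.
  have cv0 : 2 ^- k * M @[k --> \oo] --> 0.
    rewrite -(mul0r M); apply: cvgMl; under eq_fun do rewrite -exprVn.
    by apply: cvg_expr; rewrite ger0_norm ?invr_ge0// invf_lt1// ltr1n.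
  have [N /(_ N (leqnn _)) NP] := cvg0_small cv0 e2.
  have [f [Cf uf fe]] := P N _ _ mth uth e2; exists f; split => //.
  by have := le_lt_trans (ler_norm _) NP; lra.
elim: k => [|k IH] {}th {}eta mth uth e0.
  (* Before any digit is used, the zero function errs by at most the total mass [M] of [G]. *)
  exists (fun=> 0); split; [exact: C1_cst|by move=> x; rewrite lexx ler01|].
  rewrite expr0 invr1 mul1r; apply: (@le_trans _ _ M); last by rewrite lerDl ltW.
  apply: Rint_le => //; last first.
    move=> x _; rewrite ler_piMl// sub0r normrN ger0_norm; by have /andP[] := uth x.
  by apply: (L1_diff (f := fun=> 0)) => //; [move=> x; rewrite lexx ler01].
pose A := [set x | 2^-1 <= th x].
have mA : measurable A.
  by rewrite -[A]setTI; exact: measurable_fun_le.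
pose th1 x := 2 * th x - \1_A x.
have mth1 : measurable_fun setT th1.
  by apply: measurable_funB; [exact: measurable_funM|exact: measurable_indic].
have uth1 : unit_valued th1.
  move=> x; have /andP[a b] := uth x; rewrite /th1 indicE.
  have [Ax|nAx] := pselect (A x).
    by rewrite mem_set//=; move: Ax; rewrite /A /= => Ax; apply/andP; split; lra.
  rewrite memNset//=; move/negP: nAx; rewrite -ltNge => nAx; apply/andP; split; lra.
have [mi ui /(_ _ e0) [fA [CA uA fAe]]] := good_measurable mA.
have [f [Cf uf fe]] := IH _ _ mth1 uth1 e0.
exists (fun x => 2^-1 * (fA x + f x)); split.
- by apply: C1Z; exact: C1D.
- by move=> x; have := uA x; have := uf x => /andP[? ?] /andP[? ?]; apply/andP; split; lra.
have mf := C1_measurable Cf; have mfA := C1_measurable CA.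
apply: (@le_trans _ _ (\int[mu]_x (2^-1 * (`|fA x - \1_A x| * G x + `|f x - th1 x| * G x)))).
  apply: Rint_le => //.
  - apply: L1_diff => //; first by apply: measurable_funM => //; exact: measurable_funD.
    by move=> x; have := uA x; have := uf x => /andP[? ?] /andP[? ?]; apply/andP; split; lra.
  - by apply: L1Z => //; apply: L1D => //; exact: L1_diff.
  move=> x _; rewrite -mulrDl mulrA ler_wpM2r//.
  have -> : 2^-1 * (fA x + f x) - th x = 2^-1 * ((fA x - \1_A x) + (f x - th1 x)).
    by rewrite /th1; field.
  by rewrite normrM ger0_norm ?invr_ge0// ler_wpM2l ?invr_ge0// ler_normD.
rewrite RintegralZl//; last by apply: L1D => //; exact: L1_diff.
rewrite RintegralD//; try exact: L1_diff.
rewrite exprS invfM -mulrA; move: (2 ^- k * M) fe => c fe.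
lra.
Qed.

End C1_density.

(** * Truncation does not increase the total variation *)

(* In MathComp [0^-1 = 0], which is also the limit of [t / (t^2 + 1/k)] at 0. *)
Lemma measurable_invr (R : realType) : measurable_fun setT (fun t : R => t^-1).
Proof.
apply: (@measurable_fun_cvg _ _ _ setT (fun (k : nat) (t : R) => t * (t ^+ 2 + k.+1%:R^-1)^-1 : R) (fun t : R => t^-1 : R)) => [k|t _].
  apply: measurable_funM => //; apply: continuous_measurable_fun => t.
  have t0 : t ^+ 2 + k.+1%:R^-1 != 0 by rewrite gt_eqF// ltr_wpDl ?sqr_ge0// invr_gt0.
  apply: cvgV => //; apply: cvgD; last exact: cvg_cst.
  exact: exprn_continuous.
have [->|t0] := eqVneq t 0.
  by rewrite invr0; under eq_fun do rewrite mul0r; exact: cvg_cst.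
have -> : t^-1 = t * (t ^+ 2 + 0)^-1 by rewrite addr0 expr2 invfM mulrA mulfV// mul1r.
apply: cvgM; first exact: cvg_cst.
apply: cvgV; first by rewrite addr0 expf_neq0.
by apply: cvgD; [exact: cvg_cst|exact: cvg_harmonic].
Qed.

Lemma cvg_sum_fun (R : realType) (T : Type) (F : set_system T) {FF : Filter F} m
    (f : 'I_m -> T -> R) (l : 'I_m -> R) :
  (forall k, f k x @[x --> F] --> l k) ->
  \sum_(k < m) f k x @[x --> F] --> \sum_(k < m) l k.
Proof.
elim: m f l => [|m IH] f l fl.
  by under eq_fun do rewrite big_ord0; rewrite big_ord0; exact: cvg_cst.
under eq_fun do rewrite big_ord_recl; rewrite big_ord_recl.
by apply: cvgD; [exact: fl|apply: IH => k; exact: fl].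
Qed.

Lemma continuous_sum_fun (R : realType) (T : topologicalType) m (F : 'I_m -> T -> R) :
  (forall k, continuous (F k)) -> continuous (fun x => \sum_(k < m) F k x).
Proof. by move=> cF x; apply: cvg_sum_fun => k; exact: cF. Qed.

Section truncation.
Context (R : realType) (n : nat).
Local Notation mu := (lebesgue_rV R n).
Local Notation e_ i := (delta_mx 0 i : 'rV[R]_n).
Implicit Types (x v : 'rV[R]_n) (i : 'I_n) (K Omega : set 'rV[R]_n).

Lemma enorm_ge0 x : 0 <= enorm x. Proof. exact: sqrtr_ge0. Qed.

Lemma enorm_le x (c : R) : 0 <= c -> (enorm x <= c) = (\sum_(i < n) x 0 i ^+ 2 <= c ^+ 2).
Proof.
move=> c0; rewrite -[RHS]ler_sqrt ?sqr_ge0// sqrtr_sqr ger0_norm//.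
Qed.

Lemma coord_le_enorm x i : `|x 0 i| <= enorm x.
Proof.
rewrite -sqrtr_sqr /enorm ler_sqrt; last by apply: sumr_ge0 => j _; exact: sqr_ge0.
by rewrite (bigD1 i)//= lerDl sumr_ge0// => j _; exact: sqr_ge0.
Qed.

Definition csupp Omega (f : 'rV[R]_n -> R) :=
  exists K, [/\ compact K, K `<=` Omega & vanish_off K f].

Lemma csupp_sum Omega m (f : 'I_m -> 'rV[R]_n -> R) : (forall k, csupp Omega (f k)) ->
  csupp Omega (fun x => \sum_(k < m) f k x).
Proof.
elim: m f => [|m IH] f sf.
  by exists set0; split => //; [exact: compact0|move=> x _; rewrite big_ord0].
have [K1 [cK1 KO1 fK1]] := sf ord0.
have [K2 [cK2 KO2 fK2]] := IH (fun k => f (lift ord0 k)) (fun k => sf (lift ord0 k)).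
exists (K1 `|` K2); split; first exact: compactU.
- by move=> x [|]; [exact: KO1|exact: KO2].
- move=> x /not_orP[n1 n2]; rewrite big_ord_recl fK1// add0r; exact: fK2.
Qed.

Lemma csupp_comp0 Omega (f g : 'rV[R]_n -> R) : (forall x, f x = 0 -> g x = 0) ->
  csupp Omega f -> csupp Omega g.
Proof. by move=> fg [K [cK KO fK]]; exists K; split => // x /fK /fg. Qed.

(** The sum of the absolute values gathers the supports of all components in one compact set. *)
Lemma csupp_row Omega (phi : 'I_n -> 'rV[R]_n -> R) : (forall i, csupp Omega (phi i)) ->
  compactly_supported Omega (fun x => \row_i phi i x).
Proof.
move=> sp; have [K [cK KO fK]] : csupp Omega (fun x => \sum_(i < n) `|phi i x|).
  by apply: csupp_sum => k; apply: csupp_comp0 (sp k) => x ->; rewrite normr0.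
apply: (vanish_off_compactly_supported cK KO) => x /fK /eqP.
rewrite psumr_eq0// => /allP px; apply/rowP => i; rewrite !mxE.
by apply/eqP; rewrite -normr_eq0; apply: px; rewrite mem_index_enum.
Qed.

Lemma csupp_shift Omega K (f : 'rV[R]_n -> R) v : compact K -> vanish_off K f ->
  (forall x, K x -> Omega (x - v)) -> csupp Omega (fun x => f (x + v)).
Proof.
move=> cK fK KO; exists ((fun x => x - v) @` K); split.
- apply: continuous_compact => //; apply: continuous_subspaceT => x.
  exact: (@cvgD _ _ _ (nbhs x) _ id (cst (- v)) x (- v) cvg_id (cvg_cst _)).
- by move=> _ [x Kx <-]; exact: KO.
- by move=> x nx; apply: fK => Kx; apply: nx; exists (x + v) => //; rewrite addrK.
Qed.

Lemma divergence_row (phi : 'I_n -> 'rV[R]_n -> R) x :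
  divergence (fun y => \row_i phi i y) x = \sum_(i < n) partial i (phi i) x.
Proof.
rewrite /divergence; apply: eq_bigr => i _; congr (partial i _ x).
by apply/funext => y; rewrite mxE.
Qed.

Definition diff_quot i (h : R) (f : 'rV[R]_n -> R) x := h^-1 * (f (x + h *: e_ i) - f x).

(** A Riemann sum for the mean of [f] over the segment from [x] to [x + h e_i]. As a finite mean of
    translates it inherits C^1 regularity and commutes with [partial i]; the integral mean would
    call for differentiation under the integral. *)
Definition riemann_mean i (h : R) (N : nat) (f : 'rV[R]_n -> R) x :=
  N.+1%:R^-1 * \sum_(k < N.+1) f (x + (k%:R * (h / N.+1%:R)) *: e_ i).

(** The increment of [f] telescopes over the cells of the mesh. In each cell the mean value theorem
    produces a value of the partial derivative, which uniform continuity compares with the value at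
    the node. *)
Lemma riemann_mean_cvg i (h : R) K f x : 0 < h -> compact K -> Ck 1 f -> vanish_off K f ->
  riemann_mean i h N (partial i f) x @[N --> \oo] --> diff_quot i h f x.
Proof.
move=> h0 cK Cf fK; apply/cvgrPdist_le => e e0.
have [r r0 rP] := uniform_continuity_compact cK (C1_partial_continuous (i := i) Cf)
  (C1_vanish_partial i cK fK) e0.
near=> N.
have N0 : 0 < N.+1%:R :> R by [].
pose t (k : nat) := k%:R * (h / N.+1%:R).
have hN : h / N.+1%:R < r.
  rewrite ltr_pdivrMr// mulrC -ltr_pdivrMr//.
  near: N; exists (Num.truncn (h / r)).+1 => // N /= le_N.
  apply: lt_trans (truncnS_gt _) _; rewrite ltr_nat.
  exact: leq_trans le_N _.
have tS k : t k.+1 = t k + h / N.+1%:R by rewrite /t -natr1 mulrDl mul1r.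
have tele : f (x + h *: e_ i) - f x = \sum_(k < N.+1) (f (x + t k.+1 *: e_ i) - f (x + t k *: e_ i)).
  rewrite -(big_mkord xpredT (fun k => f (x + t k.+1 *: e_ i) - f (x + t k *: e_ i))).
  rewrite telescope_sumr// /t mul0r scale0r addr0.
  by rewrite [N.+1%:R * _]mulrC divfK// gt_eqF.
rewrite /diff_quot tele /riemann_mean.
have -> : h^-1 * \sum_(k < N.+1) (f (x + t k.+1 *: e_ i) - f (x + t k *: e_ i)) =
   N.+1%:R^-1 * \sum_(k < N.+1) (N.+1%:R / h * (f (x + t k.+1 *: e_ i) - f (x + t k *: e_ i))).
  by rewrite -mulr_sumr !mulrA mulVf ?mul1r// gt_eqF.
rewrite -mulrBr -sumrB normrM ger0_norm ?invr_ge0//.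
rewrite ler_pdivrMl//; apply: le_trans (ler_norm_sum _ _ _) _.
apply: (@le_trans _ _ (\sum_(k < N.+1) e)); last by rewrite sumr_const card_ord mulr_natl.
apply: ler_sum => k _.
have [c /andP[c0 c1] cE] := C1_MVT_partial (x + t k *: e_ i) i (h / N.+1%:R) Cf.
rewrite tS scalerDl addrA cE; set p := partial i f _.
rewrite (_ : N.+1%:R / h * (h / N.+1%:R * p) = p); last by field; rewrite !gt_eqF.
rewrite {}/p.
apply/ltW/rP; rewrite addrAC subrr add0r; apply: le_lt_trans (norm_delta_le _ _) _.
apply: le_lt_trans hN; rewrite ger0_norm; last by rewrite mulr_ge0// divr_ge0// ltW.
by rewrite ler_piMl// divr_ge0// ltW.
Unshelve. all: by end_near. Qed.

Lemma C1_riemann_mean i h N f : Ck 1 f -> Ck 1 (riemann_mean i h N f).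
Proof.
move=> Cf; apply: C1Z; apply: (C1_sum (f := fun k x => f (x + (k%:R * (h / N.+1%:R)) *: e_ i))) => k.
exact: C1_shift.
Qed.

Lemma partial_riemann_mean i h N f x : Ck 1 f ->
  partial i (riemann_mean i h N f) x = riemann_mean i h N (partial i f) x.
Proof.
move=> Cf; rewrite /riemann_mean partialZ; last first.
  apply: (C1_sum (f := fun k x => f (x + (k%:R * (h / N.+1%:R)) *: e_ i))) => k.
  exact: C1_shift.
rewrite (@partial_sum _ _ i _ (fun k x => f (x + (k%:R * (h / N.+1%:R)) *: e_ i))); last first.
  by move=> k; exact: C1_shift.
by congr (_ * _); apply: eq_bigr => k _; rewrite partial_shift.
Qed.

Lemma riemann_node_le (h : R) N (k : 'I_N.+1) : 0 <= h -> 0 <= k%:R * (h / N.+1%:R) <= h.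
Proof.
move=> h0; rewrite mulr_ge0 ?divr_ge0//= mulrCA ler_piMr//.
by rewrite ler_pdivrMr// mul1r ler_nat ltnW.
Qed.

Lemma riemann_mean_le i h N f x (b : R) : 0 <= h ->
  (forall s, 0 <= s <= h -> `|f (x + s *: e_ i)| <= b) -> `|riemann_mean i h N f x| <= b.
Proof.
move=> h0 fb; rewrite /riemann_mean normrM ger0_norm ?invr_ge0//.
rewrite ler_pdivrMl//; apply: le_trans (ler_norm_sum _ _ _) _.
apply: (@le_trans _ _ (\sum_(k < N.+1) b)); last by rewrite sumr_const card_ord mulr_natl.
by apply: ler_sum => k _; apply: fb; exact: riemann_node_le.
Qed.

Variables (Omega : set 'rV[R]_n) (v : 'rV[R]_n -> R) (M : R).
Hypotheses (oO : open Omega) (lv : mu.-integrable Omega (EFin \o v)).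
Hypothesis TVv : forall phi, TV_test Omega phi ->
  \int[mu]_(x in Omega) (v x * divergence phi x) <= M.

Let mO : measurable Omega. Proof. exact: open_measurable_rV. Qed.

(** Extension by 0, so that translates can be integrated over the whole space. *)
Let v0 := v \_ Omega.

Let lv0 : mu.-integrable setT (EFin \o v0).
Proof. by rewrite -restrict_EFin; apply/(integrable_mkcond _ mO). Qed.

Let mv0 : measurable_fun setT v0. Proof. exact: L1_measurable lv0. Qed.

Lemma TV_le_C1 (psi : 'I_n -> 'rV[R]_n -> R) (c : R) : 0 < c ->
  (forall i, Ck 1 (psi i)) -> (forall i, csupp Omega (psi i)) ->
  (forall x, \sum_(i < n) psi i x ^+ 2 <= c ^+ 2) ->
  \int[mu]_x (v0 x * \sum_(i < n) partial i (psi i) x) <= c * M.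
Proof.
move=> c0 Cp sp pc.
pose phi i x := c^-1 * psi i x.
have Cphi i : Ck 1 (phi i) by exact: C1Z.
have test : TV_test Omega (fun x => \row_i phi i x).
  split => [i||x].
  - by under eq_fun do rewrite mxE.
  - by apply: csupp_row => i; apply: csupp_comp0 (sp i) => x; rewrite /phi => ->; rewrite mulr0.
  - rewrite enorm_le// expr1n; under eq_bigr do rewrite mxE /phi exprMn.
    by rewrite -mulr_sumr exprVn ler_pdivrMl ?exprn_gt0// mulr1.
have := TVv test; rewrite -ler_pdivrMl//.
congr (_ <= _).
rewrite Rintegral_mkcond -RintegralZl//; last first.
  have [K [cK KO pK]] : csupp Omega (fun x => \sum_(i < n) `|psi i x|).
    by apply: csupp_sum => k; apply: csupp_comp0 (sp k) => x ->; rewrite normr0.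
  have pK' i : vanish_off K (psi i).
    move=> x /pK /eqP; rewrite psumr_eq0// => /allP px.
    by apply/eqP; rewrite -normr_eq0; apply: px; rewrite mem_index_enum.
  have cd : continuous (fun x => \sum_(i < n) partial i (psi i) x).
    apply: (continuous_sum_fun (F := fun i => partial i (psi i))) => i; exact: C1_partial_continuous.
  have vd : vanish_off K (fun x => \sum_(i < n) partial i (psi i) x).
    by move=> x nKx; rewrite big1// => i _; apply: (C1_vanish_partial i cK (pK' i)).
  have [B B0 dB] := compact_continuous_bounded cK cd vd.
  have := L1Ml measurableT (continuous_measurable_rV cd) (fun x _ => dB x) lv0.
  by under [X in _ -> _.-integrable _ (EFin \o X)]eq_fun do rewrite mulrC.
apply: eq_Rintegral => x _; rewrite /v0 /patch; case: ifPn => xO; last by rewrite mul0r mulr0.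
rewrite divergence_row mulrCA; congr (_ * _); rewrite mulr_sumr; apply: eq_bigr => i _.
exact: partialZ.
Qed.

(** Averaging component [i] of [zeta] over segments in direction [e_i] turns the divergence into the
    sum of difference quotients. The constant [c] involves only the values of [zeta] on these
    segments, so [zeta] may contain factors whose gradients are uncontrolled. *)
Lemma TV_le_diff_quot (zeta : 'I_n -> 'rV[R]_n -> R) K (c r h : R) : 0 < c -> 0 < h < r ->
  compact K -> (forall x y, K x -> `|y - x| < r -> Omega y) ->
  (forall i, Ck 1 (zeta i)) -> (forall i, vanish_off K (zeta i)) ->
  (forall x, exists2 b : 'I_n -> R, \sum_(i < n) b i ^+ 2 <= c ^+ 2 &
     forall i s, 0 <= s <= h -> `|zeta i (x + s *: e_ i)| <= b i) ->
  \int[mu]_x (v0 x * \sum_(i < n) diff_quot i h (zeta i) x) <= c * M.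
Proof.
move=> c0 /andP[h0 hr] cK KO Cz zK zb.
(* These bounds only dominate the limit in [N]; they do not enter the final estimate. *)
have /choice[B BP] i : exists B : R, 0 < B /\ forall x, `|partial i (zeta i) x| <= B.
  by have [B B0 BP] := compact_continuous_bounded cK (C1_partial_continuous (i := i) (Cz i))
    (C1_vanish_partial i cK (zK i)); exists B.
pose D N x := \sum_(i < n) riemann_mean i h N (partial i (zeta i)) x.
have cD N : continuous (D N).
  apply: (continuous_sum_fun (F := fun i => riemann_mean i h N (partial i (zeta i)))) => i x.
  have := C1_partial_continuous (i := i) (C1_riemann_mean i h N (Cz i)).
  rewrite (_ : partial i _ = riemann_mean i h N (partial i (zeta i))); first exact.
  by apply/funext => y; rewrite partial_riemann_mean.
have DM N x : `|D N x| <= \sum_(i < n) B i.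
  apply: le_trans (ler_norm_sum _ _ _) _; apply: ler_sum => i _.
  by apply: riemann_mean_le => [|s _]; [exact: ltW|exact: (BP i).2].
have leN N : \int[mu]_x (v0 x * D N x) <= c * M.
  rewrite (_ : \int[mu]_x _ = \int[mu]_x (v0 x * \sum_(i < n) partial i (riemann_mean i h N (zeta i)) x)); last first.
    by apply: eq_Rintegral => x _; congr (_ * _); apply: eq_bigr => i _; rewrite partial_riemann_mean.
  apply: (@TV_le_C1 (fun i => riemann_mean i h N (zeta i)) c c0).
  - by move=> i; exact: C1_riemann_mean.
  - move=> i; have : csupp Omega (fun x => \sum_(k < N.+1) zeta i (x + (k%:R * (h / N.+1%:R)) *: e_ i)).
      apply: csupp_sum => k; apply: csupp_shift cK (zK i) _ => x Kx; apply: (KO x) => //.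
      rewrite addrAC subrr sub0r normrN; apply: le_lt_trans (norm_delta_le _ _) _.
      have /andP[k0 kh] := riemann_node_le k (ltW h0).
      by rewrite ger0_norm// (le_lt_trans kh).
    by apply: csupp_comp0 => x; rewrite /riemann_mean => ->; rewrite mulr0.
  - move=> x; have [b bc bz] := zb x; apply: le_trans bc.
    apply: ler_sum => i _; rewrite -real_normK ?num_real// ler_pXn2r ?nnegrE//.
      by apply: riemann_mean_le; [exact: ltW|exact: bz].
    by apply: le_trans (normr_ge0 _) (bz i 0 _); rewrite lexx ltW.
have [] := @Rint_dct _ _ _ mu setT measurableT (fun N x => v0 x * D N x)
  (fun x => v0 x * \sum_(i < n) diff_quot i h (zeta i) x) (fun x => (\sum_(i < n) B i) * `|v0 x|).
- by move=> N; apply: measurable_funM => //; exact: continuous_measurable_rV.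
- apply: measurable_funM => //; apply: continuous_measurable_rV.
  apply: (continuous_sum_fun (F := fun i => diff_quot i h (zeta i))) => i.
  apply: C1_continuous; apply: C1Z; apply: C1D; first exact: C1_shift.
  by have := C1Z (-1) (Cz i); under eq_fun do rewrite mulN1r.
- apply: aeW => x _; apply: cvgM; first exact: cvg_cst.
  by apply: cvg_sum_fun => i; apply: riemann_mean_cvg (Cz i) (zK i).
- by apply: L1Z => //; exact: L1_abs.
- by move=> N x _; rewrite normrM mulrC ler_wpM2r.
by move=> _ /cvg_le_cst; apply.
Qed.

(** The factors [th i] are replaced by C^1 factors [t i], close in L^1 with weight [|W i|], and a
    change of variables moves the difference quotient from [v0] to [zeta i], the product of [t i]
    and component [i] of [phi]. As [0 <= t i <= 1], over a distance [h] the size of [zeta i] exceeds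
    that of the component by at most [L h]. *)
Lemma TV_le_theta (phi : 'rV[R]_n -> 'rV[R]_n) K (L r h : R) (th : 'I_n -> 'rV[R]_n -> R) :
  TV_test Omega phi -> 0 <= L -> 0 < h < r -> compact K ->
  (forall x y, K x -> `|y - x| < r -> Omega y) ->
  vanish_off K phi -> (forall i x, `|partial i (fun y => phi y 0 i) x| <= L) ->
  (forall i, measurable_fun setT (th i)) -> (forall i x, 0 <= th i x <= 1) ->
  \sum_(i < n) \int[mu]_x (th i x * (h^-1 * phi x 0 i * (v0 (x - h *: e_ i) - v0 x))) <=
  (1 + n%:R * L * h) * M.
Proof.
move=> [Cphi _ phi1] L0 hr cK KO phiK dphiL mth th01.
have /andP[h0 _] := hr; have hi : 0 <= h^-1 by rewrite invr_ge0 ltW.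
pose W i x := h^-1 * phi x 0 i * (v0 (x - h *: e_ i) - v0 x).
have phiK' i : vanish_off K (fun x => phi x 0 i) by move=> x /phiK ->; rewrite mxE.
have phi_le1 i x : `|phi x 0 i| <= 1 by exact: le_trans (coord_le_enorm _ _) (phi1 x).
have mphi i : measurable_fun setT (fun x => phi x 0 i).
  by apply: continuous_measurable_rV; exact: C1_continuous.
have lW i : mu.-integrable setT (EFin \o W i).
  apply: (@L1Ml _ _ _ _ _ measurableT _ _ h^-1); last first.
  - by apply: L1B => //; exact: (L1_rV_shift (- (h *: e_ i)) lv0).
  - by move=> x _; rewrite normrM (ger0_norm hi) ler_piMr.
  - by apply: measurable_funM => //; exact: measurable_cst.
apply/ler_addgt0Pr => eta eta0.
(* The denominator [n.+1] is never 0, and the [n] errors still add up to at most [eta]. *)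
have eta1 : 0 < eta / n.+1%:R by rewrite divr_gt0.
have /choice[t tP] i := C1_dense (L1_abs (lW i)) (fun x => normr_ge0 (W i x)) (mth i) (th01 i) eta1.
pose zeta i x := t i x * phi x 0 i.
have Ct i : Ck 1 (t i) by case: (tP i).
have t01 i x : 0 <= t i x <= 1 by case: (tP i) => _ /(_ x).
have mt i : measurable_fun setT (t i) by apply: continuous_measurable_rV; exact: C1_continuous.
have t_le1 i x : `|t i x| <= 1 by have /andP[a b] := t01 i x; rewrite ger0_norm.
have th_le1 i x : `|th i x| <= 1 by have /andP[a b] := th01 i x; rewrite ger0_norm.
have ltW_ i : mu.-integrable setT (EFin \o (fun x => t i x * W i x)).
  by apply: (@L1Ml _ _ _ _ _ measurableT _ _ 1) => // x _; exact: t_le1.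
have lthW i : mu.-integrable setT (EFin \o (fun x => th i x * W i x)).
  by apply: (@L1Ml _ _ _ _ _ measurableT _ _ 1) => // x _; exact: th_le1.
apply: (@le_trans _ _ (\sum_(i < n) (\int[mu]_x (t i x * W i x) + eta / n.+1%:R))).
  apply: ler_sum => i _.
  rewrite -lerBlDl -RintegralB//.
  case: (tP i) => _ _; apply: le_trans; apply: Rint_le => //.
  - by apply: L1B.
  - apply: (@L1Ml _ _ _ _ _ measurableT _ _ 1); last exact: (L1_abs (lW i)).
      by apply: measurableT_comp => //; exact: measurable_funB.
    move=> x _; rewrite normr_id ler_norml; have /andP[? ?] := t01 i x; have /andP[? ?] := th01 i x.
    by apply/andP; split; lra.
  - by move=> x _; rewrite -[X in X - _]/(th i x * W i x) -mulrBl distrC -normrM ler_norm.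
rewrite big_split/= sumr_const card_ord.
apply: lerD; last first.
  by rewrite -[X in X <= _]mulr_natl mulrCA ler_piMr ?(ltW eta0)// ler_pdivrMr// mul1r ler_nat.
have lvz i : mu.-integrable setT (EFin \o (fun x => h^-1 * zeta i x * v0 x)).
  apply: (@L1Ml _ _ _ _ _ measurableT _ _ h^-1) => //.
    by apply: measurable_funM => //; exact: measurable_funM.
  move=> x _; rewrite normrM (ger0_norm hi) ler_piMr//.
  by rewrite normrM mulr_ile1.
have lvz' i : mu.-integrable setT (EFin \o (fun x => h^-1 * zeta i x * v0 (x - h *: e_ i))).
  apply: (@L1Ml _ _ _ _ _ measurableT _ _ h^-1); last exact: (L1_rV_shift (- (h *: e_ i)) lv0).
    by apply: measurable_funM => //; exact: measurable_funM.
  move=> x _; rewrite normrM (ger0_norm hi) ler_piMr//.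
  by rewrite normrM mulr_ile1.
have tWE i : \int[mu]_x (t i x * W i x) = \int[mu]_x (v0 x * diff_quot i h (zeta i) x).
  transitivity (\int[mu]_x (h^-1 * zeta i x * v0 (x - h *: e_ i) - h^-1 * zeta i x * v0 x)).
    by apply: eq_Rintegral => x _; rewrite /W /zeta; ring.
  rewrite RintegralB// -(Rint_rV_shift (h *: e_ i) (lvz' i)) -RintegralB//; last first.
    exact: (L1_rV_shift (h *: e_ i) (lvz' i)).
  by apply: eq_Rintegral => x _; rewrite /diff_quot addrK; ring.
under eq_bigr do rewrite tWE.
rewrite -(@Rint_sum _ _ _ _ _ measurableT _ (fun i x => v0 x * diff_quot i h (zeta i) x)); last first.
  move=> i; have := L1B measurableT (L1_rV_shift (h *: e_ i) (lvz' i)) (lvz i).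
  congr (_.-integrable _ (EFin \o _)); apply/funext => x.
  by rewrite /diff_quot addrK; ring.
under eq_Rintegral do rewrite -mulr_sumr.
have c0 : 0 < 1 + n%:R * L * h by rewrite ltr_wpDr// !mulr_ge0// ltW.
apply: (TV_le_diff_quot c0 hr cK KO).
- by move=> i; exact: C1M.
- by move=> i x /phiK'; rewrite /zeta => ->; rewrite mulr0.
(* As the components of [phi] are at most 1 in size, the squares of these bounds sum to at most
   [1 + 2 n L h + n (L h)^2 <= (1 + n L h)^2]. *)
move=> x; exists (fun i => `|phi x 0 i| + L * h).
  apply: (@le_trans _ _ (\sum_(i < n) (phi x 0 i ^+ 2 + (2 * (L * h) + (L * h) ^+ 2)))).
    apply: ler_sum => i _; rewrite sqrrD real_normK ?num_real// -addrA lerD2l lerD2r.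
    rewrite -mulr_natl; have := phi_le1 i x; have : 0 <= L * h by rewrite mulr_ge0// ltW.
    by have := normr_ge0 (phi x 0 i); nra.
  rewrite big_split/= sumr_const card_ord -[X in _ + X]mulr_natl.
  have : \sum_(i < n) phi x 0 i ^+ 2 <= 1 by have := phi1 x; rewrite enorm_le// expr1n.
  have nn : n%:R <= n%:R * n%:R :> R by rewrite -natrM ler_nat; case: (n) => // k; rewrite leq_pmulr.
  have : 0 <= L * h by rewrite mulr_ge0// ltW.
  have : n%:R * (L * h) ^+ 2 <= n%:R * n%:R * (L * h) ^+ 2 by rewrite ler_wpM2r ?sqr_ge0.
  rewrite -[n%:R * L * h]mulrA; move: (L * h) (n%:R : R) (\sum_(i < n) _) => a N S.
  by move=> h1 a0 S1; lra.
move=> i s /andP[s0 sh].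
have /andP[t0 t1] := t01 i (x + s *: e_ i).
rewrite /zeta normrM (ger0_norm t0).
apply: le_trans (ler_piMl _ t1) _ => //.
have [c _ /eqP] := C1_MVT_partial x i s (Cphi i); rewrite subr_eq => /eqP ->.
apply: le_trans (ler_normD _ _) _; rewrite addrC lerD2l normrM (ger0_norm s0) mulrC.
by apply: ler_pM.
Qed.

(* Difference quotients of T o v are multiples, with factor in [0, 1], of those of v. *)
Theorem TV_contraction (T : R -> R) (B : R) : measurable_fun setT T ->
  (forall a b, a <= b -> 0 <= T b - T a <= b - a) -> (forall a, `|T a| <= B) ->
  forall phi, TV_test Omega phi -> \int[mu]_(x in Omega) (T (v x) * divergence phi x) <= M.
Proof.
move=> mT Tm TB phi test; have [Cphi sphi phi1] := test.
have [K [cK KO phiK]] := compactly_supported_vanish_off sphi.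
have phiK' i : vanish_off K (fun x => phi x 0 i) by move=> x /phiK ->; rewrite mxE.
have [r r0 rO] := compact_open_margin cK oO KO.
have /choice[b bP] i : exists b : R, 0 < b /\ forall x, `|partial i (fun y => phi y 0 i) x| <= b.
  by have [b b0 bP] := compact_continuous_bounded cK (C1_partial_continuous (i := i) (Cphi i))
    (C1_vanish_partial i cK (phiK' i)); exists b.
pose L := \sum_(i < n) b i.
have L0 : 0 <= L by apply: sumr_ge0 => i _; rewrite ltW//; case: (bP i).
have dphiL i x : `|partial i (fun y => phi y 0 i) x| <= L.
  apply: le_trans ((bP i).2 x) _; rewrite /L (bigD1 i)//= lerDl sumr_ge0// => j _.
  by rewrite ltW//; case: (bP j).
(* Since [T 0] may differ from 0, [z] need not vanish off [Omega]. It is bounded, and it only ever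
   multiplies functions of compact support. *)
pose z x := T (v0 x).
have mz : measurable_fun setT z by exact: measurableT_comp.
have B0 : 0 <= B by exact: le_trans (TB 0).
have shv (i : 'I_n) (h : R) : measurable_fun setT (fun x => v0 (x - h *: e_ i)).
  by apply: (measurableT_comp mv0); exact: measurable_rV_shift.
(* Where the denominator vanishes so does the numerator, and the default [0^-1 = 0] makes the factor
   0. *)
pose th (h : R) i x := (z (x - h *: e_ i) - z x) / (v0 (x - h *: e_ i) - v0 x).
have mth h i : measurable_fun setT (th h i).
  apply: measurable_funM.
    by apply: measurable_funB => //; apply: (measurableT_comp mT); exact: shv.
  by apply: (measurableT_comp (@measurable_invr R)); apply: measurable_funB => //; exact: shv.
have th01 h i x : 0 <= th h i x <= 1.
  rewrite /th /z; move: (v0 (x - _)) (v0 x) => p p'.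
  have [pp'|p'p|->] := ltgtP p p'; last by rewrite !subrr mul0r lexx ler01.
    have /andP[a1 a2] := Tm _ _ (ltW pp').
    have -> : (T p - T p') / (p - p') = (T p' - T p) / (p' - p) by rewrite -mulrNN -invrN !opprB.
    by rewrite divr_ge0 ?(subr_ge0 p) ?(ltW pp')//= ler_pdivrMr ?mul1r ?subr_gt0.
  have /andP[a1 a2] := Tm _ _ (ltW p'p).
  by rewrite divr_ge0 ?(subr_ge0 p') ?(ltW p'p)//= ler_pdivrMr ?mul1r ?subr_gt0.
have thE h i x : z (x - h *: e_ i) - z x = th h i x * (v0 (x - h *: e_ i) - v0 x).
  rewrite /th /z; have [->|ne] := eqVneq (v0 (x - h *: e_ i)) (v0 x).
    by rewrite !subrr mul0r mul0r.
  by rewrite divfK// subr_eq0.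
have lphi i : mu.-integrable setT (EFin \o (fun x => phi x 0 i)).
  by apply: (L1_continuous_compact cK _ (phiK' i)); exact: C1_continuous.
have zB x : `|z x| <= B by exact: TB.
(* A change of variables moves the difference quotient from [phi] to [z], and [thE] rewrites it as
   one of [v0]. *)
have step h : 0 < h < r ->
    \int[mu]_x (z x * \sum_(i < n) diff_quot i h (fun y => phi y 0 i) x) <= (1 + n%:R * L * h) * M.
  move=> hr; have := TV_le_theta test L0 hr cK rO phiK dphiL (mth h) (th01 h).
  apply: le_trans; under eq_Rintegral do rewrite mulr_sumr.
  have lzs i : mu.-integrable setT (EFin \o (fun x => z x * (h^-1 * phi (x + h *: e_ i) 0 i))).
    apply: (@L1Ml _ _ _ _ _ measurableT _ _ B) => //.
    by apply: L1Z => //; exact: (L1_rV_shift (h *: e_ i) (lphi i)).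
  have lz i : mu.-integrable setT (EFin \o (fun x => z x * (h^-1 * phi x 0 i))).
    by apply: (@L1Ml _ _ _ _ _ measurableT _ _ B) => //; exact: L1Z.
  rewrite (@Rint_sum _ _ _ _ _ measurableT _ (fun i x => z x * diff_quot i h (fun y => phi y 0 i) x)); last first.
    move=> i; have := L1B measurableT (lzs i) (lz i).
    congr (_.-integrable _ (EFin \o _)); apply/funext => x.
    by rewrite /diff_quot; ring.
  apply: ler_sum => i _; rewrite le_eqVlt; apply/orP; left; apply/eqP.
  transitivity (\int[mu]_x (z x * (h^-1 * phi (x + h *: e_ i) 0 i)) - \int[mu]_x (z x * (h^-1 * phi x 0 i))).
    rewrite -RintegralB//; apply: eq_Rintegral => x _; rewrite /diff_quot; ring.
  rewrite -(Rint_rV_shift (- (h *: e_ i)) (lzs i)) -RintegralB//; last exact: (L1_rV_shift _ (lzs i)).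
  apply: eq_Rintegral => x _; rewrite subrK.
  transitivity (h^-1 * phi x 0 i * (z (x - h *: e_ i) - z x)); first by ring.
  by rewrite thE; ring.
(* Along these steps the difference quotients tend to the divergence and the constant [1 + n L h]
   tends to 1. *)
pose hk k : R := k.+1%:R^-1.
have hk0 k : 0 < hk k by rewrite invr_gt0.
have [K' cK' KK'] := compact_thickening cK ler01.
have cdivk k : continuous (fun x => \sum_(i < n) diff_quot i (hk k) (fun y => phi y 0 i) x).
  apply: (continuous_sum_fun (F := fun i => diff_quot i (hk k) (fun y => phi y 0 i))) => i.
  apply: C1_continuous; apply: C1Z; apply: C1D; first exact: (C1_shift _ (Cphi i)).
  by have := C1Z (-1) (Cphi i); under eq_fun do rewrite mulN1r.
have [] := @Rint_dct _ _ _ mu setT measurableT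
  (fun k x => z x * \sum_(i < n) diff_quot i (hk k) (fun y => phi y 0 i) x)
  (fun x => z x * divergence phi x) (fun x => (B * (n%:R * L)) * \1_K' x).
- by move=> k; apply: measurable_funM => //; exact: continuous_measurable_rV.
- apply: measurable_funM => //; apply: continuous_measurable_rV.
  by apply: continuous_sum_fun => i; apply: C1_partial_continuous.
- apply: aeW => x _; apply: cvgM; first exact: cvg_cst.
  apply: cvg_sum_fun => i; rewrite /diff_quot /hk; under eq_fun do rewrite invrK.
  exact: C1_diff_quotient_cvg.
- apply: L1Z => //; apply: (L1_vanish (K := K') (M := 1)).
  + exact: compact_measurable_rV.
  + exact: compact_bounded.
  + by apply: measurable_indic; exact: compact_measurable_rV.
  + by move=> x; rewrite indicE; case: (_ \in _); rewrite ?normr1 ?normr0.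
  + by move=> x nK; rewrite indicE memNset.
- move=> k x _; rewrite normrM -mulrA; apply: ler_pM => //.
  apply: le_trans (ler_norm_sum _ _ _) _.
  rewrite -mulrA mulr_natl -[X in _ *+ X](card_ord n) -sumr_const.
  apply: ler_sum => i _.
  have [Kx|nKx] := pselect (K' x).
    rewrite indicE mem_set// mulr1 /diff_quot.
    have [c _ ->] := C1_MVT_partial x i (hk k) (Cphi i).
    by rewrite mulrA mulVf ?gt_eqF// mul1r.
  rewrite indicE memNset//= mulr0 /diff_quot !(phiK' i) ?subrr ?mulr0 ?normr0//.
    by move=> Kx; apply: nKx; apply: KK' Kx _; rewrite subrr normr0.
  move=> Kx; apply: nKx; apply: KK' Kx _; rewrite opprD addrA subrr sub0r normrN.
  apply: le_trans (norm_delta_le _ _) _.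
  by rewrite ger0_norm ?invr_ge0// invf_le1// ler1n.
move=> _ cv.
rewrite (_ : \int[mu]_(x in Omega) _ = \int[mu]_x (z x * divergence phi x)); last first.
  rewrite Rintegral_mkcond; apply: eq_Rintegral => x _; rewrite /z /v0 /patch.
  case: ifPn => // /negP xO; rewrite [divergence _ _](_ : _ = 0) ?mulr0//.
  rewrite /divergence big1// => i _; apply: (C1_vanish_partial i cK (phiK' i)).
  by move=> /KO Ox; apply: xO; rewrite inE.
have cvM : (1 + n%:R * L * hk k) * M @[k --> \oo] --> (1 + n%:R * L * 0) * M.
  apply: cvgMl; apply: cvgD; first exact: cvg_cst.
  by apply: cvgMr; exact: cvg_harmonic.
rewrite mulr0 addr0 mul1r in cvM.
apply: ler_cvg_to cv cvM _; near=> k; apply: step; rewrite hk0/=.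
by near: k; exact: (@near_infty_natSinv_lt R (PosNum r0)).
Unshelve. all: by end_near. Qed.

End truncation.

(** * Test fields *)

Section test_fields.
Context (R : realType) (n : nat).
Local Notation mu := (lebesgue_rV R n).
Local Notation e_ i := (delta_mx 0 i : 'rV[R]_n).
Implicit Types (x v : 'rV[R]_n) (i : 'I_n) (K Omega : set 'rV[R]_n) (phi psi : 'rV[R]_n -> 'rV[R]_n).

Lemma TV_test_C1 Omega phi i : TV_test Omega phi -> Ck 1 (fun x => phi x 0 i).
Proof. by case. Qed.

Lemma TV_test_sum_sqr_le1 Omega phi x : TV_test Omega phi -> \sum_(i < n) phi x 0 i ^+ 2 <= 1.
Proof. by case=> _ _ /(_ x); rewrite enorm_le// expr1n. Qed.

Lemma TV_test_coord_le1 Omega phi x i : TV_test Omega phi -> `|phi x 0 i| <= 1.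
Proof. by case=> _ _ /(_ x); apply: le_trans; exact: coord_le_enorm. Qed.

Lemma TV_test0 Omega : TV_test Omega (fun=> 0).
Proof.
split=> [i||x].
- by under eq_fun do rewrite mxE; exact: C1_cst.
- apply: (@vanish_off_compactly_supported _ _ set0) => //; exact: compact0.
- by rewrite enorm_le// big1 ?expr1n// => i _; rewrite mxE expr0n.
Qed.

Definition combine (s : R) phi psi x : 'rV[R]_n := (1 - s) *: phi x + s *: psi x.

Lemma combineE s phi psi i x : combine s phi psi x 0 i = (1 - s) * phi x 0 i + s * psi x 0 i.
Proof. by rewrite /combine !mxE. Qed.

Lemma TV_test_combine Omega phi psi s : 0 <= s <= 1 -> TV_test Omega phi -> TV_test Omega psi ->
  TV_test Omega (combine s phi psi).
Proof.
move=> /andP[s0 s1] tp tq; split=> [i||x].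
- under eq_fun do rewrite combineE.
  by apply: C1D; apply: C1Z; [exact: (TV_test_C1 _ tp)|exact: (TV_test_C1 _ tq)].
- have [_ /compactly_supported_vanish_off[K1 [cK1 KO1 fK1]] _] := tp.
  have [_ /compactly_supported_vanish_off[K2 [cK2 KO2 fK2]] _] := tq.
  apply: (@vanish_off_compactly_supported _ _ (K1 `|` K2)); first exact: compactU.
    by move=> x [|]; [exact: KO1|exact: KO2].
  by move=> x /not_orP[n1 n2]; rewrite /combine fK1// fK2// !scaler0 addr0.
- rewrite enorm_le// expr1n.
  have h1 := TV_test_sum_sqr_le1 x tp; have h2 := TV_test_sum_sqr_le1 x tq.
  apply: (@le_trans _ _ ((1 - s) * \sum_(i < n) phi x 0 i ^+ 2 + s * \sum_(i < n) psi x 0 i ^+ 2)).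
    rewrite !mulr_sumr -big_split/=; apply: ler_sum => i _; rewrite combineE.
    move: (phi x 0 i) (psi x 0 i) => a b.
    rewrite -subr_ge0 (_ : _ - _ = s * (1 - s) * (a - b) ^+ 2); last by ring.
    by rewrite mulr_ge0 ?sqr_ge0// mulr_ge0// subr_ge0.
  apply: (@le_trans _ _ ((1 - s) * 1 + s * 1)); last by lra.
  by rewrite lerD// ler_wpM2l// subr_ge0.
Qed.

Lemma divergence_combine Omega phi psi s x : TV_test Omega phi -> TV_test Omega psi ->
  divergence (combine s phi psi) x = (1 - s) * divergence phi x + s * divergence psi x.
Proof.
move=> tp tq; rewrite /divergence !mulr_sumr -big_split/=; apply: eq_bigr => i _.
have C1 := TV_test_C1 i tp; have C2 := TV_test_C1 i tq.
rewrite (_ : (fun y => combine s phi psi y 0 i) = fun y => (1 - s) * phi y 0 i + s * psi y 0 i).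
  by rewrite partialD ?partialZ//; exact: C1Z.
by apply/funext => y; rewrite combineE.
Qed.

Lemma divergence_continuous Omega phi : TV_test Omega phi -> continuous (divergence phi).
Proof.
move=> tp; apply: (continuous_sum_fun (F := fun i => partial i (fun y => phi y 0 i))) => i.
by apply: C1_partial_continuous; exact: TV_test_C1 tp.
Qed.

Lemma divergence_measurable Omega phi : TV_test Omega phi -> measurable_fun setT (divergence phi).
Proof. by move=> tp; apply: continuous_measurable_rV; exact: divergence_continuous tp. Qed.

Lemma TV_test_support Omega phi : TV_test Omega phi ->
  exists K, [/\ compact K, K `<=` Omega & forall i, vanish_off K (fun x => phi x 0 i)].
Proof.
move=> [_ /compactly_supported_vanish_off[K [cK KO pK]] _]; exists K; split => //.
by move=> i x /pK ->; rewrite mxE.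
Qed.

Lemma divergence_vanish K phi : compact K -> (forall i, Ck 1 (fun x => phi x 0 i)) ->
  (forall i, vanish_off K (fun x => phi x 0 i)) -> vanish_off K (divergence phi).
Proof.
move=> cK Cp pK x nKx; rewrite /divergence big1// => i _.
exact: (C1_vanish_partial i cK (pK i)).
Qed.

Lemma divergence_bounded Omega phi : TV_test Omega phi ->
  exists2 B : R, 0 < B & forall x, `|divergence phi x| <= B.
Proof.
move=> tp; have [K [cK KO pK]] := TV_test_support tp.
apply: (compact_continuous_bounded cK (divergence_continuous tp)).
by apply: divergence_vanish => // i; exact: TV_test_C1 tp.
Qed.

(* The divergence theorem applied to the compactly supported field [psi *: phi]. *)
Lemma integration_by_parts_compact Omega phi (psi : 'rV[R]_n -> R) K : compact K -> K `<=` Omega ->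
  (forall i, Ck 1 (fun x => phi x 0 i)) -> (forall i, vanish_off K (fun x => phi x 0 i)) ->
  Ck 1 psi ->
  \int[mu]_(x in Omega) (\sum_(i < n) phi x 0 i * partial i psi x) =
  - \int[mu]_(x in Omega) (divergence phi x * psi x).
Proof.
move=> cK KO Cp pK Cpsi.
have v1 : vanish_off K (fun x => \sum_(i < n) phi x 0 i * partial i psi x).
  by move=> x nKx; rewrite big1// => i _; rewrite (pK i)// mul0r.
have v2 : vanish_off K (fun x => divergence phi x * psi x).
  by move=> x nKx; rewrite (divergence_vanish cK Cp pK nKx) mul0r.
rewrite (Rint_vanish KO v1) (Rint_vanish KO v2).
have Cprod i : Ck 1 (fun x => phi x 0 i * psi x) by exact: C1M.
have vprod i : vanish_off K (fun x => phi x 0 i * psi x) by move=> x nKx; rewrite (pK i)// mul0r.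
have dprod i x : partial i (fun y => phi y 0 i * psi y) x =
    phi x 0 i * partial i psi x + partial i (fun y => phi y 0 i) x * psi x.
  by rewrite partialM// [psi x * _]mulrC.
have cpart i : continuous (partial i (fun y => phi y 0 i)) by exact: C1_partial_continuous.
have l1 : mu.-integrable setT (EFin \o (fun x => \sum_(i < n) phi x 0 i * partial i psi x)).
  apply: (L1_continuous_compact cK _ v1).
  apply: (continuous_sum_fun (F := fun i x => phi x 0 i * partial i psi x)) => i x.
  by apply: continuousM; [exact: (C1_continuous (Cp i))|exact: C1_partial_continuous].
have l2 : mu.-integrable setT (EFin \o (fun x => divergence phi x * psi x)).
  apply: (L1_continuous_compact cK _ v2) => x; apply: continuousM; last exact: C1_continuous.
  exact: (continuous_sum_fun (F := fun i => partial i (fun y => phi y 0 i))).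
apply/eqP; rewrite -subr_eq0 opprK -RintegralD//; apply/eqP.
under eq_Rintegral => x _.
  rewrite /divergence mulr_suml -big_split/=.
  under eq_bigr do rewrite -dprod.
over.
rewrite (@Rint_sum _ _ _ _ _ measurableT _ (fun i => partial i (fun y => phi y 0 i * psi y))).
  by rewrite big1// => i _; exact: (Rint_partial0 i cK).
move=> i; apply: (L1_continuous_compact cK _ (C1_vanish_partial i cK (vprod i))).
exact: C1_partial_continuous.
Qed.

(** The rate [8 ^- k] is the one [L2_fast_ae_cvg] asks for; [k <= j k] preserves bounds that improve
    with the index. *)
Lemma fast_subsequence (D : nat -> nat -> R) :
  (forall e : R, 0 < e -> exists N, forall m n, (N <= m)%N -> (N <= n)%N -> D m n <= e) ->
  exists j : nat -> nat, (forall k, (k <= j k)%N) /\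
    (forall k l m, (k <= l)%N -> (k <= m)%N -> D (j l) (j m) <= 8 ^- k).
Proof.
move=> DC.
have /choice[N NP] k : exists N, forall m n, (N <= m)%N -> (N <= n)%N -> D m n <= 8 ^- k.
  by apply: DC; rewrite invr_gt0 exprn_gt0.
pose j := fix j k := if k is k'.+1 then (maxn (j k') (N k)).+1 else N 0%N.
have jS k : j k.+1 = (maxn (j k) (N k.+1)).+1 by [].
have jmono k l : (k <= l)%N -> (j k <= j l)%N.
  elim: l => [|l IH]; first by rewrite leqn0 => /eqP ->.
  rewrite leq_eqVlt ltnS => /predU1P[->//|kl]; rewrite jS.
  by apply: leqW; apply: leq_trans (IH kl) _; rewrite leq_maxl.
have jN k : (N k <= j k)%N by case: k => [//|k]; rewrite jS leqW// leq_maxr.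
exists j; split => [k|k l m kl km].
  by elim: k => [//|k IH]; rewrite jS ltnS (leq_trans IH)// leq_maxl.
by apply: NP; apply: leq_trans (jN k) _; exact: jmono.
Qed.

End test_fields.

(** * Duality *)

Section duality.
Context (R : realType) (n : nat).
Local Notation mu := (lebesgue_rV R n).
Local Notation field := ('rV[R]_n -> 'rV[R]_n).
Variables (Omega : set 'rV[R]_n) (g0 ubar : 'rV[R]_n -> R) (ul uu tv : R).
Hypotheses (oO : open Omega) (muO : (mu Omega < +oo)%E).
Hypothesis lg : mu.-integrable Omega (EFin \o g0).
Hypotheses (lu : ul <= uu) (mub : measurable_fun Omega ubar).
Hypothesis ub_bnd : forall x, Omega x -> ul <= ubar x <= uu.
Local Notation I f := (\int[mu]_(x in Omega) f x).
Local Notation L1 f := (mu.-integrable Omega (EFin \o f)).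
Hypothesis TVub : forall phi, TV_test Omega phi -> I (fun x => ubar x * divergence phi x) <= tv.
(** The primal value, which the dual values [value y] are to reach. *)
Let c := tv + I (fun x => g0 x * ubar x).
Hypothesis optimal : forall u M, measurable_fun Omega u -> (forall x, ul <= u x <= uu) ->
  (forall phi, TV_test Omega phi -> I (fun x => u x * divergence phi x) <= M) ->
  c <= M + I (fun x => g0 x * u x).

Let mO : measurable Omega. Proof. exact: open_measurable_rV. Qed.
Let mg : measurable_fun Omega g0. Proof. exact: L1_measurable lg. Qed.
Let lcst (k : R) : L1 (fun=> k).
Proof. by apply: (@L1_bounded _ _ _ _ _ mO _ `|k|). Qed.

Local Notation pair_t := (field * ('rV[R]_n -> R))%type.
Implicit Types y z : pair_t.

(* A competitor pairs a test field with the fraction of [g0] that is charged to the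
   multipliers of the box constraint. *)
Definition competitor y :=
  [/\ TV_test Omega y.1, measurable_fun Omega y.2 & forall x, 0 <= y.2 x <= 1].

Definition resid y x := divergence y.1 x + (1 - y.2 x) * g0 x.
(** The minimum of [g0 x * v] over [ul <= v <= uu]. *)
Definition cost x := ul * Num.max (g0 x) 0 + uu * Num.min (g0 x) 0.
Definition value y := I (fun x => y.2 x * cost x).
Definition weight x : R := 1 + `|g0 x|.
Definition wresid y x := resid y x / Num.sqrt (weight x).

Let weight_ge1 x : 1 <= weight x. Proof. by rewrite /weight lerDl. Qed.
Let weight_gt0 x : 0 < weight x. Proof. exact: lt_le_trans (weight_ge1 x). Qed.
Let sqrtw_gt0 x : 0 < Num.sqrt (weight x). Proof. by rewrite sqrtr_gt0. Qed.
Let sqrtw_ge1 x : 1 <= Num.sqrt (weight x).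
Proof. by rewrite -[leLHS]sqrtr1 ler_sqrt ?weight_ge1// ltW. Qed.
Let sqrtw_sqr x : Num.sqrt (weight x) ^+ 2 = weight x. Proof. by rewrite sqr_sqrtr// ltW. Qed.
Let mweight : measurable_fun Omega weight.
Proof. by apply: measurable_funD => //; apply: measurableT_comp. Qed.
Let lweight : L1 weight. Proof. by apply: L1D => //; exact: L1_abs. Qed.
Let msqrtw : measurable_fun Omega (fun x => Num.sqrt (weight x)).
Proof.
have ms : measurable_fun setT (fun t : R => Num.sqrt t).
  by apply: continuous_measurable_fun; exact: sqrt_continuous.
exact: (measurableT_comp ms mweight).
Qed.
Let lsqrtw : L1 (fun x => Num.sqrt (weight x) ^+ 2).
Proof. by under eq_fun do rewrite sqrtw_sqr; exact: lweight. Qed.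

Let mdiv phi : TV_test Omega phi -> measurable_fun Omega (divergence phi).
Proof. by move=> t; apply: measurable_funTS; exact: divergence_measurable t. Qed.

Let mresid y : competitor y -> measurable_fun Omega (resid y).
Proof.
move=> [t m b]; apply: measurable_funD; first exact: mdiv.
by apply: measurable_funM => //; exact: measurable_funB.
Qed.

Let mwresid y : competitor y -> measurable_fun Omega (wresid y).
Proof.
move=> v; apply: measurable_funM; first exact: mresid.
exact: (measurableT_comp (@measurable_invr R) msqrtw).
Qed.

Let lwresid y : competitor y -> L1 (fun x => wresid y x ^+ 2).
Proof.
move=> v; have [t m b] := v; have [B B0 dB] := divergence_bounded t.
(* Here [|resid| <= B + |g0| <= (B + 1) weight], and the division cancels one of the two factors
   [weight] of the square. *)
apply: (@L1_dom _ _ _ _ _ mO _ (fun x => (B + 1) ^+ 2 * weight x)).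
- by apply: measurable_funX; exact: mwresid.
- move=> x _; rewrite ger0_norm ?sqr_ge0// /wresid expr_div_n sqrtw_sqr.
  rewrite ler_pdivrMr// -mulrA -expr2 -exprMn -ler_sqrt ?sqr_ge0// !sqrtr_sqr.
  rewrite [leRHS]ger0_norm ?mulr_ge0 ?(ltW (weight_gt0 x))// ?addr_ge0 ?(ltW B0)//.
  apply: le_trans (ler_normD _ _) _; rewrite /weight normrM.
  have := dB x; have /andP[b0 b1] := b x; rewrite (@ger0_norm _ (1 - _)) ?subr_ge0//.
  have := normr_ge0 (g0 x); move: `|g0 x| `|divergence _ _| (y.2 x) b0 b1 => p q r r0 r1 p0 qB.
  have h1 : 0 <= B * p by rewrite mulr_ge0// ltW.
  have h2 : 0 <= r * p by rewrite mulr_ge0.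
  lra.
- exact: L1Z.
Qed.

Let mcost : measurable_fun Omega cost.
Proof.
apply: measurable_funD; apply: measurable_funM => //.
  exact: measurable_maxr.
exact: measurable_minr.
Qed.

Let lcost : L1 cost.
Proof.
apply: (@L1_dom _ _ _ _ _ mO _ (fun x => (`|ul| + `|uu|) * `|g0 x|)) => //.
  move=> x _; rewrite /cost mulrDl; apply: le_trans (ler_normD _ _) _; rewrite !normrM.
  apply: lerD; rewrite ler_wpM2l//.
    by case: (leP (g0 x) 0) => h; rewrite ?normr0.
  by case: (leP (g0 x) 0) => h; rewrite ?normr0.
by apply: L1Z => //; exact: L1_abs.
Qed.

Let lvalue y : competitor y -> L1 (fun x => y.2 x * cost x).
Proof.
move=> [t m b]; apply: (@L1Ml _ _ _ _ _ mO _ _ 1) => // x _.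
by have /andP[b0 b1] := b x; rewrite ger0_norm.
Qed.

Definition mix (s : R) y z : pair_t :=
  (combine s y.1 z.1, fun x => (1 - s) * y.2 x + s * z.2 x).

Let competitor_mix s y z : 0 <= s <= 1 -> competitor y -> competitor z -> competitor (mix s y z).
Proof.
move=> s01 [t m b] [t' m' b']; split; first exact: TV_test_combine.
  by apply: measurable_funD; apply: measurable_funM.
move=> x /=; have /andP[? ?] := b x; have /andP[? ?] := b' x; have /andP[? ?] := s01.
by apply/andP; split; nra.
Qed.

Let wresid_mix s y z x : competitor y -> competitor z ->
  wresid (mix s y z) x = (1 - s) * wresid y x + s * wresid z x.
Proof.
move=> [t m b] [t' m' b']; rewrite /wresid /resid (divergence_combine _ _ t t') /=; ring.
Qed.

Let value_mix s y z : competitor y -> competitor z ->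
  value (mix s y z) = (1 - s) * value y + s * value z.
Proof.
move=> v v'; rewrite /value -!RintegralZl ?lvalue// -RintegralD//.
- by apply: eq_Rintegral => x _ /=; ring.
- by apply: L1Z => //; exact: lvalue.
- by apply: L1Z => //; exact: lvalue.
Qed.

(** Squared norm, inner product and squared distance of the points [(wresid y, c - value y)] of the
    Hilbert space L^2 x R; these points depend affinely on [y]. *)
Definition penalty y := I (fun x => wresid y x ^+ 2) + (c - value y) ^+ 2.
Definition polar y z := I (fun x => wresid y x * wresid z x) + (c - value y) * (c - value z).
Definition pdist y z := I (fun x => (wresid y x - wresid z x) ^+ 2) + (value y - value z) ^+ 2.

Let penalty_ge0 y : 0 <= penalty y.
Proof. by rewrite addr_ge0 ?sqr_ge0// Rintegral_ge0// => x _; exact: sqr_ge0. Qed.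

Let penalty_mix s y z : competitor y -> competitor z ->
  penalty (mix s y z) = (1 - s) ^+ 2 * penalty y + 2 * (s * (1 - s)) * polar y z + s ^+ 2 * penalty z.
Proof.
move=> v v'; rewrite /penalty /polar value_mix//.
have -> : I (fun x => wresid (mix s y z) x ^+ 2) = I (fun x => ((1 - s) * wresid y x + s * wresid z x) ^+ 2).
  by apply: eq_Rintegral => x _; rewrite wresid_mix.
have mw := mwresid v; have mw' := mwresid v'; have lw := lwresid v; have lw' := lwresid v'.
rewrite Rint_sqrD//; last 2 first.
- exact: measurable_funM.
- exact: L1_sqrZ.
have -> : I (fun x => ((1 - s) * wresid y x) ^+ 2) = (1 - s) ^+ 2 * I (fun x => wresid y x ^+ 2).
  by rewrite -RintegralZl//; apply: eq_Rintegral => x _; rewrite exprMn.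
have -> : I (fun x => (1 - s) * wresid y x * wresid z x) = (1 - s) * I (fun x => wresid y x * wresid z x).
  by rewrite -RintegralZl//; [apply: eq_Rintegral => x _; rewrite mulrA|exact: L1_prod].
ring.
Qed.

Let pdistE y z : competitor y -> competitor z -> pdist y z = penalty y - 2 * polar y z + penalty z.
Proof.
move=> v v'; rewrite /pdist /penalty /polar.
have -> : I (fun x => (wresid y x - wresid z x) ^+ 2) = I (fun x => (wresid y x + (-1) * wresid z x) ^+ 2).
  by apply: eq_Rintegral => x _; rewrite mulN1r.
rewrite (Rint_sqrD mO _ (mwresid v) (mwresid v') (lwresid v) (lwresid v')).
ring.
Qed.

Let polar_le y z : competitor y -> competitor z -> 2 * polar y z <= penalty y + penalty z.
Proof.
move=> v v'; have : 0 <= pdist y z.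
  by rewrite addr_ge0 ?sqr_ge0// Rintegral_ge0// => x _; exact: sqr_ge0.
by rewrite pdistE//; lra.
Qed.

Let competitor0 : competitor (fun=> 0, fun=> 0).
Proof. by split => //=; [exact: TV_test0|move=> x; rewrite lexx ler01]. Qed.

Let half : R := 2^-1.
Let half01 : 0 <= half <= 1. Proof. by apply/andP; split; rewrite /half; lra. Qed.

Let penalty_mid y z : competitor y -> competitor z ->
  pdist y z <= 2 * penalty y + 2 * penalty z - 4 * penalty (mix half y z).
Proof.
by move=> v v'; rewrite pdistE// penalty_mix// /half; lra.
Qed.

Let ubar_bound : exists B, forall x, Omega x -> `|ubar x| <= B.
Proof.
by exists (`|ul| + `|uu|) => x Ox; exact: ler_norm_between (ub_bnd Ox).
Qed.

(* Weak duality for the competitor [ubar]. *)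
Let ubar_le y : competitor y -> I (fun x => ubar x * resid y x) + value y <= c.
Proof.
move=> v; have [t m b] := v; have [B uB] := ubar_bound; have [B' B'0 dB] := divergence_bounded t.
have l1 : L1 (fun x => ubar x * divergence y.1 x).
  apply: (@L1Ml _ _ _ _ _ mO _ _ B) => //.
  by apply: (@L1_bounded _ _ _ _ _ mO _ B') => //; exact: mdiv.
have l2 : L1 (fun x => ubar x * ((1 - y.2 x) * g0 x)).
  apply: (@L1Ml _ _ _ _ _ mO _ _ B) => //; apply: (@L1Ml _ _ _ _ _ mO _ _ 1) => //.
    exact: measurable_funB.
  by move=> x _; have /andP[? ?] := b x; rewrite ger0_norm; lra.
have -> : I (fun x => ubar x * resid y x) = I (fun x => ubar x * divergence y.1 x) + I (fun x => ubar x * ((1 - y.2 x) * g0 x)).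
  by rewrite -RintegralD//; apply: eq_Rintegral => x _; rewrite /resid mulrDr.
rewrite /c -addrA; apply: lerD; first exact: TVub.
rewrite /value -RintegralD//; last exact: lvalue.
apply: Rint_le => //.
- by apply: L1D => //; exact: lvalue.
- by under eq_fun do rewrite mulrC; apply: (@L1Ml _ _ _ _ _ mO _ _ B).
move=> x Ox; rewrite /cost; have /andP[b0 b1] := b x; have /andP[a1 a2] := ub_bnd Ox.
have [h|h] := leP (g0 x) 0.
  have : y.2 x * (- g0 x) * (uu - ubar x) >= 0 by rewrite !mulr_ge0// ?oppr_ge0// subr_ge0.
  by lra.
have : y.2 x * g0 x * (ubar x - ul) >= 0 by rewrite !mulr_ge0// ?(ltW h)// subr_ge0.
by lra.
Qed.

Let clamp (a : R) := Num.min (Num.max a ul) uu.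

Let clampE a : clamp a = if a <= ul then ul else if a <= uu then a else uu.
Proof. by rewrite /clamp; case: (leP a ul) => h; [rewrite min_l|case: (leP a uu)]. Qed.

Let clamp_bnd a : ul <= clamp a <= uu.
Proof.
have h := lu.
by rewrite clampE; case: (leP a ul) => h1; [|case: (leP a uu) => h2]; apply/andP; split; lra.
Qed.

Let clamp_abs a : `|clamp a| <= `|ul| + `|uu|.
Proof. exact: ler_norm_between (clamp_bnd a). Qed.

Let clamp_contraction a b : a <= b -> 0 <= clamp b - clamp a <= b - a.
Proof.
have h := lu; rewrite !clampE => ab.
case: (leP a ul) => h1; case: (leP b ul) => h2; case: (leP a uu) => h3; case: (leP b uu) => h4;
  apply/andP; split; lra.
Qed.

Let measurable_clamp : measurable_fun setT clamp.
Proof. by apply: measurable_minr => //; exact: measurable_maxr. Qed.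

(* A minimiser of the squared norm of (wresid, c - value) would separate: it yields a
   function [u] and a slope [t] such that [I (u * resid h) + t * value h] stays below
   [t * c] for all competitors [h]. *)
Let separation (eps : R) : 0 < eps -> (forall y, competitor y -> eps < penalty y) ->
  exists u t, [/\ measurable_fun Omega u, L1 u, L1 (fun x => u x * g0 x) &
    forall h, competitor h -> I (fun x => u x * resid h x) + t * value h <= t * c - eps].
Proof.
move=> e0 He.
have [y_ [yC yCau ymin]] : exists x_ : nat -> pair_t, [/\ forall n, competitor (x_ n),
    (forall e : R, 0 < e -> exists N, forall m n, (N <= m)%N -> (N <= n)%N ->
       pdist (x_ m) (x_ n) <= e) &
    forall n y, competitor y -> penalty (x_ n) <= penalty y + n.+1%:R^-1].
  apply: (@nested_minimizers R pair_t (fun=> competitor) (mix half) penalty pdist (penalty (fun=> 0, fun=> 0))).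
  - by move=> _.
  - by move=> _ x z; exact: competitor_mix.
  - by move=> x _; exact: penalty_ge0.
  - by move=> _; exists (fun=> 0, fun=> 0).
  - by move=> x z; exact: penalty_mid.
have [j [jk jP]] := fast_subsequence yCau.
pose y k := y_ (j k); pose F k := wresid (y k).
have yc k : competitor (y k) by exact: yC.
have mF k : measurable_fun Omega (F k) by exact: mwresid.
have lF k : L1 (fun x => F k x ^+ 2) by exact: lwresid.
have dF k l m : (k <= l)%N -> (k <= m)%N -> I (fun x => (F l x - F m x) ^+ 2) <= 8 ^- k.
  by move=> kl km; apply: le_trans (jP _ _ _ kl km); rewrite lerDl sqr_ge0.
have [Fs mFs cvF] := L2_fast_ae_cvg mO mF lF (fun k => dF k _ _ (leqnSn k) (leqnn k)).
have limF k : L1 (fun x => (F k x - Fs x) ^+ 2) /\ I (fun x => (F k x - Fs x) ^+ 2) <= 8 ^- k.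
  by apply: (L2_limit mO mF lF mFs cvF) => l kl; exact: dF.
have lFs : L1 (fun x => Fs x ^+ 2).
  have := L1_sqrB mO (mF 0%N) (measurable_funB (mF 0%N) mFs) (lF 0%N) (limF 0%N).1.
  by congr (_.-integrable _ (EFin \o _)); apply/funext => x; rewrite opprB addrC subrK.
pose r k := value (y k).
have cvr : cvgn r.
  apply: (@fast_cauchy_cvg _ r 1) => k.
  have : (r k.+1 - r k) ^+ 2 <= 8 ^- k.
    apply: le_trans (jP k k.+1 k (leqnSn k) (leqnn k)).
    by rewrite lerDr Rintegral_ge0// => x _; exact: sqr_ge0.
  move=> h; apply: (@le_trans _ _ (4 ^+ k * 8 ^- k)); first by rewrite ler_wpM2l// exprn_ge0.
  by rewrite -expr_div_n exprn_ile1//; lra.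
pose rs := limn r.
(* Chosen so that [u * resid h = - Fs * wresid h]. The division also makes both [u] and [u * g0]
   integrable, given that [Fs] is in L^2. *)
pose u x := - Fs x / Num.sqrt (weight x).
have mu_ : measurable_fun Omega u.
  apply: measurable_funM; last exact: (measurableT_comp (@measurable_invr R) msqrtw).
  exact: measurableT_comp.
have u_le x : `|u x| <= `|Fs x|.
  rewrite /u normrM normrN normfV (gtr0_norm (sqrtw_gt0 x)) ler_pdivrMr//.
  by rewrite ler_peMr// sqrtw_ge1.
exists u, (c - rs); split => //.
- apply: (@L1_dom _ _ _ _ _ mO _ (fun x => 1 + Fs x ^+ 2)) => //; last exact: L1D.
  move=> x _; apply: le_trans (u_le x) _; rewrite -(real_normK (num_real (Fs x))).
  by have := sqr_ge0 (`|Fs x| - 1); have := normr_ge0 (Fs x); nra.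
- apply: (@L1_dom _ _ _ _ _ mO _ (fun x => `|Fs x * Num.sqrt (weight x)|)) => //.
  + exact: measurable_funM.
  + move=> x _; rewrite /u !normrM normrN normfV (gtr0_norm (sqrtw_gt0 x)) -mulrA ler_wpM2l//.
    by rewrite ler_pdivrMl// -expr2 sqrtw_sqr /weight lerDr.
  + by apply: L1_abs; exact: L1_prod.
move=> h hc.
have -> : I (fun x => u x * resid h x) = - I (fun x => Fs x * wresid h x).
  rewrite -mulN1r -RintegralZl//; last by apply: L1_prod => //; [exact: mwresid|exact: lwresid].
  by apply: eq_Rintegral => x _; rewrite /u /wresid; ring.
pose A k := polar (y k) h.
pose As := I (fun x => Fs x * wresid h x) + (c - rs) * (c - value h).
have mh := mwresid hc; have lh := lwresid hc.
have cvA : A k @[k --> \oo] --> As.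
  apply: cvgD; last first.
    by apply: cvgM; [apply: cvgB; [exact: cvg_cst|exact: cvr]|exact: cvg_cst].
  pose H := I (fun x => wresid h x ^+ 2).
  (* [Rint_prod_le] with [eta = 2 ^- k] turns the squared distance [8 ^- k] into
     [2 ^ k * 8 ^- k = 4 ^- k]. *)
  apply: (@cvg_dist_le _ _ _ (fun k => 4 ^- k + 2 ^- k * H)) => [k|]; last first.
    rewrite -[X in _ --> X]addr0; apply: cvgD; first by apply: cvg_exprN; rewrite ltr1n.
    by rewrite -(mul0r H); apply: cvgMl; apply: cvg_exprN; rewrite ltr1n.
  have mFF : measurable_fun Omega (fun x => F k x - Fs x) by exact: measurable_funB.
  have lFF := (limF k).1.
  rewrite -RintegralB//; last 2 first.
  - exact: (L1_prod mO (mF k) mh (lF k) lh).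
  - exact: (L1_prod mO mFs mh lFs lh).
  under eq_Rintegral do rewrite -mulrBl.
  apply: le_trans (le_normr_Rintegral mO (L1_prod mO mFF mh lFF lh)) _.
  have e2 : 0 < 2 ^- k :> R by rewrite invr_gt0 exprn_gt0.
  apply: le_trans (Rint_prod_le mO e2 mFF mh lFF lh) _.
  rewrite lerD2r invrK; apply: (@le_trans _ _ (2 ^+ k * 8 ^- k)).
    by rewrite ler_wpM2l ?exprn_ge0// (limF k).2.
  by rewrite -expr_div_n -exprVn (_ : 2 / 8 = 4^-1)//; lra.
(* Rearranged, the claim is the projection inequality: the inner product [As] of the limit point
   with the point of [h] is at least [eps]. *)
suff : eps <= As by rewrite /As; lra.
rewrite -subr_ge0.
(* Compare [y k] with [mix s (y k) h], use [eps < penalty (y k)], let [k] tend to infinity and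
   divide by [s]. *)
have key s : 0 < s <= 1 -> s * (2 * As - eps - penalty h) <= 2 * (As - eps).
  move=> /andP[s0 s1].
  have s01 : 0 <= s <= 1 by rewrite ltW.
  suff : (2 * s - s ^+ 2) * eps - s ^+ 2 * penalty h <= 2 * (s * (1 - s)) * As.
    move=> h1; rewrite -(ler_pM2l s0); move: h1; rewrite expr2; lra.
  have cvL : (2 * s - s ^+ 2) * eps - s ^+ 2 * penalty h - harmonic k @[k --> \oo] -->
      (2 * s - s ^+ 2) * eps - s ^+ 2 * penalty h - 0.
    by apply: cvgB; [exact: cvg_cst|exact: cvg_harmonic].
  rewrite subr0 in cvL.
  have cvR : 2 * (s * (1 - s)) * A k @[k --> \oo] --> 2 * (s * (1 - s)) * As.
    by apply: cvgM; [exact: cvg_cst|exact: cvA].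
  apply: (ler_cvg_to cvL cvR).
  apply: nearW => k.
  have := ymin (j k) _ (competitor_mix s01 (yc k) hc); rewrite penalty_mix// -/(y k).
  have hj : (j k).+1%:R^-1 <= harmonic k :> R.
    by rewrite /harmonic /= lef_pV2 ?posrE// ler_nat ltnS.
  have := He _ (yc k); rewrite -/(A k); move: hj (penalty (y k)) => /=.
  move: ((j k).+1%:R^-1) (k.+1%:R^-1) => a b ab p pe.
  have : 0 <= (2 * s - s ^+ 2) * (p - eps).
    by rewrite mulr_ge0 ?subr_ge0 ?(ltW pe)// expr2; nra.
  by move: (s * (1 - s)) => q; lra.
have := le0_of_small_slope key; lra.
Qed.

(* Otherwise [separation] applies. Let [V] be a weighted mean of the separating function and
   [ubar]; taking [th = 1] exactly where [g0] pushes [V] out of [[ul, uu]] turns the separation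
   into a strict improvement of [ubar] by the truncation of [V] to [[ul, uu]]. *)
Let penalty_small (eps : R) : 0 < eps -> exists2 y, competitor y & penalty y <= eps.
Proof.
move=> e0; apply: contrapT => ne.
have He y : competitor y -> eps < penalty y.
  by move=> yc; rewrite ltNge; apply/negP => pe; apply: ne; exists y.
have [u [t [mu_ lu_ lug sep]]] := separation e0 He.
(* The slope [t] may have either sign. Adding [tau] times the inequality [ubar_le] gives the dual
   value the coefficient [S >= 1]. *)
pose tau := 1 + `|t|; pose S := t + tau.
have S0 : 0 < S by rewrite /S /tau; have := ler_norm (- t); rewrite normrN; lra.
have tau0 : 0 <= tau by rewrite /tau addr_ge0.
have [B uB] := ubar_bound.
have lub : L1 ubar by apply: (@L1_bounded _ _ _ _ _ mO _ B).
have lubg : L1 (fun x => ubar x * g0 x) by apply: (@L1Ml _ _ _ _ _ mO _ _ B).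
pose V x := S^-1 * (u x + tau * ubar x).
have mV : measurable_fun Omega V.
  by apply: measurable_funM => //; apply: measurable_funD => //; exact: measurable_funM.
have lV : L1 V by apply: L1Z => //; apply: L1D => //; exact: L1Z.
have lVg : L1 (fun x => V x * g0 x).
  rewrite (_ : (fun x => V x * g0 x) = fun x => S^-1 * (u x * g0 x + tau * (ubar x * g0 x))).
    by apply: L1Z => //; apply: L1D => //; exact: L1Z.
  by apply/funext => x; rewrite /V; ring.
pose A := (Omega `&` g0 @^-1` `]0, +oo[ `&` (Omega `&` V @^-1` `]-oo, ul[)) `|`
          (Omega `&` g0 @^-1` `]-oo, 0[ `&` (Omega `&` V @^-1` `]uu, +oo[)).
have mA : measurable A.
  by apply: measurableU; apply: measurableI; (apply: mg || apply: mV) => //; exact: measurable_itv.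
pose th : 'rV[R]_n -> R := \1_A.
have th01 x : 0 <= th x <= 1 by rewrite /th indicE; case: (_ \in _); rewrite ?lexx ?ler01.
have hc phi : TV_test Omega phi -> competitor (phi, th).
  by move=> tp; split => //=; exact: measurable_indic.
have lTV : L1 (fun x => g0 x * clamp (V x)).
  under eq_fun do rewrite mulrC; apply: (@L1Ml _ _ _ _ _ mO _ _ (`|ul| + `|uu|)) => //.
  exact: measurableT_comp.
(* Since [th] is the same for every test field, the inequality for the competitors [(phi, th)]
   bounds the variation of [V] by [M]. By [TV_contraction] the truncation inherits this bound, so
   its functional is at most [c - eps / S], below the optimum. *)
pose M := c - eps / S - I (fun x => g0 x * clamp (V x)).
have MV phi : TV_test Omega phi -> I (fun x => V x * divergence phi x) <= M.
  move=> tp; have h := hc _ tp; have h1 := sep _ h; have h2 := ubar_le h.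
  have [B' B'0 dB] := divergence_bounded tp.
  have ldiv w : L1 w -> L1 (fun x => w x * divergence phi x).
    move=> lw; under eq_fun do rewrite mulrC; apply: (@L1Ml _ _ _ _ _ mO _ _ B') => //.
    exact: mdiv.
  have lthg w : L1 (fun x => w x * g0 x) -> L1 (fun x => w x * ((1 - th x) * g0 x)).
    move=> lw; under eq_fun do rewrite mulrCA; apply: (@L1Ml _ _ _ _ _ mO _ _ 1) => //.
      by apply: measurable_funB => //; exact: measurable_indic.
    by move=> x _; have /andP[? ?] := th01 x; rewrite ger0_norm; lra.
  have lres w : L1 w -> L1 (fun x => w x * g0 x) -> L1 (fun x => w x * resid (phi, th) x).
    move=> lw lwg; rewrite /resid /=; under eq_fun do rewrite mulrDr.
    by apply: L1D => //; [exact: ldiv|exact: lthg].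
  have h3 : I (fun x => V x * resid (phi, th) x) + value (phi, th) <= c - eps / S.
    rewrite -(ler_pM2l S0) [leRHS]mulrBr mulrCA mulfV ?gt_eqF// mulr1.
    have -> : I (fun x => V x * resid (phi, th) x) =
        S^-1 * (I (fun x => u x * resid (phi, th) x) + tau * I (fun x => ubar x * resid (phi, th) x)).
      rewrite -RintegralZl//; last exact: lres.
      rewrite -RintegralD//; [|exact: lres|by apply: L1Z => //; exact: lres].
      rewrite -RintegralZl//; last by apply: L1D => //; [exact: lres|by apply: L1Z => //; exact: lres].
      by apply: eq_Rintegral => x _; rewrite /V; ring.
    rewrite mulrDr mulrA mulfV ?gt_eqF// mul1r.
    have := ler_wpM2l tau0 h2; rewrite /S mulrDr; lra.
  rewrite /M lerBrDr; apply: le_trans h3.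
  have -> : I (fun x => V x * resid (phi, th) x) =
      I (fun x => V x * divergence phi x) + I (fun x => V x * ((1 - th x) * g0 x)).
    by rewrite -RintegralD//; [apply: eq_Rintegral => x _; rewrite /resid mulrDr|exact: ldiv|exact: lthg].
  rewrite -addrA lerD2l /value -RintegralD//; [|exact: lthg|exact: lvalue].
  apply: Rint_le => //; first by apply: L1D => //; [exact: lthg|exact: lvalue].
  move=> x Ox /=.
  (* On [A] the cost equals [g0 * clamp V]; off [A], replacing [V] by [clamp V] can only decrease
     [g0 * V]. *)
  have [Ax|nAx] := pselect (A x).
    rewrite /th indicE mem_set//= subrr mul0r mulr0 add0r mul1r /cost /clamp.
    case: Ax => -[[_ /=]]; rewrite in_itv/= ?andbT => g [_ /=]; rewrite in_itv/= ?andbT => v.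
      rewrite (max_l (ltW g)) (min_r (ltW g)) (max_r (ltW v)) (min_l lu) mulr0 addr0 mulrC//.
    rewrite (max_r (ltW g)) (min_l (ltW g)) mulr0 add0r mulrC (max_l _) ?(min_r (ltW v))//.
    by apply: le_trans (ltW v).
  rewrite /th indicE memNset//= subr0 mul0r mul1r addr0 [leRHS]mulrC.
  have [g|g|->] := ltgtP (g0 x) 0; last by rewrite !mul0r.
    have : V x <= uu.
      rewrite leNgt; apply/negP => v; apply: nAx; right.
      by split; split => //=; rewrite in_itv/= ?andbT.
    move=> v; rewrite ler_wnM2l ?(ltW g)// clampE.
    by case: (leP (V x) ul) => h4; case: (leP (V x) uu) => h5; lra.
  have : ul <= V x.
    rewrite leNgt; apply/negP => v; apply: nAx; left.
    by split; split => //=; rewrite in_itv/= ?andbT.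
  move=> v; rewrite ler_wpM2l ?(ltW g)// clampE.
  by case: (leP (V x) ul) => h4; case: (leP (V x) uu) => h5; lra.
have := optimal (measurableT_comp measurable_clamp mV) (fun x => clamp_bnd (V x))
  (TV_contraction oO lV MV measurable_clamp clamp_contraction clamp_abs).
rewrite /M; have : 0 < eps / S by rewrite divr_gt0.
by rewrite /=; lra.
Qed.

Let sum_sqr y x := \sum_(i < n) y.1 x 0 i ^+ 2 + y.2 x ^+ 2.

Let mcoord y i : competitor y -> measurable_fun Omega (fun x => y.1 x 0 i).
Proof.
move=> [t _ _]; apply: measurable_funTS; apply: continuous_measurable_rV.
by apply: C1_continuous; exact: TV_test_C1 t.
Qed.

Let lsum_sqr y : competitor y -> L1 (sum_sqr y).
Proof.
move=> v; have [t m b] := v; apply: (@L1_bounded _ _ _ _ _ mO _ 2) => //.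
  apply: measurable_funD; last exact: measurable_funX.
  by apply: measurable_sum => i; apply: measurable_funX; exact: mcoord.
move=> x _; rewrite ger0_norm; last by rewrite addr_ge0 ?sqr_ge0// sumr_ge0// => i _; exact: sqr_ge0.
rewrite (_ : 2 = 1 + 1)//; apply: lerD; first exact: TV_test_sum_sqr_le1 t.
by have /andP[b0 b1] := b x; rewrite expr_le1.
Qed.

(* The approximate maximisers of the dual problem are bounded in L^2, so those of nearly
   least norm converge strongly. *)
Lemma dual_solution : exists (sigma : field) (th : 'rV[R]_n -> R),
  [/\ forall i, measurable_fun Omega (fun x => sigma x 0 i),
      {ae mu, forall x, Omega x -> enorm (sigma x) <= 1},
      measurable_fun Omega th & forall x, 0 <= th x <= 1] /\
  [/\ forall psi : 'rV[R]_n -> R, Ck 1 psi -> csupp Omega psi ->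
        I (fun x => \sum_(i < n) sigma x 0 i * partial i psi x) =
        - I (fun x => (th x - 1) * g0 x * psi x),
      forall (u : 'rV[R]_n -> R) (B M : R), measurable_fun Omega u -> (forall x, Omega x -> `|u x| <= B) ->
        (forall phi, TV_test Omega phi -> I (fun x => u x * divergence phi x) <= M) ->
        I (fun x => (th x - 1) * g0 x * u x) <= M &
      c <= I (fun x => th x * cost x)].
Proof.
(* Small penalty controls only residuals and values. Near minimality of [Q] within these sets,
   closed under midpoints by convexity of [penalty], is what makes the fields and weights themselves
   converge. *)
pose C k := [set y | competitor y /\ penalty y <= 4 ^- k].
pose Q y := I (sum_sqr y).
pose diff2 y z x := \sum_(i < n) (y.1 x 0 i - z.1 x 0 i) ^+ 2 + (y.2 x - z.2 x) ^+ 2.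
pose D y z := I (diff2 y z).
have midE y z x : diff2 y z x = 2 * sum_sqr y x + 2 * sum_sqr z x - 4 * sum_sqr (mix half y z) x.
  rewrite /diff2 /sum_sqr /mix /=.
  have -> : \sum_(i < n) (y.1 x 0 i - z.1 x 0 i) ^+ 2 =
      2 * (\sum_(i < n) y.1 x 0 i ^+ 2) + 2 * (\sum_(i < n) z.1 x 0 i ^+ 2)
      - 4 * \sum_(i < n) combine half y.1 z.1 x 0 i ^+ 2.
    rewrite !mulr_sumr -big_split -sumrB /=; apply: eq_bigr => i _.
    by rewrite combineE /half; field.
  by rewrite /half; field.
have ldiff2 y z : competitor y -> competitor z -> L1 (diff2 y z).
  move=> v v'; rewrite (_ : diff2 y z = fun x => 2 * sum_sqr y x + 2 * sum_sqr z x - 4 * sum_sqr (mix half y z) x).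
    apply: L1B => //; last by apply: L1Z => //; apply: lsum_sqr; exact: competitor_mix.
    by apply: L1D => //; apply: L1Z => //; exact: lsum_sqr.
  by apply/funext => x; exact: midE.
have [y_ [yC yCau _]] : exists x_ : nat -> pair_t, [/\ forall n, C n (x_ n),
    (forall e : R, 0 < e -> exists N, forall m n, (N <= m)%N -> (N <= n)%N ->
       D (x_ m) (x_ n) <= e) &
    forall n y, C n y -> Q (x_ n) <= Q y + n.+1%:R^-1].
  (* The integrand of [Q] is at most 2: the squared length of the field and the square of the weight
     are each at most 1. *)
  apply: (@nested_minimizers R pair_t C (mix half) Q D (I (fun=> 2))).
  - move=> k y [yc yk]; split => //; apply: le_trans yk _.
    by rewrite lef_pV2 ?posrE ?exprn_gt0// ler_eXn2l// ltr1n.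
  - move=> k y z [yc yk] [zc zk]; split; first exact: competitor_mix.
    rewrite penalty_mix//; have := polar_le yc zc; rewrite /half.
    by move: (4 ^- k) yk zk => a; lra.
  - by move=> y _; apply: Rintegral_ge0 => x _; rewrite addr_ge0 ?sqr_ge0// sumr_ge0// => i _; exact: sqr_ge0.
  - move=> k; have e0 : 0 < 4 ^- k :> R by rewrite invr_gt0 exprn_gt0.
    have [y yc yk] := penalty_small e0; exists y => //.
    have [t m b] := yc.
    apply: Rint_le => //; [exact: lsum_sqr|] => x _.
    rewrite (_ : 2 = 1 + 1)//; apply: lerD; first exact: TV_test_sum_sqr_le1 t.
    by have /andP[b0 b1] := b x; rewrite expr_le1.
  - move=> y z [yc _] [zc _]; rewrite /D /Q.
    have mc : competitor (mix half y z) by exact: competitor_mix.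
    under eq_Rintegral do rewrite midE.
    have l1 := lsum_sqr yc; have l2 := lsum_sqr zc; have l3 := lsum_sqr mc.
    rewrite RintegralB//; [|by apply: L1D => //; exact: L1Z|exact: L1Z].
    by rewrite RintegralD//; [rewrite !RintegralZl|exact: L1Z|exact: L1Z].
have [j [jk jP]] := fast_subsequence yCau.
pose y k := y_ (j k).
have yc k : competitor (y k) by case: (yC (j k)).
have yt k : TV_test Omega (y k).1 by case: (yc k).
have mth k : measurable_fun Omega (y k).2 by case: (yc k).
have th01 k x : 0 <= (y k).2 x <= 1 by case: (yc k).
have yp k : penalty (y k) <= 4 ^- k.
  case: (yC (j k)) => _ /le_trans; apply.
  by rewrite lef_pV2 ?posrE ?exprn_gt0// ler_eXn2l ?ltr1n.
have Dk k : D (y k.+1) (y k) <= 8 ^- k by exact: jP.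
have /choice[sig sigP] i : exists f : 'rV[R]_n -> R, measurable_fun Omega f /\
    {ae mu, forall x, Omega x -> (y k).1 x 0 i @[k --> \oo] --> f x}.
  have [||k|f mf cf] := @L2_fast_ae_cvg _ _ _ mu Omega mO (fun k x => (y k).1 x 0 i).
  - by move=> k; exact: mcoord.
  - move=> k; apply: (@L1_bounded _ _ _ _ _ mO _ 1) => //.
      by apply: measurable_funX; exact: mcoord.
    move=> x _; rewrite normrX expr_le1//; exact: TV_test_coord_le1 (yt k).
  - apply: le_trans (Dk k); apply: Rint_le => //.
    + apply: (@L1_bounded _ _ _ _ _ mO _ (2 ^+ 2)) => //.
        by apply: measurable_funX; apply: measurable_funB; exact: mcoord.
      move=> x _; rewrite normrX ler_pXn2r ?nnegrE//.
      apply: le_trans (ler_normB _ _) _; rewrite (_ : 2 = 1 + 1)//.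
      by apply: lerD; apply: TV_test_coord_le1; exact: yt.
    + exact: ldiff2.
    move=> x _; rewrite /diff2 (bigD1 i)//= -addrA lerDl addr_ge0 ?sqr_ge0// sumr_ge0// => l _.
    exact: sqr_ge0.
  by exists f.
have [th' mth' cth'] : exists2 f : 'rV[R]_n -> R, measurable_fun Omega f &
    {ae mu, forall x, Omega x -> (y k).2 x @[k --> \oo] --> f x}.
  apply: (@L2_fast_ae_cvg _ _ _ mu Omega mO (fun k x => (y k).2 x)) => // k.
    apply: (@L1_bounded _ _ _ _ _ mO _ 1) => //; first exact: measurable_funX.
    by move=> x _; have /andP[? ?] := th01 k x; rewrite normrX expr_le1// ger0_norm.
  apply: le_trans (Dk k); apply: Rint_le => //.
  - apply: (@L1_bounded _ _ _ _ _ mO _ 1) => //.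
      by apply: measurable_funX; exact: measurable_funB.
    move=> x _; have /andP[? ?] := th01 k x; have /andP[? ?] := th01 k.+1 x.
    by rewrite normrX expr_le1// ler_norml; apply/andP; split; lra.
  - exact: ldiff2.
  by move=> x _; rewrite /diff2 lerDr sumr_ge0// => l _; exact: sqr_ge0.
(* Truncation makes the bounds hold everywhere, and it changes the limit on a null set only. *)
pose th x := Num.min (Num.max (th' x) 0) 1.
have th_01 x : 0 <= th x <= 1.
  rewrite /th; case: (leP (th' x) 0) => h; first by rewrite (min_l ler01) lexx ler01.
  by case: (leP (th' x) 1) => h'; rewrite ?lexx ?ler01 ?(ltW h).
have mthl : measurable_fun Omega th by apply: measurable_minr => //; exact: measurable_maxr.
have cth : {ae mu, forall x, Omega x -> (y k).2 x @[k --> \oo] --> th x}.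
  apply: filterS cth' => x h Ox; have hx := h Ox.
  have h0 : 0 <= th' x by apply: (cvg_ge_cst hx) => k; have /andP[] := th01 k x.
  have h1 : th' x <= 1 by apply: (cvg_le_cst hx) => k; have /andP[] := th01 k x.
  by rewrite /th (max_l h0) (min_l h1).
pose sigma x : 'rV[R]_n := \row_i sig i x.
have sigE i x : sigma x 0 i = sig i x by rewrite mxE.
have csig : {ae mu, forall x, Omega x -> forall i, (y k).1 x 0 i @[k --> \oo] --> sig i x}.
  have : {ae mu, forall x i, Omega x -> (y k).1 x 0 i @[k --> \oo] --> sig i x}.
    by apply: filter_forall => i; case: (sigP i).
  by apply: filterS => x h Ox i; exact: h.
have W0 : 0 <= I weight by apply: Rintegral_ge0 => x _; rewrite ltW.
(* As the divergence is [resid] minus [(1 - th) g0], it remains to see that the residuals vanish in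
   L^1. This follows from [penalty (y k) <= 4 ^- k] by Cauchy-Schwarz against the square root of
   [weight], with [eta = 2 ^- k]. *)
have conv (u : 'rV[R]_n -> R) (B : R) : measurable_fun Omega u -> (forall x, Omega x -> `|u x| <= B) ->
    I (fun x => u x * divergence (y k).1 x) @[k --> \oo] --> I (fun x => (th x - 1) * g0 x * u x).
  move=> mu_ uB.
  have lug : L1 (fun x => u x * g0 x) by apply: (@L1Ml _ _ _ _ _ mO _ _ B).
  have lthg k : L1 (fun x => ((y k).2 x - 1) * g0 x * u x).
    rewrite (_ : (fun x => _) = fun x => ((y k).2 x - 1) * (u x * g0 x)); last by apply/funext => x; ring.
    apply: (@L1Ml _ _ _ _ _ mO _ _ 1) => //; first exact: measurable_funB.
    by move=> x _; have /andP[? ?] := th01 k x; rewrite ler_norml; apply/andP; split; lra.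
  have lures k : L1 (fun x => u x * resid (y k) x).
    apply: (@L1Ml _ _ _ _ _ mO _ _ B) => //.
    have [B' B'0 dB] := divergence_bounded (yt k).
    apply: L1D => //; first by apply: (@L1_bounded _ _ _ _ _ mO _ B') => //; exact: mdiv.
    apply: (@L1Ml _ _ _ _ _ mO _ _ 1) => //; first exact: measurable_funB.
    by move=> x _; have /andP[? ?] := th01 k x; rewrite ler_norml; apply/andP; split; lra.
  have -> : (fun k => I (fun x => u x * divergence (y k).1 x)) =
      (fun k => I (fun x => u x * resid (y k) x) + I (fun x => ((y k).2 x - 1) * g0 x * u x)).
    apply/funext => k; rewrite -RintegralD//; apply: eq_Rintegral => x _.
    by rewrite /resid; ring.
  rewrite -[X in _ --> X]add0r; apply: cvgD.
    apply: (@cvg_dist_le _ _ _ (fun k => `|B| * (2 ^- k + 2 ^- k * I weight))) => [k|]; last first.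
      rewrite -(mulr0 `|B|); apply: cvgMr; rewrite -[X in _ --> X]addr0.
      apply: cvgD; first by apply: cvg_exprN; rewrite ltr1n.
      by rewrite -(mul0r (I weight)); apply: cvgMl; apply: cvg_exprN; rewrite ltr1n.
    rewrite subr0; apply: le_trans (le_normr_Rintegral mO (lures k)) _.
    have e2 : 0 < 2 ^- k :> R by rewrite invr_gt0 exprn_gt0.
    have lFs := L1_prod mO (mwresid (yc k)) msqrtw (lwresid (yc k)) lsqrtw.
    apply: (@le_trans _ _ (`|B| * I (fun x => `|wresid (y k) x * Num.sqrt (weight x)|))).
      rewrite -RintegralZl//; last exact: L1_abs.
      apply: Rint_le => //; [exact: L1_abs|by apply: L1Z => //; exact: L1_abs|].
      move=> x Ox; rewrite /wresid divfK ?gt_eqF// normrM ler_wpM2r//.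
      by apply: le_trans (uB x Ox) (ler_norm _).
    rewrite ler_wpM2l//.
    apply: le_trans (Rint_prod_le mO e2 (mwresid (yc k)) msqrtw (lwresid (yc k)) lsqrtw) _.
    rewrite invrK; under [X in _ + _ * X <= _]eq_Rintegral do rewrite sqrtw_sqr.
    rewrite lerD2r; apply: (@le_trans _ _ (2 ^+ k * 4 ^- k)).
      rewrite ler_wpM2l ?exprn_ge0//; apply: le_trans (yp k).
      by rewrite /penalty lerDl sqr_ge0.
    by rewrite -expr_div_n -exprVn (_ : 2 / 4 = 2^-1)//; lra.
  have [] := @Rint_dct _ _ _ mu Omega mO (fun k x => ((y k).2 x - 1) * g0 x * u x)
    (fun x => (th x - 1) * g0 x * u x) (fun x => `|u x * g0 x|) => //.
  - by move=> k; exact: L1_measurable (lthg k).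
  - by apply: measurable_funM => //; apply: measurable_funM => //; exact: measurable_funB.
  - apply: filterS cth => x h Ox; apply: cvgMl; apply: cvgMl.
    by apply: cvgB; [exact: h|exact: cvg_cst].
  - exact: L1_abs.
  - move=> k x Ox; rewrite -mulrA [g0 x * _]mulrC normrM ler_piMl//.
    by have /andP[? ?] := th01 k x; rewrite ler_norml; apply/andP; split; lra.
exists sigma, th; split; split => //.
- by move=> i; under eq_fun do rewrite sigE; case: (sigP i).
- apply: filterS csig => x h Ox; rewrite enorm_le// expr1n.
  have cs : \sum_(i < n) (y k).1 x 0 i ^+ 2 @[k --> \oo] --> \sum_(i < n) sigma x 0 i ^+ 2.
    apply: cvg_sum_fun => i; rewrite sigE expr2; under eq_fun do rewrite expr2.
    by apply: cvgM; exact: h.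
  by apply: (cvg_le_cst cs) => k; exact: TV_test_sum_sqr_le1 (yt k).
- move=> psi Cpsi [K [cK KO pK]].
  have [B B0 psiB] := compact_continuous_bounded cK (C1_continuous Cpsi) pK.
  have mpsi : measurable_fun Omega psi.
    by apply: measurable_funTS; apply: continuous_measurable_rV; exact: C1_continuous.
  have cv1 := conv psi B mpsi (fun x _ => psiB x).
  have /choice[b bP] i : exists b, forall x, `|partial i psi x| <= b.
    by have [b _ bP] := compact_continuous_bounded cK (C1_partial_continuous (i := i) Cpsi) (C1_vanish_partial i cK pK); exists b.
  have mpart i : measurable_fun Omega (partial i psi).
    by apply: measurable_funTS; apply: continuous_measurable_rV; exact: C1_partial_continuous.
  have [] := @Rint_dct _ _ _ mu Omega mO (fun k x => \sum_(i < n) (y k).1 x 0 i * partial i psi x)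
    (fun x => \sum_(i < n) sigma x 0 i * partial i psi x) (fun=> \sum_(i < n) b i).
  + move=> k; apply: measurable_sum => i; apply: measurable_funM => //; exact: mcoord.
  + apply: measurable_sum => i; apply: measurable_funM => //.
    by under eq_fun do rewrite sigE; case: (sigP i).
  + apply: filterS csig => x h Ox; apply: cvg_sum_fun => i; rewrite sigE.
    by apply: cvgMl; exact: h.
  + exact: lcst.
  + move=> k x _; apply: le_trans (ler_norm_sum _ _ _) _; apply: ler_sum => i _.
    rewrite normrM -[leRHS]mul1r; apply: ler_pM => //; exact: TV_test_coord_le1 (yt k).
  move=> _ cv2.
  have ibp k : I (fun x => \sum_(i < n) (y k).1 x 0 i * partial i psi x) =
      - I (fun x => psi x * divergence (y k).1 x).
    have [K' [cK' KO' pK']] := TV_test_support (yt k).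
    rewrite (integration_by_parts_compact cK' KO' _ pK' Cpsi) => [|i]; last exact: TV_test_C1 (yt k).
    by congr (- _); apply: eq_Rintegral => x _; rewrite mulrC.
  have cv3 : - I (fun x => psi x * divergence (y k).1 x) @[k --> \oo] -->
      - I (fun x => (th x - 1) * g0 x * psi x) by exact: cvgN.
  have : (fun k => I (fun x => \sum_(i < n) (y k).1 x 0 i * partial i psi x)) =
      (fun k => - I (fun x => psi x * divergence (y k).1 x)) by apply/funext => k; exact: ibp.
  move=> E; rewrite E in cv2.
  exact: (cvg_unique _ cv2 cv3).
- move=> u B M mu_ uB uM; apply: (cvg_le_cst (conv u B mu_ uB)) => k; exact: uM.
- have [] := @Rint_dct _ _ _ mu Omega mO (fun k x => (y k).2 x * cost x)
    (fun x => th x * cost x) (fun x => `|cost x|).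
  + by move=> k; exact: measurable_funM.
  + exact: measurable_funM.
  + by apply: filterS cth => x h Ox; apply: cvgMl; exact: h.
  + exact: L1_abs.
  + by move=> k x _; have /andP[? ?] := th01 k x; rewrite normrM ler_piMl// ger0_norm.
  move=> _ cv.
  have cvc : value (y k) @[k --> \oo] --> c.
    apply: (@cvg_dist_le _ _ _ (fun k => 2 ^- k)) => [k|]; last by apply: cvg_exprN; rewrite ltr1n.
    rewrite -(@ler_pXn2r _ 2) ?nnegrE ?invr_ge0 ?exprn_ge0// real_normK ?num_real//.
    have -> : (2 ^- k) ^+ 2 = 4 ^- k :> R.
      by rewrite -!exprVn -exprM mulnC exprM; congr (_ ^+ _); rewrite expr2; lra.
    rewrite -sqrrN opprB.
    by apply: le_trans (yp k); rewrite /penalty lerDr Rintegral_ge0// => x _; exact: sqr_ge0.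
  by rewrite (cvg_unique _ cv cvc).
Qed.

End duality.

(** * Lp norms *)

Section lp_norms.
Context (R : realType) (n : nat).
Local Notation mu := (lebesgue_rV R n).
Variables (Omega : set 'rV[R]_n) (mO : measurable Omega).
Implicit Types (f g : 'rV[R]_n -> R) (r : R).
Local Notation L1 f := (mu.-integrable Omega (EFin \o f)).
Local Notation Lp_norm r f := (LpNorm Omega r%:E f).

Lemma measurable_patch f : measurable_fun Omega f ->
  measurable_fun setT ((EFin \o f) \_ Omega).
Proof.
by move=> mf; apply/(measurable_restrictT _ mO); exact/measurable_EFinP.
Qed.

Lemma measurable_norm_powR f r : measurable_fun Omega f ->
  measurable_fun Omega (fun x => `|f x| `^ r).
Proof.
move=> mf; apply: (@measurableT_comp _ _ _ _ _ _ (@powR R ^~ r)) => //.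
exact: measurableT_comp.
Qed.

Lemma LpNormE f r : 0 < r ->
  Lp_norm r f = ((\int[mu]_(x in Omega) (`|f x| `^ r)%:E) `^ r^-1)%E.
Proof.
move=> r0; rewrite /LpNorm unlock [in RHS]integral_mkcond; congr (_ `^ _)%E.
apply: eq_integral => x _; rewrite /patch; case: ifPn => _ //.
by rewrite abse0 poweR0r// gt_eqF.
Qed.

Lemma in_LpP f r : 0 < r -> measurable_fun Omega f ->
  in_Lp Omega r%:E f <-> L1 (fun x => `|f x| `^ r).
Proof.
move=> r0 mf; have E : (\int[mu]_(x in Omega) `|(`|f x| `^ r)%:E| = \int[mu]_(x in Omega) (`|f x| `^ r)%:E)%E.
  by apply: eq_integral => x _; rewrite gee0_abs// lee_fin powR_ge0.
rewrite /in_Lp LpNormE//; split.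
  move=> [_ h]; apply/integrableP; split.
    by apply/measurable_EFinP; exact: measurable_norm_powR.
  by rewrite E; apply: lty_poweRy h; rewrite gt_eqF// invr_gt0.
by move=> /integrableP[_]; rewrite E => h; split => //; exact: poweR_lty.
Qed.

Lemma in_Lp_le f g r : 0 < r -> measurable_fun Omega f -> (forall x, Omega x -> `|f x| <= `|g x|) ->
  in_Lp Omega r%:E g -> in_Lp Omega r%:E f.
Proof.
move=> r0 mf fg gp; have mg : measurable_fun Omega g by case: gp.
apply/(in_LpP r0 mf); have /(in_LpP r0 mg) lg := gp.
apply: (L1_dom mO _ _ lg); first exact: measurable_norm_powR.
move=> x Ox; rewrite ger0_norm ?powR_ge0//.
by apply: ge0_ler_powR; rewrite ?nnegrE ?(ltW r0)// fg.
Qed.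

(** On a set of finite measure [1 + |f|^r] is an integrable majorant of [|f|]. *)
Lemma in_Lp_L1 f r : (mu Omega < +oo)%E -> 1 <= r -> in_Lp Omega r%:E f -> L1 f.
Proof.
move=> muO r1 fp; have r0 : 0 < r by exact: lt_le_trans r1.
have mf : measurable_fun Omega f by case: fp.
have /(in_LpP r0 mf) lf := fp.
have l1 : L1 (fun=> 1) by apply: (@L1_bounded _ _ _ _ _ mO _ `|1|).
apply: (L1_dom mO mf _ (L1D mO l1 lf)) => x Ox /=.
 have [h|h] := leP `|f x| 1; first by rewrite ler_wpDr// powR_ge0.
by apply: ler_wpDl => //; apply: le1r_powR => //; exact: ltW.
Qed.

Lemma bounded_in_Lp f r (B : R) : (mu Omega < +oo)%E -> 0 < r -> measurable_fun Omega f ->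
  (forall x, Omega x -> `|f x| <= B) -> in_Lp Omega r%:E f.
Proof.
move=> muO r0 mf fB; apply/(in_LpP r0 mf); apply: (@L1_bounded _ _ _ _ _ mO _ (B `^ r)) => //.
  exact: measurable_norm_powR.
move=> x Ox; rewrite ger0_norm ?powR_ge0//.
by apply: ge0_ler_powR; rewrite ?nnegrE ?(ltW r0)// ?fB// (le_trans _ (fB x Ox)).
Qed.

(** Turns almost everywhere bounds into the pointwise ones that [L1Ml] and [bounded_in_Lp] ask for;
    [|B|] keeps the truncation interval nonempty when [B] is negative. *)
Lemma ae_bounded_representative f (B : R) : measurable_fun Omega f ->
  ae_on Omega (fun x => `|f x| <= B) ->
  exists g, [/\ measurable_fun Omega g, forall x, `|g x| <= `|B| & ae_on Omega (fun x => g x = f x)].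
Proof.
move=> mf fB; have B0 := normr_ge0 B.
exists (fun x => Num.max (- `|B|) (Num.min (f x) `|B|)); split.
- by apply: measurable_maxr => //; exact: measurable_minr.
- move=> x; rewrite ler_norml le_max lexx/= ge_max.
  by rewrite ge_min lexx orbT andbT; lra.
move: fB; rewrite /ae_on; apply: filterS => x h Ox.
have /ler_normlP[h1 h2] := le_trans (h Ox) (ler_norm B).
by rewrite (min_l h2) max_r// lerNl.
Qed.

Lemma ae_bounded_in_Lp f r (B : R) : (mu Omega < +oo)%E -> 0 < r -> measurable_fun Omega f ->
  ae_on Omega (fun x => `|f x| <= B) -> in_Lp Omega r%:E f.
Proof.
move=> muO r0 mf /(ae_bounded_representative mf)[g [mg gB gf]].
have /(in_LpP r0 mg) lg := bounded_in_Lp muO r0 mg (fun x _ => gB x).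
apply/(in_LpP r0 mf); apply: (L1_ae_eq mO _ _ lg); first exact: measurable_norm_powR.
by move: gf; rewrite /ae_on; apply: filterS => x h Ox; rewrite h.
Qed.

Lemma LpNormZ f r (a : R) : 0 < r -> 0 <= a -> measurable_fun Omega f ->
  Lp_norm r (fun x => a * f x) = (a%:E * Lp_norm r f)%E.
Proof.
move=> r0 a0 mf; rewrite !LpNormE//.
under eq_integral do rewrite normrM (ger0_norm a0) powRM// EFinM.
have mp : measurable_fun Omega (fun x => (`|f x| `^ r)%:E).
  by apply/measurable_EFinP; exact: measurable_norm_powR.
rewrite (ge0_integralZl _ mO mp); last 2 first.
- by move=> x _; rewrite lee_fin powR_ge0.
- by rewrite lee_fin powR_ge0.
rewrite poweRM ?lee_fin ?powR_ge0//; last by apply: integral_ge0 => x _; rewrite lee_fin powR_ge0.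
by rewrite poweR_EFin -powRrM mulfV ?gt_eqF// powRr1.
Qed.

Lemma LpNorm_eq0 f r : 0 < r -> measurable_fun Omega f -> Lp_norm r f = 0%E ->
  ae_on Omega (fun x => f x = 0).
Proof.
move=> r0 mf /Lnorm_eq0_eq0; rewrite lte_fin => /(_ (measurable_patch mf) r0).
apply: filterS => x /(_ Logic.I); rewrite /patch => + Ox.
by rewrite (mem_set Ox) => -[].
Qed.

Lemma LpNorm_ge0 f (p : \bar R) : (0 <= LpNorm Omega p f)%E.
Proof. exact: Lnorm_ge0. Qed.

Lemma LpNormyP f (a : R) : (0 < mu Omega)%E -> 0 <= a ->
  (LpNorm Omega +oo f <= a%:E)%E <-> ae_on Omega (fun x => `|f x| <= a).
Proof.
(* The norm at infinity distinguishes whether the whole space has positive measure; [mu Omega > 0]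
   selects the essential supremum. *)
move=> muO a0; rewrite /LpNorm unlock ifT; last first.
  by apply: (lt_le_trans muO); apply: le_measure; rewrite ?inE.
split => [/ess_supP|h]; last apply/ess_supP.
  by apply: filterS => x + Ox; rewrite /= /patch (mem_set Ox)/= lee_fin.
move: h; rewrite /ae_on; apply: filterS => x h; rewrite /= /patch; case: ifPn => [|_]; last by rewrite abse0 lee_fin.
by rewrite inE => /h; rewrite lee_fin.
Qed.

End lp_norms.

(** * First-order condition *)

Section first_order.
Context (R : realType) (n : nat).
Local Notation mu := (lebesgue_rV R n).
Variables (Omega : set 'rV[R]_n) (oO : open Omega) (muO : (mu Omega < +oo)%E).
Implicit Types (u v w g : 'rV[R]_n -> R) (phi : 'rV[R]_n -> 'rV[R]_n).
Local Notation I f := (\int[mu]_(x in Omega) f x).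
Local Notation L1 f := (mu.-integrable Omega (EFin \o f)).

Let mO : measurable Omega. Proof. exact: open_measurable_rV. Qed.

Lemma ae_bounded_L1M g v (B : R) : L1 g -> measurable_fun Omega v ->
  ae_on Omega (fun x => `|v x| <= B) -> L1 (fun x => g x * v x).
Proof.
move=> lg mv /(ae_bounded_representative mv)[w [mw wB wv]].
have lw : L1 (fun x => w x * g x) by apply: (@L1Ml _ _ _ _ _ mO _ _ `|B|).
apply: (L1_ae_eq mO _ _ lw); first by apply: measurable_funM => //; exact: L1_measurable lg.
by move: wv; rewrite /ae_on; apply: filterS => x h Ox; rewrite h// mulrC.
Qed.

Definition TV_bound u (M : R) :=
  forall phi, TV_test Omega phi -> I (fun x => u x * divergence phi x) <= M.

Lemma TV_leP u (M : R) : (TV Omega u <= M%:E)%E <-> TV_bound u M.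
Proof.
split=> [uM phi t|uM]; last by apply: ub_ereal_sup => _ [phi t <-]; rewrite lee_fin; exact: uM.
by rewrite -lee_fin; apply: le_trans uM; apply: ereal_sup_ubound; exists phi.
Qed.

Lemma divergence0 x : divergence (fun=> 0 : 'rV[R]_n) x = 0.
Proof.
rewrite /divergence big1// => i _.
by rewrite (_ : (fun y => _) = fun=> 0) ?partial_cst//; apply/funext => y; rewrite mxE.
Qed.

Lemma TV_ge0 u : (0 <= TV Omega u)%E.
Proof.
apply: ereal_sup_ubound; exists (fun=> 0); first exact: TV_test0.
rewrite /integral_on; under eq_Rintegral do rewrite divergence0 mulr0.
by rewrite Rintegral_cst// mul0r.
Qed.

Lemma TV_testN phi : TV_test Omega phi -> TV_test Omega (fun x => - phi x).
Proof.
move=> t; split => [i||x].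
- rewrite (_ : (fun x => _) = fun x => -1 * phi x 0 i); last by apply/funext => x; rewrite mxE mulN1r.
  by apply: C1Z; exact: TV_test_C1 t.
- have [_ /compactly_supported_vanish_off[K [cK KO pK]] _] := t.
  by apply: (vanish_off_compactly_supported cK KO) => x /pK ->; rewrite oppr0.
- rewrite enorm_le// expr1n; under eq_bigr do rewrite mxE sqrrN.
  exact: TV_test_sum_sqr_le1 t.
Qed.

Lemma divergenceN phi x : TV_test Omega phi -> divergence (fun x => - phi x) x = - divergence phi x.
Proof.
move=> t; rewrite /divergence -sumrN; apply: eq_bigr => i _.
rewrite (_ : (fun y => _) = fun y => -1 * phi y 0 i); last by apply/funext => y; rewrite mxE mulN1r.
by rewrite partialZ ?mulN1r//; exact: TV_test_C1 t.
Qed.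

Lemma L1_divergence u phi : L1 u -> TV_test Omega phi -> L1 (fun x => u x * divergence phi x).
Proof.
move=> lu t; have [B B0 dB] := divergence_bounded t.
under eq_fun do rewrite mulrC.
apply: (@L1Ml _ _ _ _ _ mO _ _ B) => //.
by apply: measurable_funTS; exact: divergence_measurable t.
Qed.

Lemma TV_bound_segment u v (M N t : R) : 0 <= t <= 1 -> L1 u -> L1 v ->
  TV_bound u M -> TV_bound v N -> TV_bound (fun x => u x + t * (v x - u x)) ((1 - t) * M + t * N).
Proof.
move=> /andP[t0 t1] lu lv uM vN phi tp.
have l1 := L1_divergence lu tp; have l2 := L1_divergence lv tp.
have -> : I (fun x => (u x + t * (v x - u x)) * divergence phi x) =
    (1 - t) * I (fun x => u x * divergence phi x) + t * I (fun x => v x * divergence phi x).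
  rewrite -!RintegralZl// -RintegralD//; [|exact: L1Z|exact: L1Z].
  by apply: eq_Rintegral => x _; ring.
by apply: lerD; apply: ler_wpM2l; rewrite ?subr_ge0//; [exact: uM|exact: vN].
Qed.

(** Local minimality is measured by the variation of a difference; testing [u] with [- phi] and [v]
    with [phi] bounds it. *)
Lemma TV_bound_diff u v (M N t : R) : 0 <= t -> L1 u -> L1 v ->
  TV_bound u M -> TV_bound v N -> TV_bound (fun x => t * (v x - u x)) (t * (M + N)).
Proof.
move=> t0 lu lv uM vN phi tp.
have l1 := L1_divergence lu (TV_testN tp); have l2 := L1_divergence lv tp.
have -> : I (fun x => t * (v x - u x) * divergence phi x) =
    t * (I (fun x => u x * divergence (fun x => - phi x) x) + I (fun x => v x * divergence phi x)).
  rewrite -RintegralD// -RintegralZl//; last exact: L1D.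
  by apply: eq_Rintegral => x _; rewrite divergenceN//; ring.
by apply: ler_wpM2l => //; apply: lerD; [exact: uM (TV_testN tp)|exact: vN].
Qed.

Section admissible.
Variables (ul uu : R) (lu : ul <= uu).
Local Notation U := (Uad Omega ul uu).

Lemma Uad_L1 u : U u -> L1 u.
Proof. by case=> -[up _] _; exact: (in_Lp_L1 mO muO (lexx 1) up). Qed.

Lemma Uad_measurable u : U u -> measurable_fun Omega u.
Proof. by move=> /Uad_L1; exact: L1_measurable. Qed.

Lemma Uad_TV u : U u -> TV Omega u = (fine (TV Omega u))%:E.
Proof. by case=> -[_ TVy] _; rewrite fineK// ge0_fin_numE// TV_ge0. Qed.

Lemma Uad_TV_bound u : U u -> TV_bound u (fine (TV Omega u)).
Proof. by move=> Uu; apply/TV_leP; rewrite -Uad_TV. Qed.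

Lemma Uad_diff_bound u v : U u -> U v -> ae_on Omega (fun x => `|v x - u x| <= uu - ul).
Proof.
case=> _ hu [_ hv]; move: hu hv; rewrite /ae_on => hu hv.
apply: filterS2 hu hv => x hu hv Ox.
have /andP[a b] := hu Ox; have /andP[a' b'] := hv Ox.
by rewrite ler_norml; apply/andP; split; lra.
Qed.

Lemma Uad_segment u v (t : R) : 0 <= t <= 1 -> U u -> U v -> U (fun x => u x + t * (v x - u x)).
Proof.
move=> t01 Uu Uv; have lu' := Uad_L1 Uu; have lv := Uad_L1 Uv.
have lw : L1 (fun x => u x + t * (v x - u x)) by apply: L1D => //; apply: L1Z => //; exact: L1B.
split; last first.
  case: Uu Uv => _ hu [_ hv]; move: hu hv; rewrite /ae_on => hu hv.
  apply: filterS2 hu hv => x hu hv Ox.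
  have /andP[a b] := hu Ox; have /andP[a' b'] := hv Ox; have /andP[t0 t1] := t01.
  by apply/andP; split; nra.
split; last first.
  have /TV_leP h := TV_bound_segment t01 lu' lv (Uad_TV_bound Uu) (Uad_TV_bound Uv).
  by apply: le_lt_trans h _; rewrite ltry.
have mw := L1_measurable lw; apply/(in_LpP ltr01 mw).
by under eq_fun do rewrite powRr1//; exact: L1_abs.
Qed.

Variables (q : R) (q1 : 1 < q) (j : ('rV[R]_n -> R) -> R) (ubar g0 : 'rV[R]_n -> R).
Variable D : ('rV[R]_n -> R) -> R.
Hypotheses (derD : feasible_derivative Omega q U j ubar D) (repD : represents Omega q g0 D).
Hypothesis hmin : local_minimizer Omega q U j ubar.

Lemma conjugate_gt1 : 1 < q / (q - 1).
Proof. by have h := q1; rewrite ltr_pdivlMr; lra. Qed.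

Lemma gradient_L1 : L1 g0.
Proof. by apply: (in_Lp_L1 mO muO (ltW conjugate_gt1)); case: repD. Qed.

Lemma gradient_L1M u v : U u -> U v -> L1 (fun x => g0 x * (v x - u x)).
Proof.
move=> Uu Uv; apply: (ae_bounded_L1M gradient_L1 _ (Uad_diff_bound Uu Uv)).
by apply: measurable_funB; exact: Uad_measurable.
Qed.

(* Compare [ubar] with [ubar + t (u - ubar)]: convexity bounds the growth of [TV] by
   [t (TV u - TV ubar)], and the difference quotient of [j] tends to the derivative. *)
Lemma first_order_condition u : U u ->
  fine (TV Omega ubar) <= fine (TV Omega u) + I (fun x => g0 x * (u x - ubar x)).
Proof.
have q0 : 0 < q by exact: lt_trans q1.
have [Ub [rho rho0 hm]] := hmin; move=> Uu.
set T0 := fine (TV Omega ubar); set T1 := fine (TV Omega u).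
have T00 : 0 <= T0 by rewrite fine_ge0// TV_ge0.
have T10 : 0 <= T1 by rewrite fine_ge0// TV_ge0.
pose v x := u x - ubar x.
have mv : measurable_fun Omega v by apply: measurable_funB; exact: Uad_measurable.
have vq : in_Lp Omega q%:E v by apply: (ae_bounded_in_Lp mO muO q0 mv (Uad_diff_bound Ub Uu)).
pose N := fine (LpNorm Omega q%:E v).
have NE : LpNorm Omega q%:E v = N%:E by rewrite fineK// ge0_fin_numE ?LpNorm_ge0//; case: vq.
have N0 : 0 <= N by rewrite fine_ge0// LpNorm_ge0.
have lgv := gradient_L1M Ub Uu.
(* The derivative says nothing about increments of norm 0. For these, [u = ubar] almost everywhere
   and the variations are compared directly. *)
have [Nz|Nz] := eqVneq N 0.
  have v0 : ae_on Omega (fun x => v x = 0) by apply: (LpNorm_eq0 mO q0 mv); rewrite NE Nz.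
  have -> : I (fun x => g0 x * (u x - ubar x)) = 0.
    rewrite (@Rint_ae_eq _ _ _ mu _ mO _ (fun=> 0)) ?Rintegral_cst ?mul0r//.
      exact: L1_measurable lgv.
    by move: v0; rewrite /ae_on; apply: filterS => x h Ox; rewrite -/(v x) h// mulr0.
  rewrite addr0 -lee_fin -(Uad_TV Ub); apply/TV_leP => phi tp.
  rewrite (@Rint_ae_eq _ _ _ mu _ mO _ (fun x => u x * divergence phi x)).
  - exact: Uad_TV_bound.
  - by apply: L1_measurable; apply: L1_divergence => //; exact: Uad_L1.
  - by apply: L1_measurable; apply: L1_divergence => //; exact: Uad_L1.
  by move: v0; rewrite /ae_on; apply: filterS => x h Ox; congr (_ * _); have := h Ox; rewrite /v; lra.
have {Nz}N0 : 0 < N by rewrite lt_neqAle eq_sym Nz.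
rewrite leNgt; apply/negP => lt0.
pose DD := I (fun x => g0 x * (u x - ubar x)); rewrite -/DD in lt0.
(* Half of the assumed gap per unit of norm, so that the remainder of [j] cannot make up for the
   decrease. *)
pose eps := (T0 - T1 - DD) / (2 * N).
have eps0 : 0 < eps by rewrite divr_gt0 ?mulr_gt0// subr_gt0 ltrBrDl.
have [dual frechet] := derD; have [delta delta0 hd] := frechet _ eps0.
(* The step [t = 1 / K] meets all its constraints at once: [t <= 1], [t N < delta], [t N <= rho] and
   [t (T0 + T1) <= rho]. *)
pose K := 1 + N + N / delta + N / rho + (T0 + T1) / rho.
have h1 : 0 <= N / delta by rewrite divr_ge0// ltW.
have h2 : 0 <= N / rho by rewrite divr_ge0// ltW.
have h3 : 0 <= (T0 + T1) / rho by rewrite divr_ge0 ?addr_ge0// ltW.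
have K1 : 1 < K by rewrite /K; lra.
have K0 : 0 < K by exact: lt_trans K1.
pose t := K^-1; have t0 : 0 < t by rewrite invr_gt0.
have t01 : 0 <= t <= 1 by rewrite (ltW t0)/= invf_le1// ltW.
have tdelta : t * N < delta.
  by rewrite /t mulrC ltr_pdivrMr// -ltr_pdivrMl// mulrC /K; lra.
have trho : t * N <= rho.
  by rewrite /t mulrC ler_pdivrMr// -ler_pdivrMl// mulrC /K; lra.
have trho' : t * (T0 + T1) <= rho.
  by rewrite /t mulrC ler_pdivrMr// -ler_pdivrMl// mulrC /K; lra.
pose w x := t * v x.
have mw : measurable_fun Omega w by apply: measurable_funM.
have wE : LpNorm Omega q%:E w = (t * N)%:E by rewrite (LpNormZ mO q0 (ltW t0) mv) NE.
have wq : in_Lp Omega q%:E w by split => //; rewrite wE ltry.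
have Uw : U (fun x => ubar x + w x) by exact: Uad_segment.
have := hd w wq Uw; rewrite wE !lte_fin tdelta mulr_gt0//= => /(_ isT).
rewrite ltr_pdivrMr ?mulr_gt0// => /ltr_normlW; rewrite (proj2 repD _ wq).
have -> : integral_on Omega (fun x => g0 x * w x) = t * DD.
  rewrite /DD -RintegralZl//; apply: eq_Rintegral => x _; rewrite /w /v; ring.
have := hm _ Uw; rewrite (_ : (fun x => ubar x + w x - ubar x) = w); last first.
  by apply/funext => x; ring.
rewrite ge_max wE lee_fin trho andbT.
have /TV_leP Tw := TV_bound_diff (ltW t0) (Uad_L1 Ub) (Uad_L1 Uu) (Uad_TV_bound Ub) (Uad_TV_bound Uu).
have /TV_leP Ts := TV_bound_segment t01 (Uad_L1 Ub) (Uad_L1 Uu) (Uad_TV_bound Ub) (Uad_TV_bound Uu).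
move=> /(_ (le_trans Tw _)); rewrite lee_fin => /(_ trho').
move=> /le_trans /(_ (leeD (lexx _) Ts)); rewrite (Uad_TV Ub) -/T0 -/T1 -!EFinD lee_fin.
move: (j _) (j ubar) => ja jb /= le1 lt1.
have E : eps * (t * N) = t * ((T0 - T1 - DD) / 2) by rewrite /eps; field; rewrite gt_eqF.
have : t * ((T0 - T1 - DD) / 2) > 0 by rewrite mulr_gt0// divr_gt0// subr_gt0 ltrBrDl.
move: lt1; rewrite E; lra.
Qed.

End admissible.
End first_order.

(** * Correction of the supremum norm *)

Section enorm.
Context (R : realType) (n : nat).
Implicit Types x y : 'rV[R]_n.

Lemma enorm_sqr x : enorm x ^+ 2 = \sum_(i < n) x 0 i ^+ 2.
Proof. by rewrite sqr_sqrtr// sumr_ge0// => i _; exact: sqr_ge0. Qed.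

Lemma enormZ (a : R) x : enorm (a *: x) = `|a| * enorm x.
Proof.
rewrite /enorm -sqrtr_sqr -sqrtrM ?sqr_ge0// mulr_sumr; congr Num.sqrt.
by apply: eq_bigr => i _; rewrite mxE exprMn.
Qed.

Lemma enorm0_eq0 x : enorm x = 0 -> x = 0.
Proof.
move=> x0; apply/rowP => i; rewrite mxE; apply/eqP; rewrite -normr_le0 -x0.
exact: coord_le_enorm.
Qed.

(* Jensen: [(a + b)^2 <= (A + B) (a^2 / A + b^2 / B)]. *)
Lemma enormD x y : enorm (x + y) <= enorm x + enorm y.
Proof.
have [/enorm0_eq0 ->|x0] := eqVneq (enorm x) 0; first by rewrite add0r lerDr enorm_ge0.
have [/enorm0_eq0 ->|y0] := eqVneq (enorm y) 0; first by rewrite addr0 lerDl enorm_ge0.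
have A0 : 0 < enorm x by rewrite lt_neqAle eq_sym x0 enorm_ge0.
have B0 : 0 < enorm y by rewrite lt_neqAle eq_sym y0 enorm_ge0.
rewrite enorm_le ?addr_ge0 ?enorm_ge0//.
have := enorm_sqr x; have := enorm_sqr y.
move: A0 B0; set A := enorm x; set B := enorm y => A0 B0 EB EA.
apply: (@le_trans _ _ ((A + B) * (A^-1 * \sum_(i < n) x 0 i ^+ 2 + B^-1 * \sum_(i < n) y 0 i ^+ 2))).
  rewrite mulrDr !mulr_sumr -big_split/=; apply: ler_sum => i _; rewrite mxE -subr_ge0.
  set a := x 0 i; set b := y 0 i.
  rewrite (_ : _ - _ = (B * a - A * b) ^+ 2 / (A * B)); last by field; rewrite ?gt_eqF.
  by rewrite divr_ge0 ?sqr_ge0// mulr_ge0// ltW.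
rewrite -EA -EB !expr2 !mulKf ?gt_eqF//.
Qed.

Lemma enormB x y : enorm (x - y) <= enorm x + enorm y.
Proof. by have := enormD x (-1 *: y); rewrite scaleN1r -scaleN1r enormZ normrN normr1 mul1r. Qed.

Lemma enormN x : enorm (- x) = enorm x.
Proof. by rewrite -scaleN1r enormZ normrN normr1 mul1r. Qed.

End enorm.

(** * A compactly supported divergence-free field *)

Section solenoidal.
Context (R : realType) (n : nat).
Local Notation mu := (lebesgue_rV R n).
Local Notation field := ('rV[R]_n -> 'rV[R]_n).
Implicit Types (sigma tau : field) (Omega : set 'rV[R]_n) (x c : 'rV[R]_n).

(* In the plane of the coordinates [i] and [k] this is the rotation around [c], damped
   by a radial bump function, hence tangent to the level sets of the latter. *)
Definition sqr_dist c x : R := \sum_(k < n) (x 0 k - c 0 k) * (x 0 k - c 0 k).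
Definition bump c (r : R) x : R := pos2 (r ^+ 2 - sqr_dist c x).
Definition rotation (i k : 'I_n) c (r : R) x : 'rV[R]_n :=
  \row_l (if l == i then - ((x 0 k - c 0 k) * bump c r x)
          else if l == k then (x 0 i - c 0 i) * bump c r x else 0).

Let C1_dcoord c k : Ck 1 (fun x : 'rV[R]_n => x 0 k - c 0 k).
Proof. by apply: C1D; [exact: C1_coord|exact: C1_cst]. Qed.

Let partial_dcoord c i k x : partial i (fun y : 'rV[R]_n => y 0 k - c 0 k) x = (i == k)%:R.
Proof.
rewrite partialD; [|exact: C1_coord|exact: C1_cst].
by rewrite partial_coord partial_cst addr0.
Qed.

Let C1_gap c r : Ck 1 (fun x => r ^+ 2 - sqr_dist c x).
Proof.
rewrite (_ : (fun x => _) = fun x => r ^+ 2 + -1 * sqr_dist c x); last by apply/funext => x; rewrite mulN1r.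
apply: C1D; first exact: C1_cst.
by apply: C1Z; apply: C1_sum => k; apply: C1M.
Qed.

Let partial_gap c r i x : partial i (fun x => r ^+ 2 - sqr_dist c x) x = - 2 * (x 0 i - c 0 i).
Proof.
have CS k : Ck 1 (fun x : 'rV[R]_n => (x 0 k - c 0 k) * (x 0 k - c 0 k)) by exact: C1M.
rewrite (_ : (fun x => _) = fun x => r ^+ 2 + -1 * sqr_dist c x); last by apply/funext => y; rewrite mulN1r.
rewrite partialD; [|exact: C1_cst|by apply: C1Z; exact: C1_sum].
rewrite partial_cst partialZ ?partial_sum//; last exact: C1_sum.
rewrite (bigD1 i)//= big1 => [|k ki].
  by rewrite partialM// partial_dcoord eqxx mulr1; lra.
by rewrite partialM// partial_dcoord eq_sym (negbTE ki) mulr0 addr0.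
Qed.

Let C1_bump c r : Ck 1 (bump c r).
Proof. exact: (C1_comp (@is_derive_pos2 R) (@continuous_pos2' R) (C1_gap c r)). Qed.

Let partial_bump c r i x : partial i (bump c r) x =
  2 * Num.max (r ^+ 2 - sqr_dist c x) 0 * (- 2 * (x 0 i - c 0 i)).
Proof. by rewrite (partial_comp i x (@is_derive_pos2 R) (C1_gap c r)) partial_gap. Qed.

Let C1_rotation i k c r l : Ck 1 (fun x => rotation i k c r x 0 l).
Proof.
under eq_fun do rewrite mxE.
have [_|_] := boolP (l == i); first by under eq_fun do rewrite -mulN1r; apply: C1Z; exact: C1M.
by have [_|_] := boolP (l == k); [exact: C1M|exact: C1_cst].
Qed.

(** The gradient of [bump] at [x] is a multiple of [x - c], so the contributions of the components
    [i] and [k] cancel. *)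
Lemma divergence_rotation i k c r x : i != k -> divergence (rotation i k c r) x = 0.
Proof.
move=> ik; have ki : k != i by rewrite eq_sym.
rewrite /divergence (bigD1 i)//= (bigD1 k) ?ki//= big1 => [|l /andP[li lk]]; last first.
  rewrite (_ : (fun y => _) = fun=> 0) ?partial_cst//.
  by apply/funext => y; rewrite mxE (negbTE li) (negbTE lk).
rewrite addr0 (_ : (fun y => rotation i k c r y 0 i) = fun y => -1 * ((y 0 k - c 0 k) * bump c r y)); last first.
  by apply/funext => y; rewrite mxE eqxx mulN1r.
rewrite (_ : (fun y => rotation i k c r y 0 k) = fun y => (y 0 i - c 0 i) * bump c r y); last first.
  by apply/funext => y; rewrite mxE (negbTE ki) eqxx.
rewrite partialZ; last exact: C1M.
rewrite (partialM _ _ (C1_dcoord c k) (C1_bump c r)) (partialM _ _ (C1_dcoord c i) (C1_bump c r)) !partial_bump !partial_dcoord (negbTE ik) (negbTE ki).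
ring.
Qed.

Lemma solenoidal_field Omega : (2 <= n)%N -> open Omega -> Omega !=set0 ->
  exists tau K, [/\ compact K, K `<=` Omega, forall i, Ck 1 (fun x => tau x 0 i) &
    forall i, vanish_off K (fun x => tau x 0 i)] /\
    (forall x, divergence tau x = 0) /\ exists x, enorm (tau x) != 0.
Proof.
move=> n2 oO [c Oc].
pose i := Ordinal (ltnW n2); pose k := Ordinal n2.
have ik : i != k by [].
have /nbhs_ballP[e /= e0 eO] : nbhs c Omega by exact: open_nbhs_nbhs.
pose r := e / 2; have r0 : 0 < r by rewrite divr_gt0.
(* The bump lives on the Euclidean ball of radius [r], which lies inside this ball of the maximum
   norm. *)
exists (rotation i k c r), [set x | `|x - c| <= r]; split; split.
- apply: bounded_closed_compact.
    exists (`|c| + r); split; first exact: num_real.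
    move=> M hM x /= xr; apply: le_trans (ltW hM).
    by rewrite -(subrK c x); apply: le_trans (ler_normD _ _) _; rewrite addrC lerD2l.
  rewrite (_ : [set x | _] = (fun x : 'rV[R]_n => `|x - c|) @^-1` [set t | t <= r])//.
  apply: closed_comp; last exact: closed_le.
  move=> x _; apply: (@continuous_comp _ _ _ (fun x : 'rV[R]_n => x - c) (fun y => `|y|)).
    by apply: differentiable_continuous.
  exact: norm_continuous.
- by move=> x /= xr; apply: eO; rewrite /= -ball_normE /= distrC (le_lt_trans xr)// /r ltr_pdivrMr// ltr_pMr// ltr1n.
- by move=> l; exact: C1_rotation.
- move=> l x /= nx.
  have b0 : bump c r x = 0.
    rewrite /bump /pos2 max_r ?expr0n//= subr_le0 leNgt; apply/negP => h; apply: nx.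
    rewrite /Num.norm/= mx_normrE; apply: bigmax_le; first exact: ltW.
    move=> [a b] _ /=; rewrite !mxE (ord1 a) -ler_sqr ?nnegrE ?(ltW r0)// real_normK ?num_real//.
    apply: le_trans (ltW h); rewrite /sqr_dist (bigD1 b)//= -expr2 lerDl sumr_ge0// => m _.
    by rewrite -expr2 sqr_ge0.
  by rewrite mxE b0 !mulr0 oppr0; case: ifP => //; case: ifP.
- by move=> x; exact: divergence_rotation.
(* At this point the component [k] is [(r / 2) * bump], with a positive bump. *)
exists (c + (r / 2) *: delta_mx 0 i).
set x := c + _; apply/eqP => /enorm0_eq0 /rowP /(_ k); rewrite !mxE eqxx.
rewrite eq_sym (negbTE ik) !eqxx/= mulr1 [c 0 i + _]addrC addrK.
have E : sqr_dist c x = (r / 2) ^+ 2.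
  rewrite /sqr_dist (bigD1 i)//= big1 => [|l li].
    by rewrite !mxE !eqxx mulr1 addr0 [c 0 i + _]addrC addrK expr2.
  by rewrite !mxE (negbTE li) andbF mulr0 addr0 subrr mul0r.
have b0 : 0 < r ^+ 2 - (r / 2) ^+ 2 by rewrite subr_gt0 ltr_sqr ?nnegrE; lra.
by apply/eqP; rewrite /bump /pos2 E (max_l (ltW b0)) gt_eqF// mulr_gt0 ?divr_gt0// exprn_gt0.
Qed.

End solenoidal.

(** * Raising the supremum norm to 1 *)

Section unit_norm.
Context (R : realType) (n : nat).
Local Notation mu := (lebesgue_rV R n).
Local Notation field := ('rV[R]_n -> 'rV[R]_n).
Variables (Omega : set 'rV[R]_n) (mO : measurable Omega) (sigma tau : field) (B : R).
Hypotheses (sigma1 : ae_on Omega (fun x => enorm (sigma x) <= 1)).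
Hypotheses (tau_cont : forall i, continuous (fun x => tau x 0 i)).
Hypotheses (tauB : forall x, enorm (tau x) <= B) (tauO : forall x, enorm (tau x) != 0 -> Omega x).
Hypothesis tau0 : exists x, enorm (tau x) != 0.

Let U (m : R) := [set x | m < enorm (tau x)].

Let openU (m : R) : 0 <= m -> open (U m).
Proof.
move=> m0; rewrite (_ : U m = (fun x => \sum_(i < n) tau x 0 i ^+ 2) @^-1` [set t | m ^+ 2 < t]).
  apply: open_comp => [x _|]; last exact: open_gt.
  apply: (@continuous_sum_fun _ _ _ (fun i x => tau x 0 i ^+ 2)) => i y.
  exact: (continuousM (tau_cont (i := i) (x := y)) (tau_cont (i := i) (x := y))).
apply/seteqP; split => x /=; rewrite -enorm_sqr /U /= ltr_pXn2r ?nnegrE ?enorm_ge0//.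
Qed.

(** Take the supremum of the [t >= 0] whose norm is at most 1. It is finite because [tau] is bounded
    away from 0 on a set of positive measure, and there the norm is exactly 1 because it is
    Lipschitz in [t] with constant [B]. *)
Lemma unit_norm_correction : exists t : R,
  LpNorm Omega +oo%E (fun x => enorm (sigma x + t *: tau x)) = 1%E.
Proof.
have [y ty] := tau0; have ty0 : 0 < enorm (tau y) by rewrite lt_neqAle eq_sym ty enorm_ge0.
(* Half of the value at [y], so that [U m] is a nonempty open set and hence of positive measure. *)
pose m := enorm (tau y) / 2; have m0 : 0 < m by rewrite divr_gt0.
have UO : U m `<=` Omega by move=> x /= h; apply: tauO; rewrite gt_eqF// (lt_trans m0).
have oU : open (U m) by apply: openU; exact: ltW.
have muU : (0 < mu (U m))%E.
  by apply: open_gt0_rV => //; exists y; rewrite /U /= /m; lra.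
have mU : measurable (U m) by exact: open_measurable_rV.
have muO : (0 < mu Omega)%E by apply: (lt_le_trans muU); apply: le_measure; rewrite ?inE.
have B0 : 0 < B by exact: lt_le_trans ty0 (tauB y).
pose N t := LpNorm Omega +oo%E (fun x => enorm (sigma x + t *: tau x)).
have NP t (a : R) : 0 <= a -> (N t <= a%:E)%E <->
    ae_on Omega (fun x => enorm (sigma x + t *: tau x) <= a).
  move=> a0; rewrite /N (LpNormyP mO _ muO a0) /ae_on; split; apply: filterS => x h Ox.
    by have := h Ox; rewrite ger0_norm ?enorm_ge0.
  by rewrite ger0_norm ?enorm_ge0// h.
have N0 t : (0 <= N t)%E by exact: LpNorm_ge0.
have Nlip t t' (a : R) : 0 <= a -> (N t <= a%:E)%E -> (N t' <= (a + `|t' - t| * B)%:E)%E.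
  move=> a0 /(NP _ _ a0) h; apply/NP; first by rewrite addr_ge0// mulr_ge0// ltW.
  move: h; rewrite /ae_on; apply: filterS => x h Ox.
  rewrite (_ : sigma x + t' *: tau x = sigma x + t *: tau x + (t' - t) *: tau x); last first.
    by rewrite -addrA -scalerDl addrC [t + _]addrC subrK addrC.
  by apply: le_trans (enormD _ _) (lerD (h Ox) _); rewrite enormZ ler_wpM2l.
pose S := [set t : R | 0 <= t /\ (N t <= 1)%E].
have S0 : S 0.
  split => //; apply/(NP _ _ ler01); move: sigma1; rewrite /ae_on; apply: filterS => x h Ox.
  by rewrite scale0r addr0 h.
(* Almost everywhere on [U m] the triangle inequality bounds [t m] by
   [|sigma + t tau| + |sigma| <= 2]. *)
have Sub : ubound S (2 / m).
  move=> t [t0 /(NP _ _ ler01)]; move: sigma1; rewrite /ae_on => h1 h2.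
  have [//|tm] := leP t (2 / m); exfalso.
  have : {ae mu, forall x, ~ U m x}.
    apply: filterS2 h1 h2 => x a1 a2 Ux; have Ox := UO _ Ux.
    have : t * m < t * enorm (tau x).
      by rewrite ltr_pM2l//; apply: le_lt_trans tm; rewrite divr_ge0// ltW.
    have -> : t * enorm (tau x) = enorm (sigma x + t *: tau x - sigma x).
      by rewrite addrC addKr enormZ ger0_norm.
    move=> /lt_le_trans /(_ (enormB _ _)).
    have := a1 Ox; have := a2 Ox; move: tm; rewrite ltr_pdivrMr//; lra.
  move=> [Z [mZ Z0 UZ]]; have : (mu (U m) <= mu Z)%E.
    by apply: le_measure; rewrite ?inE// => x Ux; apply: UZ => /=; apply.
  by rewrite Z0 leNgt muU.
have hS : has_sup S by split; [exists 0|exists (2 / m)].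
pose t := sup S.
have t0 : 0 <= t by apply: ub_le_sup => //; case: hS.
have Nt1 : (N t <= 1)%E.
  apply/lee_addgt0Pr => e e0.
  have [s [s0 s1] st] := sup_adherent (divr_gt0 e0 B0) hS.
  have sl : s <= t by apply: ub_le_sup => //; case: hS.
  apply: le_trans (Nlip s t 1 ler01 s1) _; rewrite -EFinD lee_fin lerD2l.
  rewrite ger0_norm ?subr_ge0// -ler_pdivlMr//; move: st; rewrite -/t; lra.
exists t; apply/eqP; rewrite -/(N t) eq_le Nt1 leNgt; apply/negP => lt1.
have NtE : N t = (fine (N t))%:E by rewrite fineK// ge0_fin_numE// (le_lt_trans Nt1)// ltry.
pose a := fine (N t); have a0 : 0 <= a by rewrite fine_ge0.
have a1 : a < 1 by rewrite -lte_fin -NtE.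
(* If the norm [a] were below 1, the Lipschitz bound would let [t] grow by this amount. *)
pose d := (1 - a) / B; have d0 : 0 < d by rewrite divr_gt0// subr_gt0.
have : S (t + d).
  split; first by rewrite addr_ge0// ltW.
  have : (N t <= a%:E)%E by rewrite NtE.
  move=> /(Nlip t (t + d) a a0) /le_trans; apply.
  rewrite [t + d]addrC addrK (gtr0_norm d0) /d divfK ?gt_eqF// lee_fin; lra.
move=> /ub_le_sup; move/(_ (proj2 hS)); rewrite -/t; lra.
Qed.

End unit_norm.

(** * Optimality system *)

Section optimality_system.
Context (R : realType) (n : nat).
Local Notation mu := (lebesgue_rV R n).
Local Notation field := ('rV[R]_n -> 'rV[R]_n).
Variables (Omega : set 'rV[R]_n) (oO : open Omega) (muO : (mu Omega < +oo)%E).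
Variables (ul uu : R) (lu : ul <= uu).
Local Notation U := (Uad Omega ul uu).
Local Notation I f := (\int[mu]_(x in Omega) f x).
Local Notation L1 f := (mu.-integrable Omega (EFin \o f)).
Implicit Types (u w f g : 'rV[R]_n -> R).

Let mO : measurable Omega. Proof. exact: open_measurable_rV. Qed.

Lemma Uad_representative u : U u -> exists w, [/\ measurable_fun Omega w,
  forall x, ul <= w x <= uu & ae_on Omega (fun x => u x = w x)].
Proof.
move=> Uu; exists (fun x => Num.min (Num.max (u x) ul) uu); split.
- by apply: measurable_minr => //; apply: measurable_maxr => //; exact: Uad_measurable Uu.
- move=> x; have h := lu; case: (leP (u x) ul) => a; first by rewrite (min_l h) lexx h.
  by case: (leP (u x) uu) => b; apply/andP; split; lra.
case: Uu => _; rewrite /ae_on; apply: filterS => x h Ox.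
by have /andP[a b] := h Ox; rewrite (max_l a) (min_l b).
Qed.

Lemma TV_bound_ae u w (M : R) : L1 u -> L1 w -> ae_on Omega (fun x => u x = w x) ->
  TV_bound Omega u M -> TV_bound Omega w M.
Proof.
move=> lU lw uw uM phi tp; rewrite -(@Rint_ae_eq _ _ _ mu _ mO (fun x => u x * divergence phi x)).
- exact: uM.
- by apply: L1_measurable; exact: L1_divergence.
- by apply: L1_measurable; exact: L1_divergence.
by move: uw; rewrite /ae_on; apply: filterS => x h Ox; rewrite h.
Qed.

Lemma bounded_Uad w (M : R) : measurable_fun Omega w -> (forall x, ul <= w x <= uu) ->
  TV_bound Omega w M -> U w.
Proof.
move=> mw wb wM; split; last by apply: nearW => x _; exact: wb.
split; last by apply: le_lt_trans (ltry M); exact/TV_leP.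
apply: (@bounded_in_Lp _ _ _ mO _ _ (`|ul| + `|uu|)) => // x _; exact: ler_norm_between (wb x).
Qed.

Variables (g0 ubar : 'rV[R]_n -> R).
Hypotheses (lg : L1 g0) (Ub : U ubar).
Hypothesis stationary : forall u, U u ->
  fine (TV Omega ubar) <= fine (TV Omega u) + I (fun x => g0 x * (u x - ubar x)).

(** With [p = (th - 1) g0], the dual value equals [int p ubar - A - B + int g0 ubar]. It is at least
    the primal value [tv + int g0 ubar], while [int p ubar <= tv] and [A, B >= 0]; so equality holds
    throughout, which gives both complementarity relations and the attained variation. *)
Lemma optimality_system : exists (sigma : field) (th : 'rV[R]_n -> R),
  [/\ forall i, measurable_fun Omega (fun x => sigma x 0 i),
      ae_on Omega (fun x => enorm (sigma x) <= 1),
      measurable_fun Omega th & forall x, 0 <= th x <= 1] /\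
  [/\ forall psi : 'rV[R]_n -> R, Ck 1 psi -> csupp Omega psi ->
        I (fun x => \sum_(i < n) sigma x 0 i * partial i psi x) =
        - I (fun x => (th x - 1) * g0 x * psi x),
      forall u, U u -> I (fun x => (th x - 1) * g0 x * u x) <= fine (TV Omega u),
      I (fun x => (th x - 1) * g0 x * ubar x) = fine (TV Omega ubar),
      I (fun x => th x * Num.max (g0 x) 0 * (ubar x - ul)) = 0 &
      I (fun x => th x * Num.max (- g0 x) 0 * (uu - ubar x)) = 0].
Proof.
set tv := fine (TV Omega ubar).
(* [dual_solution] asks for the bounds at every point. It is applied to the representative [ub], and
   the conclusions are carried back along [ubE]. *)
have [ub [mub ub_bnd ubE]] := Uad_representative Ub.
have wb w : (forall x, ul <= w x <= uu) -> forall x, `|w x| <= `|ul| + `|uu|.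
  by move=> h x; exact: ler_norm_between (h x).
have lw w : measurable_fun Omega w -> (forall x, ul <= w x <= uu) -> L1 w.
  by move=> mw h; apply: (@L1_bounded _ _ _ _ _ mO _ (`|ul| + `|uu|)) => // x _; exact: wb.
have lMw f w : L1 f -> measurable_fun Omega w -> (forall x, ul <= w x <= uu) -> L1 (fun x => f x * w x).
  move=> lf mw h; under eq_fun do rewrite mulrC.
  by apply: (@L1Ml _ _ _ _ _ mO _ _ (`|ul| + `|uu|)) => // x _; exact: wb.
have aeI f u w : measurable_fun Omega f -> measurable_fun Omega u -> measurable_fun Omega w ->
    ae_on Omega (fun x => u x = w x) -> I (fun x => f x * u x) = I (fun x => f x * w x).
  move=> mf mu_ mw uw; apply: Rint_ae_eq => //; try exact: measurable_funM.
  by move: uw; rewrite /ae_on; apply: filterS => x h Ox; rewrite h.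
have mg := L1_measurable lg; have mb := Uad_measurable oO muO Ub.
have TVw u w : U u -> measurable_fun Omega w -> (forall x, ul <= w x <= uu) ->
    ae_on Omega (fun x => u x = w x) -> TV_bound Omega w (fine (TV Omega u)).
  move=> Uu mw h uw; apply: (TV_bound_ae (Uad_L1 oO muO Uu) (lw _ mw h) uw).
  exact: (Uad_TV_bound oO Uu).
have optimal w M : measurable_fun Omega w -> (forall x, ul <= w x <= uu) -> TV_bound Omega w M ->
    tv + I (fun x => g0 x * ub x) <= M + I (fun x => g0 x * w x).
  move=> mw wbd wM; have Uw := bounded_Uad mw wbd wM.
  have := stationary Uw.
  have := lMw g0 w lg mw wbd; have := lMw g0 ub lg mub ub_bnd => l1 l2.
  have -> : I (fun x => g0 x * (w x - ubar x)) = I (fun x => g0 x * w x) - I (fun x => g0 x * ub x).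
    rewrite (aeI g0 (fun x => w x - ubar x) (fun x => w x - ub x)) => //.
    - by rewrite -RintegralB//; apply: eq_Rintegral => x _; ring.
    - exact: measurable_funB.
    - exact: measurable_funB.
    by move: ubE; rewrite /ae_on; apply: filterS => x h Ox; rewrite h.
  have : fine (TV Omega w) <= M by rewrite -lee_fin -(Uad_TV oO Uw); exact/TV_leP.
  rewrite -/tv; lra.
have [sigma [th [[msigma sigma1 mth th01] [weak bound value]]]] := dual_solution oO muO lg lu mub
  (fun x _ => ub_bnd x) (TVw _ _ Ub mub ub_bnd ubE) optimal.
pose p x := (th x - 1) * g0 x.
have lth f : L1 f -> L1 (fun x => th x * f x).
  move=> lf; apply: (@L1Ml _ _ _ _ _ mO _ _ 1) => // x _.
  by have /andP[? ?] := th01 x; rewrite ger0_norm.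
have lp : L1 p.
  apply: (@L1Ml _ _ _ _ _ mO _ _ 1) => //; first exact: measurable_funB.
  by move=> x _; have /andP[? ?] := th01 x; rewrite ler_norml; apply/andP; split; lra.
have mp := L1_measurable lp.
have lgp : L1 (fun x => Num.max (g0 x) 0).
  apply: (L1_dom mO _ _ (L1_abs lg)); first exact: measurable_maxr.
  by move=> x _; case: (leP (g0 x) 0) => h; rewrite ?normr0.
have mgn : measurable_fun Omega (fun x => - g0 x) by exact: measurableT_comp.
have lgn : L1 (fun x => Num.max (- g0 x) 0).
  apply: (L1_dom mO _ _ (L1_abs lg)); first exact: measurable_maxr.
  by move=> x _; case: (leP (- g0 x) 0) => h; rewrite ?normr0// normrN.
have ltgp := lth _ lgp; have ltgn := lth _ lgn.
have bound_U u : U u -> I (fun x => p x * u x) <= fine (TV Omega u).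
  move=> Uu; have [w [mw w_bnd uw]] := Uad_representative Uu.
  rewrite (aeI p u w mp (Uad_measurable oO muO Uu) mw uw).
  exact: (bound w (`|ul| + `|uu|) _ mw (fun x _ => wb _ w_bnd x) (TVw _ _ Uu mw w_bnd uw)).
(* [A] and [B] are the complementarity defects at the lower and the upper bound. *)
pose A := I (fun x => th x * Num.max (g0 x) 0 * (ub x - ul)).
pose B := I (fun x => th x * Num.max (- g0 x) 0 * (uu - ub x)).
have lA : L1 (fun x => th x * Num.max (g0 x) 0 * (ub x - ul)).
  have -> : (fun x => th x * Num.max (g0 x) 0 * (ub x - ul)) =
      fun x => th x * Num.max (g0 x) 0 * ub x - ul * (th x * Num.max (g0 x) 0).
    by apply/funext => x; ring.
  by apply: L1B => //; [exact: lMw|exact: L1Z].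
have lB : L1 (fun x => th x * Num.max (- g0 x) 0 * (uu - ub x)).
  have -> : (fun x => th x * Num.max (- g0 x) 0 * (uu - ub x)) =
      fun x => uu * (th x * Num.max (- g0 x) 0) - th x * Num.max (- g0 x) 0 * ub x.
    by apply/funext => x; ring.
  by apply: L1B => //; [exact: L1Z|exact: lMw].
have A0 : 0 <= A.
  apply: Rintegral_ge0 => x _; have /andP[a _] := th01 x; have /andP[b _] := ub_bnd x.
  by rewrite !mulr_ge0 ?subr_ge0// le_max lexx orbT.
have B0 : 0 <= B.
  apply: Rintegral_ge0 => x _; have /andP[a _] := th01 x; have /andP[_ b] := ub_bnd x.
  by rewrite !mulr_ge0 ?subr_ge0// le_max lexx orbT.
have lpub := lMw p ub lp mub ub_bnd; have lgub := lMw g0 ub lg mub ub_bnd.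
have E : I (fun x => th x * cost g0 ul uu x) = I (fun x => p x * ub x) - A - B + I (fun x => g0 x * ub x).
  rewrite /A /B -RintegralB// -RintegralB//; last exact: L1B.
  rewrite -RintegralD//; last by apply: L1B => //; exact: L1B.
  apply: eq_Rintegral => x _; rewrite /cost /p.
  have -> : Num.min (g0 x) 0 = - Num.max (- g0 x) 0.
    by case: (leP (g0 x) 0) => h; [rewrite max_l ?opprK// oppr_ge0|rewrite max_r ?oppr0// oppr_le0 ltW].
  have gE : g0 x = Num.max (g0 x) 0 - Num.max (- g0 x) 0.
    case: (leP (g0 x) 0) => h; [rewrite max_l ?opprK ?add0r// oppr_ge0//|].
    by rewrite max_r ?subr0// oppr_le0 ltW.
  by move: gE; move: (Num.max (g0 x) 0) (Num.max (- g0 x) 0) => a b ->; ring.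
have le_tv := bound_U _ Ub; rewrite (aeI p ubar ub mp mb mub ubE) -/tv in le_tv.
have [AE BE pE] : [/\ A = 0, B = 0 & I (fun x => p x * ub x) = tv].
  move: value le_tv A0 B0; rewrite E /=; clear E; move: A B (I (fun x => p x * ub x)) (I (fun x => g0 x * ub x)) => /=.
  by rewrite /tv; move: (fine _) => t a b r s h1 h2 h3 h4; split; lra.
exists sigma, th; split; split => //.
- by rewrite (aeI p ubar ub mp mb mub ubE).
- rewrite -[RHS]AE; apply: (aeI (fun x => th x * Num.max (g0 x) 0)).
  + exact: L1_measurable ltgp.
  + exact: measurable_funB.
  + exact: measurable_funB.
  by move: ubE; rewrite /ae_on; apply: filterS => x h Ox; rewrite h.
- rewrite -[RHS]BE; apply: (aeI (fun x => th x * Num.max (- g0 x) 0)).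
  + exact: L1_measurable ltgn.
  + exact: measurable_funB.
  + exact: measurable_funB.
  by move: ubE; rewrite /ae_on; apply: filterS => x h Ox; rewrite h.
Qed.

End optimality_system.

Theorem theorem3p10 (R : realType) (d : nat) (hd : (2 <= d)%N)
    (alpha : R) (halpha : 0 < alpha <= 1)
    (Omega : set 'rV[R]_d) (hOmega : bounded_domain alpha Omega)
    (ul uu : R) (hul : 0 < ul) (hluu : ul <= uu)
    (s q : R) (hs : 2 < s) (hq : 2 * s / (s - 2) < q)
    (j : ('rV[R]_d -> R) -> R)
    (* j is defined on equivalence classes modulo null sets *)
    (hj_ae : forall u v, Uad Omega ul uu u -> Uad Omega ul uu v ->
       ae_on Omega (fun x => u x = v x) -> j u = j v)
    (dj : ('rV[R]_d -> R) -> ('rV[R]_d -> R) -> R)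
    (gradj : ('rV[R]_d -> R) -> 'rV[R]_d -> R)
    (hdj : forall u, Uad Omega ul uu u ->
       feasible_derivative Omega q (Uad Omega ul uu) j u (dj u))
    (hgradj : forall u, Uad Omega ul uu u ->
       represents Omega q (gradj u) (dj u))
    (hLip : exists L : R, forall u v, Uad Omega ul uu u -> Uad Omega ul uu v ->
       (LpNorm Omega (q / (q - 1))%:E (fun x => (gradj u x - gradj v x)%R) <=
        L%:E * LpNorm Omega q%:E (fun x => (u x - v x)%R))%E)
    (ubar : 'rV[R]_d -> R)
    (hmin : local_minimizer Omega q (Uad Omega ul uu) j ubar) :
  exists (sigma : 'rV[R]_d -> 'rV[R]_d)
         (divsigma lambdal lambdau : 'rV[R]_d -> R),
    [/\ in_Linfty_vec Omega sigma,
        weak_divergence Omega sigma divsigma,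
        in_Lp Omega (q / (q - 1))%:E divsigma,
        in_Lp Omega (q / (q - 1))%:E lambdal &
        in_Lp Omega (q / (q - 1))%:E lambdau] /\
    [/\ ae_on Omega (fun x =>
          - divsigma x - lambdal x + lambdau x = - gradj ubar x),
        ae_on Omega (fun x => 0 <= lambdal x),
        ae_on Omega (fun x => 0 <= lambdau x),
        integral_on Omega (fun x => lambdal x * (ul - ubar x)) = 0 &
        integral_on Omega (fun x => lambdau x * (ubar x - uu)) = 0] /\
    [/\ LpNorm Omega +oo%E (fun x => enorm (sigma x)) = 1%E,
        TV Omega ubar =
          (- integral_on Omega (fun x => (ubar x * divsigma x)%R))%:E &
        forall u, Uad Omega ul uu u ->
          ((- integral_on Omega (fun x => (divsigma x * (u x - ubar x))%R))%:E
           <= TV Omega u - TV Omega ubar)%E].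
Proof.
have [[oO _ O0 bO] _] := hOmega.
have mO := open_measurable_rV oO.
have muO := bounded_finite_rV mO bO.
have s2 : 0 < s - 2 by rewrite subr_gt0.
(* Because [2 s > 2 (s - 2)], the lower bound on [q] exceeds 2. *)
have q2 : 2 < q by apply: lt_trans hq; rewrite ltr_pdivlMr//; lra.
have q1 : 1 < q by apply: lt_trans q2; rewrite ltr1n.
have [Ub _] := hmin; have rep := hgradj _ Ub; have der := hdj _ Ub.
pose g0 := gradj ubar; pose p' := q / (q - 1).
have gp : in_Lp Omega p'%:E g0 by case: rep.
have p'0 : 0 < p' by exact: lt_trans ltr01 (conjugate_gt1 q1).
have lg : (lebesgue_rV R d).-integrable Omega (EFin \o g0).
  exact: (gradient_L1 oO muO q1 rep).
have [sg [th [[msg sg1 mth th01] [weak bound attained cl cu]]]] := optimality_system oO muO hluu lg Ub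
  (fun u Uu => first_order_condition oO muO q1 der rep hmin Uu).
have [tau [K [[cK KO C1tau vtau] [divtau tau0]]]] := solenoidal_field hd oO O0.
have ctau i : continuous (fun x => tau x 0 i) by exact: C1_continuous.
have tauK x : ~ K x -> tau x = 0 by move=> nK; apply/rowP => i; rewrite (vtau i)// mxE.
have [B B0 tauB] : exists2 B : R, 0 < B & forall x, enorm (tau x) <= B.
  have cn : continuous (fun x => enorm (tau x)).
    move=> x; apply: (@continuous_comp _ _ _ (fun x => \sum_(i < d) tau x 0 i ^+ 2) Num.sqrt).
      apply: (@continuous_sum_fun _ _ _ (fun i x => tau x 0 i ^+ 2)) => i y.
      exact: (continuousM (ctau i y) (ctau i y)).
    exact: sqrt_continuous.
  have vn : vanish_off K (fun x => enorm (tau x)).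
    by move=> x /tauK ->; rewrite -[X in enorm X](scale0r 0) enormZ normr0 mul0r.
  have [B B0 h] := compact_continuous_bounded cK cn vn; exists B => // x.
  exact: le_trans (ler_norm _) (h x).
have tauO x : enorm (tau x) != 0 -> Omega x.
  move=> t0; apply: contrapT => nO; move/eqP: t0; apply.
  by rewrite tauK => [|/KO//]; rewrite -[X in enorm X](scale0r 0) enormZ normr0 mul0r.
have sgN1 : ae_on Omega (fun x => enorm (- sg x) <= 1).
  by move: sg1; rewrite /ae_on; apply: filterS => x h Ox; rewrite enormN h.
have [t normE] := unit_norm_correction mO sgN1 ctau tauB tauO tau0.
set mu := lebesgue_rV R d in lg *.
(* The field [sg] has weak divergence [(th - 1) g0], opposite to the sign wanted here, hence [- sg];
   adding [t *: tau] leaves the divergence unchanged. *)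
pose sigma x := - sg x + t *: tau x.
pose divsigma x := (1 - th x) * g0 x.
pose lambdal x := th x * Num.max (g0 x) 0.
pose lambdau x := th x * Num.max (- g0 x) 0.
have mg := L1_measurable lg.
have mgn : measurable_fun Omega (fun x => - g0 x) by exact: measurableT_comp.
have mtau i : measurable_fun Omega (fun x => tau x 0 i).
  by apply: measurable_funTS; exact: continuous_measurable_rV.
pose p x := (th x - 1) * g0 x.
have lp : mu.-integrable Omega (EFin \o p).
  apply: (@L1Ml _ _ _ _ _ mO _ _ 1) => //; first exact: measurable_funB.
  by move=> x _; have /andP[? ?] := th01 x; rewrite ler_norml; apply/andP; split; lra.
have lMU f u : mu.-integrable Omega (EFin \o f) -> Uad Omega ul uu u ->
    mu.-integrable Omega (EFin \o (fun x => f x * u x)).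
  move=> lf Uu; apply: (@ae_bounded_L1M _ _ _ oO _ _ (`|ul| + `|uu|)) => //; first exact: Uad_measurable Uu.
  case: Uu => _; rewrite /ae_on; apply: filterS => x h Ox; exact: ler_norm_between (h Ox).
have lpU u : Uad Omega ul uu u -> mu.-integrable Omega (EFin \o (fun x => p x * u x)).
  exact: lMU.
have lmult (f : 'rV[R]_d -> R) : mu.-integrable Omega (EFin \o f) ->
    mu.-integrable Omega (EFin \o (fun x => th x * Num.max (f x) 0)).
  move=> lf; have mf := L1_measurable lf.
  apply: (L1_dom mO _ _ (L1_abs lf)); first by apply: measurable_funM => //; exact: measurable_maxr.
  move=> x _; rewrite normrM; have /andP[a b] := th01 x; rewrite (ger0_norm a) -[leRHS]mul1r.
  by apply: ler_pM => //; case: (leP (f x) 0) => h; rewrite ?normr0.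
have IpN (f g : 'rV[R]_d -> R) : mu.-integrable Omega (EFin \o f) -> (forall x, g x = - f x) ->
    integral_on Omega f = - integral_on Omega g.
  move=> lf fg; rewrite /integral_on (_ : g = fun x => -1 * f x); last by apply/funext => x; rewrite fg mulN1r.
  by rewrite RintegralZl// mulN1r opprK.
exists sigma, divsigma, lambdal, lambdau; split; [split|split; split].
- split; last by rewrite normE ltry.
  move=> i; rewrite /sigma; under eq_fun do rewrite !mxE.
  by apply: measurable_funD; [exact: measurableT_comp|exact: measurable_funM].
- move=> psi /(_ 1%N) Cpsi /compactly_supported_vanish_off spsi.
  have [K' [cK' KO' psiK']] := spsi.
  have [b b0 psib] := compact_continuous_bounded cK' (C1_continuous Cpsi) psiK'.
  have mpsi : measurable_fun Omega psi.
    by apply: measurable_funTS; apply: continuous_measurable_rV; exact: C1_continuous.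
  have lpart i : mu.-integrable Omega (EFin \o partial i psi).
    apply: (integrableS measurableT) => //.
    by apply: (L1_continuous_compact cK' (C1_partial_continuous (i := i) Cpsi)); exact: C1_vanish_partial.
  have l1 : mu.-integrable Omega (EFin \o (fun x => \sum_(i < d) sg x 0 i * partial i psi x)).
    apply: (L1_sum mO) => i; under eq_fun do rewrite mulrC.
    apply: (@ae_bounded_L1M _ _ _ oO _ _ 1) => //.
    by move: sg1; rewrite /ae_on; apply: filterS => x h Ox; exact: le_trans (coord_le_enorm _ _) (h Ox).
  have l2 : mu.-integrable Omega (EFin \o (fun x => \sum_(i < d) tau x 0 i * partial i psi x)).
    apply: (L1_sum mO) => i; apply: (@L1Ml _ _ _ _ _ mO _ _ B) => // x _.
    exact: le_trans (coord_le_enorm _ _) (tauB x).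
  have -> : integral_on Omega (fun x => \sum_(i < d) sigma x 0 i * partial i psi x) =
      -1 * integral_on Omega (fun x => \sum_(i < d) sg x 0 i * partial i psi x) +
      t * integral_on Omega (fun x => \sum_(i < d) tau x 0 i * partial i psi x).
    rewrite /integral_on -!RintegralZl// -RintegralD//; [|exact: L1Z|exact: L1Z].
    apply: eq_Rintegral => x _; rewrite !mulr_sumr -big_split/=; apply: eq_bigr => i _.
    by rewrite /sigma !mxE; ring.
  (* Integration by parts moves the derivative onto [tau], whose divergence is 0. *)
  have -> : integral_on Omega (fun x => \sum_(i < d) tau x 0 i * partial i psi x) = 0.
    rewrite /integral_on (integration_by_parts_compact cK KO C1tau vtau Cpsi).
    by under eq_Rintegral do rewrite divtau mul0r; rewrite Rintegral_cst// mul0r oppr0.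
  rewrite mulr0 addr0 mulN1r /integral_on (weak psi Cpsi spsi) opprK.
  apply: IpN => [|x]; last by rewrite /divsigma; ring.
  under eq_fun do rewrite -/(p _) mulrC.
  by apply: (@L1Ml _ _ _ _ _ mO _ _ b).
(* The divergence and both multipliers are dominated by [|g0|], which lies in L^q'. *)
- apply: (in_Lp_le mO p'0 _ _ gp); first by apply: measurable_funM => //; exact: measurable_funB.
  move=> x _; rewrite normrM ler_piMl//; have /andP[a b] := th01 x.
  by rewrite ler_norml; apply/andP; split; lra.
- apply: (in_Lp_le mO p'0 _ _ gp); first by apply: measurable_funM => //; exact: measurable_maxr.
  move=> x _; rewrite normrM; have /andP[a b] := th01 x; rewrite (ger0_norm a) -[leRHS]mul1r.
  by apply: ler_pM => //; case: (leP (g0 x) 0) => h; rewrite ?normr0.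
- apply: (in_Lp_le mO p'0 _ _ gp); first by apply: measurable_funM => //; exact: measurable_maxr.
  move=> x _; rewrite normrM; have /andP[a b] := th01 x; rewrite (ger0_norm a) -[leRHS]mul1r.
  by apply: ler_pM => //; case: (leP (- g0 x) 0) => h; rewrite ?normr0// normrN.
(* Of [g0 = g0^+ - g0^-], the share [th] is carried by the multipliers and the share [1 - th] by the
   divergence. *)
- apply: nearW => x _; rewrite /divsigma /lambdal /lambdau -/g0.
  by case: (leP (g0 x) 0) => h; [rewrite max_l ?oppr_ge0//|rewrite max_r ?oppr_le0 ?(ltW h)//]; ring.
- apply: nearW => x _; have /andP[a b] := th01 x.
  by rewrite /lambdal mulr_ge0// le_max lexx orbT.
- apply: nearW => x _; have /andP[a b] := th01 x.
  by rewrite /lambdau mulr_ge0// le_max lexx orbT.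
- rewrite -[RHS]oppr0 -[X in _ = - X]cl; apply: IpN => [|x]; last by rewrite /lambdal; ring.
  rewrite (_ : (fun x => _) = fun x => ul * lambdal x - lambdal x * ubar x); last by apply/funext => x; ring.
  by apply: (L1B mO); [apply: (L1Z mO); exact: lmult|apply: lMU => //; exact: lmult].
- rewrite -[RHS]oppr0 -[X in _ = - X]cu; apply: IpN => [|x]; last by rewrite /lambdau; ring.
  have lgn := L1N lg.
  rewrite (_ : (fun x => _) = fun x => lambdau x * ubar x - uu * lambdau x); last by apply/funext => x; ring.
  by apply: (L1B mO); [apply: lMU => //; exact: lmult|apply: (L1Z mO); exact: lmult].
- exact: normE.
- rewrite (Uad_TV oO Ub) -attained; congr (_%:E).
  by apply: IpN => [|x]; [exact: lpU|rewrite /divsigma; ring].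
- move=> u Uu; rewrite (Uad_TV oO Ub) (Uad_TV oO Uu) -EFinB lee_fin -attained.
  have -> : - integral_on Omega (fun x => divsigma x * (u x - ubar x)) =
      integral_on Omega (fun x => p x * u x) - integral_on Omega (fun x => p x * ubar x).
    rewrite /integral_on -RintegralB//; [|exact: lpU|exact: lpU].
    rewrite -(IpN (fun x => p x * u x - p x * ubar x))//.
      by apply: (L1B mO); exact: lpU.
    by move=> x; rewrite /divsigma /p; ring.
  by rewrite lerD2r; exact: bound.
Qed.
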